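(* Let $\varphi_0\in\mathbb R$, $\alpha_2\in(-1,1)$, $\beta\neq0$, $T>0$, and let $\gamma_2(t)=\gamma_2(\varphi_0,\alpha_2,\beta;t)$, $0\le t\le T$, be a noncontinuable shortest arc of the sub-Riemannian space $(SO_0(2,1)\times\mathbb R,\rho_2)$. Then: 1. If $0<\frac{|\beta|}{\sqrt{1-\alpha_2^2}}<1$, then $T\in\left(\frac{\pi}{|\beta|},\frac{2\pi}{|\beta|}\right)$ and $T$ satisfies the system $$\cos\frac{|\beta|T}{2}=-\frac{|\beta|\sinh(T\sqrt{1-\alpha_2^2-\beta^2}/2)}{\sqrt{(1-\alpha_2^2)\cosh^2(T\sqrt{1-\alpha_2^2-\beta^2}/2)-\beta^2}},$$ $$\sin\frac{|\beta|T}{2}=\frac{\sqrt{1-\alpha_2^2-\beta^2}\cosh(T\sqrt{1-\alpha_2^2-\beta^2}/2)}{\sqrt{(1-\alpha_2^2)\cosh^2(T\sqrt{1-\alpha_2^2-\beta^2}/2)-\beta^2}}.$$ 2. If $\frac{|\beta|}{\sqrt{1-\alpha_2^2}}=1$, then $T\in\left(\frac{\pi}{|\beta|},\frac{2\pi}{|\beta|}\right)$ and $T$ satisfies the system $$\cos\frac{|\beta|T}{2}=-\frac{|\beta|T/2}{\sqrt{1+\beta^2T^2/4}},\qquad\sin\frac{|\beta|T}{2}=\frac{1}{\sqrt{1+\beta^2T^2/4}}.$$ 3. If $1<\frac{|\beta|}{\sqrt{1-\alpha_2^2}}<\frac{2}{\sqrt3}$, then $T\in\left(\frac{\pi}{|\beta|},\frac{2\pi}{|\beta|}\right)$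 and $T$ satisfies the system $$\cos\frac{|\beta|T}{2}=-\frac{|\beta|\sin(T\sqrt{\alpha_2^2+\beta^2-1}/2)}{\sqrt{\beta^2-(1-\alpha_2^2)\cos^2(T\sqrt{\alpha_2^2+\beta^2-1}/2)}},$$ $$\sin\frac{|\beta|T}{2}=\frac{\sqrt{\alpha_2^2+\beta^2-1}\cos(T\sqrt{\alpha_2^2+\beta^2-1}/2)}{\sqrt{\beta^2-(1-\alpha_2^2)\cos^2(T\sqrt{\alpha_2^2+\beta^2-1}/2)}}.$$ 4. If $\frac{|\beta|}{\sqrt{1-\alpha_2^2}}=\frac{2}{\sqrt3}$, then $T=\frac{2\pi}{|\beta|}$. 5. If $\frac{2}{\sqrt3}<\frac{|\beta|}{\sqrt{1-\alpha_2^2}}<\frac{3}{\sqrt5}$, then $T\in\left(\frac{2\pi}{|\beta|},\frac{3\pi}{|\beta|}\right)$ and $T$ satisfies the same system of two equations as displayed in item 3. 6. If $\frac{|\beta|}{\sqrt{1-\alpha_2^2}}\ge\frac{3}{\sqrt5}$, then $T=\frac{2\pi}{\sqrt{\beta^2+\alpha_2^2-1}}$.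
   Context: $SO_0(2,1)=\{g\in GL(3,\mathbb R)\mid g^TJg=J,\ \det g=1,\ g_{11}>0\}$ with $J=\mathrm{diag}(-1,1,1)$. $SO_0(2,1)\times\mathbb R$ is the group of $4\times4$ block-diagonal matrices $(C,v):=\mathrm{diag}(C,e^v)$ with $C\in SO_0(2,1)$, $v\in\mathbb R$. Its Lie algebra has basis $E_1=e_{13}+e_{31}$, $E_2=e_{12}+e_{21}$, $E_3=e_{23}-e_{32}$, $E_4=e_{44}$ ($e_{ij}$ with double indices are $4\times4$ matrix units). Put $e_1=E_1$, $e_2=E_4$, $e_3=E_2$, $e_4=-E_3$. $\rho_2$ is the left-invariant sub-Riemannian metric defined by the left-invariant distribution with value $\mathrm{span}(e_1,e_2,e_3)$ at the unit $\mathrm{Id}$ and the inner product with orthonormal basis $e_1,e_2,e_3$. For $\alpha_2\neq\pm1$, $\gamma_2(\varphi_0,\alpha_2,\beta;t)=\exp(t(\alpha_1e_1+\alpha_2e_2+\alpha_3e_3+\beta e_4))\exp(-t\beta e_4)$, where $\alpha_1=\sqrt{1-\alpha_2^2}\sin\varphi_0$, $\alpha_3=\sqrt{1-\alpha_2^2}\cos\varphi_0$; it is an arclength-parametrized geodesic of $\rho_2$. A shortest arc is a curve whose length equals the distance between its endpoints; a shortest arc $\gamma(t)$, $0\le t\le T$, is noncontinuable if it cannot be extended beyond $\gamma(T)$ to a longer shortest arc. *)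

(* Defs.v *)
From HB Require Import structures.
From mathcomp Require Import all_boot all_order all_algebra.
From mathcomp Require Import all_classical all_reals all_analysis.

Set Implicit Arguments.
Unset Strict Implicit.
Unset Printing Implicit Defensive.

Import Order.TTheory GRing.Theory Num.Theory.
Import numFieldNormedType.Exports.

Local Open Scope classical_set_scope.
Local Open Scope ring_scope.

Section Hyperbolic.
Context {R : realType}.
Implicit Type x : R.

Definition sinh x : R := (expR x - expR (- x)) / 2.
Definition cosh x : R := (expR x + expR (- x)) / 2.

End Hyperbolic.

Section Group.
Context {R : realType}.

Definition mxexp n (A : 'M[R]_n.+1) : 'M[R]_n.+1 :=
  limn (series (fun k : nat => (k`!%:R : R)^-1 *: A ^+ k)).

Definition Jmx : 'M[R]_3 := diag_mx (\row_i (if i == 0 then -1 else 1)).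

Definition SO0_21 : set 'M[R]_3 :=
  [set C | [/\ C^T *m Jmx *m C = Jmx, \det C = 1 & 0 < C 0 0]].

Definition blockCv (C : 'M[R]_3) (v : R) : 'M[R]_4 :=
  (block_mx C 0 0 (expR v)%:M : 'M[R]_(3 + 1)).

Definition SO0_21xR : set 'M[R]_4 :=
  [set g | exists C v, SO0_21 C /\ g = blockCv C v].

(* Matrix indices start at 0, so the matrix unit e_ij is
   [delta_mx (i - 1) (j - 1)]. *)
Definition E1 : 'M[R]_4 := delta_mx 0 2 + delta_mx 2 0.
Definition E2 : 'M[R]_4 := delta_mx 0 1 + delta_mx 1 0.
Definition E3 : 'M[R]_4 := delta_mx 1 2 - delta_mx 2 1.
Definition E4 : 'M[R]_4 := delta_mx 3 3.

Definition e1 := E1.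
Definition e2 := E4.
Definition e3 := E2.
Definition e4 := - E3.

End Group.

Section SubRiemannian.
Context {R : realType}.
Notation mu := (@lebesgue_measure R).
Implicit Types (g h : R -> 'M[R]_4) (S T : R).

(* [horizontal S g u1 u2 u3]: on [0, S], [g] is an absolutely continuous curve
   in the group with g' = g (u1 e1 + u2 e2 + u3 e3) almost everywhere (the
   differential equation is written in integral form, entry by entry).  Since
   [g t] is invertible and e1, e2, e3 are linearly independent, the
   coordinates u1, u2, u3 of the velocity in the left-invariant frame are
   determined by [g] up to a null set. *)
Definition horizontal S g (u1 u2 u3 : R -> R) : Prop :=
  [/\ forall t, 0 <= t <= S -> SO0_21xR (g t),
      {within `[0, S], continuous g},
      [/\ mu.-integrable `[0, S] (EFin \o u1),
          mu.-integrable `[0, S] (EFin \o u2) &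
          mu.-integrable `[0, S] (EFin \o u3)] &
      forall t, 0 <= t <= S -> forall i j,
        g t i j = g 0 i j + \int[mu]_(s in `[0, t])
          ((g s *m (u1 s *: e1 + u2 s *: e2 + u3 s *: e3)) i j)].

Definition control_length S (u1 u2 u3 : R -> R) : \bar R :=
  (\int[mu]_(s in `[0%R, S])
     (Num.sqrt (u1 s ^+ 2 + u2 s ^+ 2 + u3 s ^+ 2))%:E)%E.

(* [g] on [0, S] is horizontal and has length [l]. *)
Definition has_length S g (l : \bar R) : Prop :=
  exists u1 u2 u3, horizontal S g u1 u2 u3 /\ l = control_length S u1 u2 u3.

Definition rho2 (x y : 'M[R]_4) : \bar R :=
  ereal_inf [set l | exists S g,
    [/\ 0 <= S, g 0 = x, g S = y & has_length S g l]].

Definition shortest_arc T g : Prop := has_length T g (rho2 (g 0) (g T)).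

(* No shortest arc extending [g] beyond [T] is strictly longer.  Parametrizations
   are arbitrary, so strictness must be required of the lengths, which for
   shortest arcs are the distances between the endpoints. *)
Definition noncontinuable_shortest_arc T g : Prop :=
  shortest_arc T g /\
  ~ exists T' h,
      [/\ T < T', forall t, 0 <= t <= T -> h t = g t,
          shortest_arc T' h & (rho2 (g 0%R) (g T) < rho2 (h 0%R) (h T'))%E].

Definition gamma2 (phi0 alpha2 beta t : R) : 'M[R]_4 :=
  let alpha1 := Num.sqrt (1 - alpha2 ^+ 2) * sin phi0 in
  let alpha3 := Num.sqrt (1 - alpha2 ^+ 2) * cos phi0 in
  mxexp (t *: (alpha1 *: e1 + alpha2 *: e2 + alpha3 *: e3 + beta *: e4)) *m
  mxexp (- (t * beta) *: e4).

End SubRiemannian.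

Section Systems.
Context {R : realType}.

Definition system_lt1 (alpha2 beta T : R) : Prop :=
  let w := Num.sqrt (1 - alpha2 ^+ 2 - beta ^+ 2) in
  let D := Num.sqrt ((1 - alpha2 ^+ 2) * cosh (T * w / 2) ^+ 2 - beta ^+ 2) in
  cos (`|beta| * T / 2) = - (`|beta| * sinh (T * w / 2) / D) /\
  sin (`|beta| * T / 2) = w * cosh (T * w / 2) / D.

Definition system_eq1 (beta T : R) : Prop :=
  let D := Num.sqrt (1 + beta ^+ 2 * T ^+ 2 / 4) in
  cos (`|beta| * T / 2) = - (`|beta| * T / 2 / D) /\
  sin (`|beta| * T / 2) = 1 / D.

Definition system_gt1 (alpha2 beta T : R) : Prop :=
  let w := Num.sqrt (alpha2 ^+ 2 + beta ^+ 2 - 1) in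
  let D := Num.sqrt (beta ^+ 2 - (1 - alpha2 ^+ 2) * cos (T * w / 2) ^+ 2) in
  cos (`|beta| * T / 2) = - (`|beta| * sin (T * w / 2) / D) /\
  sin (`|beta| * T / 2) = w * cos (T * w / 2) / D.

End Systems.

(* Main.v *)
From HB Require Import structures.
From mathcomp Require Import all_boot all_order all_algebra.
From mathcomp Require Import all_classical all_reals all_analysis.
From mathcomp Require Import measurable_realfun ring lra.
Require Import Defs.

Set Implicit Arguments.
Unset Strict Implicit.
Unset Printing Implicit Defensive.

Import Order.TTheory GRing.Theory Num.Theory.
Import numFieldNormedType.Exports.

Local Open Scope classical_set_scope.
Local Open Scope ring_scope.

(** The group acts on the hyperbolic plane, and horizontal curves project there
    without change of the length contributed by the controls [u1] and [u3]; the
    control [u2] only moves the vertical coordinate. A curve that starts at the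
    identity is determined at its end by the end point of the projection, by the
    vertical coordinate, and, modulo [2 * pi], by the holonomy, which is the area
    between the projection and its chord. So shortest arcs solve a problem of
    Dido: shortest plane curves with given end points and given area modulo
    [2 * pi].

    The projection of [gamma2] has geodesic curvature [k = |beta| / a] up to sign
    and length [a t], where [a ^+ 2 = 1 - alpha2 ^+ 2] ([gamma2E], [geod_KAK]).
    The area [hol k t] of an arc of length [t] increases up to a full turn, which
    exists for [k > 1] only, at [t = 2 * pi / kap k] with
    [kap k ^+ 2 = k ^+ 2 - 1]. The cut time is the first time at which the
    holonomy is [pi] or a full turn is completed ([cut_time]).

    Up to that time the arc is shortest. A competitor has the same holonomy
    modulo [2 * pi], hence a holonomy of absolute value at least [hol k t], as
    this is at most [pi]; and it cannot enclose so much area with less length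
    ([dido_lower_bound]). This is proved by calibrations: for each curvature [k']
    a function of the area and of the distance to the base point grows along
    every curve at most as the length ([calibration_le]). The vertical part is
    added by a unit covector ([control_length_ge]). As controls are only
    integrable, differentials are taken with respect to a clock, the variation of
    the primitives of the controls ([clock_diff]).

    After that time there are shortcuts. Beyond holonomy [pi], part of the
    reflected arc can be replaced by its chord ([shortcut_holonomy]). Beyond a
    full turn, the circle can be turned about its base point so as to create a
    corner, which is cut off ([shortcut_full_turn]). Both are shorter than the
    geodesic, for whichever controls its length is computed, because a horizontal
    curve determines its controls almost everywhere ([control_length_unique]).

    It remains to locate the cut time. With [om], the polar angle of the end
    point of the arc, [hol k t = k t - 2 om], so that holonomy [pi] means
    [k t / 2 = om + pi / 2]; the cosine and sine of [om] are explicit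
    ([om_cos_sin]), and this is the system of equations. The values of [hol] at
    [pi / k], [2 * pi / k], [3 * pi / k] and [2 * pi / kap k], compared with [pi],
    give the intervals ([cut_time_first_interval], [cut_time_second_interval],
    [hol_half_turn], [hol_full_turn_le]); the cases change when [2 * pi / k] is
    half a turn, [k = 2 / sqrt 3], and when [3 * pi / k] is a full turn,
    [k = 3 / sqrt 5]. *)

(** * Differentials with respect to a clock *)

(** Real induction: the supremum of the points where [G] has not grown is
    itself such a point, and the local hypothesis there pushes it to [b]. *)
Lemma local_nonincreasing (R : realType) (G : R -> R) (a b : R) : a <= b ->
  (forall t0, a <= t0 <= b -> \forall t \near t0, a <= t <= b ->
     (t0 <= t -> G t <= G t0) /\ (t <= t0 -> G t0 <= G t)) ->
  G b <= G a.
Proof.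
move=> ab loc.
pose E := [set t | a <= t <= b /\ G t <= G a].
have Ea : E a by split; rewrite ?lexx.
have Eub : ubound E b by move=> t [/andP[]].
have Esup : has_sup E by split; [exists a | exists b].
pose c := sup E.
have ac : a <= c by apply: ub_le_sup => //; exists b.
have cb : c <= b by apply: ge_sup => //; exists a.
have acb : a <= c <= b by rewrite ac cb.
have [e /= e0 He] := loc c acb.
have Ec : E c.
  split => //.
  have [t Et ct] := sup_adherent e0 Esup.
  have tc : t <= c by apply: ub_le_sup => //; exists b.
  have [/andP[at_ tb] Gt] := Et.
  have [| |_ /(_ tc) Gct] := He t _ _; last exact: le_trans Gt.
    by rewrite /ball /= ger0_norm ?subr_ge0// ltrBlDr -ltrBlDl.
  by rewrite at_ tb.
have [cltb|] := ltP c b; last first.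
  move=> bc; have <- : c = b by apply/le_anti; rewrite cb bc.
  by case: Ec.
pose t := Num.min b (c + e / 2).
have ct : c < t by rewrite lt_min cltb /= ltrDl divr_gt0.
have tb : t <= b by rewrite ge_min lexx.
have at_ : a <= t by exact: le_trans ac (ltW ct).
have [| |/(_ (ltW ct)) Gtc _] := He t _ _.
- rewrite /ball /= ltr0_norm ?subr_lt0// opprB ltrBlDl.
  by rewrite gt_min ltrD2l ltr_pdivrMr// ltr_pMr// ltr1n orbT.
- by rewrite at_ tb.
have Et : E t by split; [rewrite at_ tb | apply: le_trans Gtc Ec.2].
have : t <= c by apply: ub_le_sup => //; exists b.
by rewrite leNgt ct.
Qed.

Section Clock.
Context {R : realType}.
Variables (S : R) (W U V : R -> R).
Hypothesis WU : forall s t : R, 0 <= s -> s <= t -> t <= S ->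
  `|U t - U s| <= W t - W s.
Hypothesis WV : forall s t : R, 0 <= s -> s <= t -> t <= S ->
  `|V t - V s| <= W t - W s.
Hypothesis Wcont : forall t0 : R, 0 <= t0 <= S -> forall e : R, 0 < e ->
  \forall t \near t0, 0 <= t <= S -> `|W t - W t0| <= e.

(** The controls are merely integrable, so that nothing need be differentiable in
    time. Differentials are taken instead with respect to two primitives [U]
    and [V] of controls: [f] has differential [a dU + b dV] at [t0], up to
    [o(dW)] for a continuous clock [W] that dominates [U] and [V]. *)
Definition clock_diff (f : R -> R) (t0 a b : R) := forall e : R, 0 < e ->
  \forall t \near t0, 0 <= t <= S ->
  `|f t - f t0 - (a * (U t - U t0) + b * (V t - V t0))| <= e * `|W t - W t0|.

Lemma clock_le s t : 0 <= s -> s <= t -> t <= S -> W s <= W t.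
Proof.
by move=> s0 st tS; rewrite -subr_ge0; apply: le_trans (WU s0 st tS).
Qed.

Lemma clock_dom t0 t : 0 <= t0 <= S -> 0 <= t <= S ->
  `|U t - U t0| <= `|W t - W t0| /\ `|V t - V t0| <= `|W t - W t0|.
Proof.
move=> /andP[t00 t0S] /andP[tge0 tS].
have [tt0|/ltW tt0] := leP t0 t.
  by rewrite (ger0_norm (_ : 0 <= W t - W t0)) ?subr_ge0 ?clock_le// WU// WV.
rewrite distrC (distrC (V t)) (distrC (W t)).
by rewrite (ger0_norm (_ : 0 <= W t0 - W t)) ?subr_ge0 ?clock_le// WU// WV.
Qed.

Lemma clock_diff_lip f t0 a b : 0 <= t0 <= S -> clock_diff f t0 a b ->
  \forall t \near t0, 0 <= t <= S ->
    `|f t - f t0| <= (1 + `|a| + `|b|) * `|W t - W t0|.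
Proof.
move=> t0S /(_ 1 ltr01); apply: filterS => t H tS.
have [HU HV] := clock_dom t0S tS; move: {H}(H tS); rewrite mul1r => H.
have -> : f t - f t0 = (f t - f t0 - (a * (U t - U t0) + b * (V t - V t0))) +
  (a * (U t - U t0) + b * (V t - V t0)) by ring.
have -> : (1 + `|a| + `|b|) * `|W t - W t0| = `|W t - W t0| +
  (`|a| * `|W t - W t0| + `|b| * `|W t - W t0|) by ring.
apply: le_trans (ler_normD _ _) _; apply: lerD => //; apply: le_trans (ler_normD _ _) _.
by rewrite !normrM; apply: lerD; apply: ler_wpM2l.
Qed.

Lemma clock_diff_cst k t0 : clock_diff (fun=> k) t0 0 0.
Proof.
move=> e e0; near=> t => _.
by rewrite !mul0r addr0 !subrr normr0 mulr_ge0// ltW.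
Unshelve. all: by end_near. Qed.

Lemma clock_diff_ext f g t0 a b a' b' : 0 <= t0 <= S ->
  (forall t : R, 0 <= t <= S -> f t = g t) -> a = a' -> b = b' ->
  clock_diff f t0 a b -> clock_diff g t0 a' b'.
Proof.
move=> t0S fg <- <- Hf e e0; move: (Hf e e0); apply: filterS => t H tS.
by rewrite -!fg//; apply: H.
Qed.

Lemma clock_diffD f g t0 a b a' b' : clock_diff f t0 a b ->
  clock_diff g t0 a' b' ->
  clock_diff (fun t => f t + g t) t0 (a + a') (b + b').
Proof.
move=> Hf Hg e e0; have e20 : 0 < e / 2 by rewrite divr_gt0.
near=> t => tS.
have -> : f t + g t - (f t0 + g t0) - ((a + a') * (U t - U t0) +
    (b + b') * (V t - V t0)) =
  (f t - f t0 - (a * (U t - U t0) + b * (V t - V t0))) +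
  (g t - g t0 - (a' * (U t - U t0) + b' * (V t - V t0))) by ring.
apply: le_trans (ler_normD _ _) _; rewrite [e]splitr mulrDl.
by apply: lerD; move: tS; near: t; [exact: Hf | exact: Hg].
Unshelve. all: by end_near. Qed.

Lemma clock_diffZ k f t0 a b : clock_diff f t0 a b ->
  clock_diff (fun t => k * f t) t0 (k * a) (k * b).
Proof.
move=> Hf e e0; have e20 : 0 < e / (1 + `|k|).
  by rewrite divr_gt0// ltr_pwDl.
near=> t => tS.
have -> : k * f t - k * f t0 - (k * a * (U t - U t0) + k * b * (V t - V t0)) =
  k * (f t - f t0 - (a * (U t - U t0) + b * (V t - V t0))) by ring.
have H : `|f t - f t0 - (a * (U t - U t0) + b * (V t - V t0))| <=
  e / (1 + `|k|) * `|W t - W t0| by move: tS; near: t; exact: Hf.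
rewrite normrM; apply: le_trans (ler_wpM2l (normr_ge0 k) H) _.
rewrite mulrA ler_wpM2r// mulrCA ger_pMr// ler_pdivrMr ?ltr_pwDl//.
by rewrite mul1r lerDr.
Unshelve. all: by end_near. Qed.

Lemma clock_diffN f t0 a b : clock_diff f t0 a b ->
  clock_diff (fun t => - f t) t0 (- a) (- b).
Proof.
move=> /(@clock_diffZ (-1)) H e e0; move: (H e e0); apply: filterS => t.
by rewrite !mulN1r.
Qed.

Lemma clock_diffB f g t0 a b a' b' : clock_diff f t0 a b ->
  clock_diff g t0 a' b' ->
  clock_diff (fun t => f t - g t) t0 (a - a') (b - b').
Proof. by move=> Hf Hg; apply: clock_diffD => //; apply: clock_diffN. Qed.

(** The chain rule holds because [f] is Lipschitz with respect to the clock,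
    and the clock is continuous. *)
Lemma clock_diff_comp (h : R -> R) f t0 a b (dh : R) : 0 <= t0 <= S ->
  clock_diff f t0 a b -> is_derive (f t0) 1 h dh ->
  clock_diff (fun t => h (f t)) t0 (dh * a) (dh * b).
Proof.
move=> t0S Hf hdh e e0.
pose K := 1 + `|a| + `|b|.
have K0 : 0 < K by rewrite /K -addrA ltr_pwDl// addr_ge0.
have e10 : 0 < e / 2 / K by rewrite !divr_gt0.
have Hh : \forall y \near f t0,
    `|h y - h (f t0) - dh * (y - f t0)| <= e / 2 / K * `|y - f t0|.
  have [hd hv] := hdh.
  have : (fun k => k^-1 *: (h (k *: 1 + f t0) - h (f t0))) @ 0^' --> dh.
    by rewrite -hv; exact: hd.
  move=> /cvgr_dist_le /(_ _ e10) [d /= d0 Hd]; exists d => //= y yd.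
  have [->|yf] := eqVneq y (f t0); first by rewrite !subrr mulr0 subrr !normr0 mulr0.
  have yf0 : y - f t0 != 0 by rewrite subr_eq0.
  move: yd; rewrite /ball_ /= distrC => yd.
  have := Hd (y - f t0); rewrite /= sub0r normrN => /(_ yd yf0).
  rewrite /GRing.scale /= mulr1 subrK => Hy.
  rewrite -ler_pdivrMr ?normr_gt0// -normf_div.
  suff -> : (h y - h (f t0) - dh * (y - f t0)) / (y - f t0) =
      - (dh - (y - f t0)^-1 * (h y - h (f t0))) by rewrite normrN.
  by field.
have Hc : \forall t \near t0, 0 <= t <= S ->
    `|h (f t) - h (f t0) - dh * (f t - f t0)| <= e / 2 / K * `|f t - f t0|.
  have [d /= d0 Hd] := Hh.
  have Hl := clock_diff_lip t0S Hf.
  have Hw := Wcont t0S (divr_gt0 (divr_gt0 d0 (ltr0n _ 2)) K0).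
  near=> t => tS; apply: Hd; rewrite /ball_ /= distrC.
  have H1 : `|f t - f t0| <= K * `|W t - W t0| by move: tS; near: t.
  apply: le_lt_trans H1 _.
  have H2 : `|W t - W t0| <= d / 2 / K by move: tS; near: t.
  apply: le_lt_trans (ler_wpM2l (ltW K0) H2) _.
  by rewrite mulrC divfK ?gt_eqF// ltr_pdivrMr// ltr_pMr// ltr1n.
have e20 : 0 < e / 2 / (1 + `|dh|) by rewrite !divr_gt0// ltr_pwDl.
have Hl := clock_diff_lip t0S Hf.
near=> t => tS.
have -> : h (f t) - h (f t0) - (dh * a * (U t - U t0) + dh * b * (V t - V t0)) =
  (h (f t) - h (f t0) - dh * (f t - f t0)) +
  dh * (f t - f t0 - (a * (U t - U t0) + b * (V t - V t0))) by ring.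
apply: le_trans (ler_normD _ _) _; rewrite [X in _ <= X * _]splitr mulrDl.
apply: lerD.
  have H1 : `|h (f t) - h (f t0) - dh * (f t - f t0)| <= e / 2 / K * `|f t - f t0|.
    by move: tS; near: t.
  apply: le_trans H1 _.
  have H2 : `|f t - f t0| <= K * `|W t - W t0| by move: tS; near: t.
  apply: le_trans (ler_wpM2l (ltW e10) H2) _.
  by rewrite mulrA divfK ?gt_eqF.
have H3 : `|f t - f t0 - (a * (U t - U t0) + b * (V t - V t0))| <=
    e / 2 / (1 + `|dh|) * `|W t - W t0| by move: tS; near: t; exact: Hf.
rewrite normrM; apply: le_trans (ler_wpM2l (normr_ge0 dh) H3) _.
rewrite mulrA ler_wpM2r// mulrCA ger_pMr ?divr_gt0// ler_pdivrMr ?ltr_pwDl//.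
by rewrite mul1r lerDr.
Unshelve. all: by end_near. Qed.

Lemma clock_diff_sqr f t0 a b : 0 <= t0 <= S -> clock_diff f t0 a b ->
  clock_diff (fun t => f t ^+ 2) t0 (2 * f t0 * a) (2 * f t0 * b).
Proof.
move=> t0S Hf.
have D : is_derive (f t0) 1 (fun x : R => x ^+ 2) (2 * f t0).
  by apply: is_derive_eq; rewrite /GRing.scale /= mulr1; ring.
exact: (clock_diff_comp t0S Hf D).
Qed.

(** Polarization reduces the product to squares, that is, to the chain rule. *)
Lemma clock_diffM f g t0 a b a' b' : 0 <= t0 <= S -> clock_diff f t0 a b ->
  clock_diff g t0 a' b' ->
  clock_diff (fun t => f t * g t) t0 (a * g t0 + f t0 * a')
    (b * g t0 + f t0 * b').
Proof.
move=> t0S Hf Hg.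
have Hp := clock_diff_sqr t0S (clock_diffD Hf Hg).
have Hm := clock_diff_sqr t0S (clock_diffB Hf Hg).
apply: clock_diff_ext (clock_diffZ 4^-1 (clock_diffB Hp Hm)) => //.
- by move=> t _; field.
- by field.
- by field.
Qed.

(** The error [e dW] integrates to [e (W b - W a)], which vanishes with [e]. *)
Lemma clock_increment_le F N (a b : R) : 0 <= a -> a <= b -> b <= S ->
  (forall t0, a <= t0 <= b -> forall e : R, 0 < e ->
   \forall t \near t0, a <= t <= b ->
     (t0 <= t -> F t - F t0 - (N t - N t0) <= e * (W t - W t0)) /\
     (t <= t0 -> F t0 - F t - (N t0 - N t) <= e * (W t0 - W t))) ->
  F b - F a <= N b - N a.
Proof.
move=> a0 ab bS H.
suff K e : 0 < e -> F b - F a - (N b - N a) <= e * (W b - W a).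
  rewrite -subr_le0 leNgt; apply/negP => lt0.
  have Wab := clock_le a0 ab bS.
  have /K : 0 < (F b - F a - (N b - N a)) / 2 / (1 + (W b - W a)).
    by rewrite !divr_gt0// ltr_pwDl// subr_ge0.
  set z := F b - _ - _ in lt0 *; rewrite leNgt => /negP; apply.
  rewrite mulrAC ltr_pdivrMr ?ltr_pwDl ?subr_ge0// -mulrA ltr_pM2l//.
  by rewrite ltr_pdivrMl//; move: Wab; lra.
move=> e0.
suff : F b - N b - e * W b <= F a - N a - e * W a by lra.
apply: (local_nonincreasing (G := fun t => F t - N t - e * W t)) => // t0 t0ab.
move: (H t0 t0ab e e0); apply: filterS => t Ht tab.
by have [H1 H2] := Ht tab; split => [/H1|/H2]; lra.
Qed.

(** The differential is frozen at [t0]: for [N] the length, the hypothesis on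
    [N] says that the covector [(c, d)] has norm at most 1. *)
Lemma clock_diff_bound F N t0 c d : 0 <= t0 <= S ->
  clock_diff F t0 c d ->
  (forall s t : R, 0 <= s -> s <= t -> t <= S ->
      c * (U t - U s) + d * (V t - V s) <= N t - N s) ->
  forall e : R, 0 < e -> \forall t \near t0, 0 <= t <= S ->
     (t0 <= t -> F t - F t0 - (N t - N t0) <= e * (W t - W t0)) /\
     (t <= t0 -> F t0 - F t - (N t0 - N t) <= e * (W t0 - W t)).
Proof.
move=> t0S HF HN e e0; move: (HF e e0); apply: filterS => t + tS.
move=> /(_ tS) {}HF; case/andP: tS => ? ?; case/andP: t0S => ? ?.
split => tt0; move: HF.
  rewrite (ger0_norm (_ : 0 <= W t - W t0)) ?subr_ge0 ?clock_le//.
  by rewrite ler_norml => /andP[_]; have := HN t0 t; lra.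
rewrite (ler0_norm (_ : W t - W t0 <= 0)) ?subr_le0 ?clock_le//.
by rewrite ler_norml => /andP[+ _]; have := HN t t0; lra.
Qed.

Lemma clock_diff_increment_le F N (a b : R) : 0 <= a -> a <= b -> b <= S ->
  (forall t0, a <= t0 <= b -> exists c d, clock_diff F t0 c d /\
    forall s t : R, 0 <= s -> s <= t -> t <= S ->
      c * (U t - U s) + d * (V t - V s) <= N t - N s) ->
  F b - F a <= N b - N a.
Proof.
move=> a0 ab bS H.
have sub t : a <= t <= b -> 0 <= t <= S.
  by case/andP => t1 t2; rewrite (le_trans a0)//= (le_trans t2).
apply: clock_increment_le => // t0 /[dup] t0ab /H.
move=> [c [d [HF HN]]] e e0.
move: (clock_diff_bound (sub _ t0ab) HF HN e0); apply: filterS => t Ht tab.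
exact/Ht/sub.
Qed.

Lemma clock_diff0_cst F (a b : R) : 0 <= a -> a <= b -> b <= S ->
  (forall t0, a <= t0 <= b -> clock_diff F t0 0 0) -> F b = F a.
Proof.
move=> a0 ab bS H.
suff K G : (forall t0, a <= t0 <= b -> clock_diff G t0 0 0) -> G b <= G a.
  apply/le_anti; rewrite K//= -lerN2 (K (fun t => - F t))// => t0 /H.
  by move=> /clock_diffN; rewrite oppr0.
move=> {}H; rewrite -subr_le0 -(subrr (0 : R)).
apply: (clock_diff_increment_le (N := fun=> 0)) => // t0 /H HG.
exists 0, 0; split => //.
by move=> *; rewrite !mul0r addr0 subrr.
Qed.

End Clock.

(** * Primitives of integrable controls *)

Lemma integrable_continuousM (R : realType) (S : R) (h k : R -> R) :
  {within `[0, S], continuous h} ->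
  lebesgue_measure.-integrable `[0, S] (EFin \o k) ->
  lebesgue_measure.-integrable `[0, S] (EFin \o (fun x => h x * k x)).
Proof.
move=> hc kI.
have hb : [bounded h x | x in `[0, S]].
  have := continuous_compact hc (@segment_compact R 0 S).
  move=> /compact_bounded [M [Mr HM]]; exists M; split => // r Mr' x xS /=.
  by apply: HM => //; exists x.
apply: (@integrableMr _ _ _ (@lebesgue_measure R) _ _ h (EFin \o k)) => //.
exact: subspace_continuous_measurable_fun.
Qed.

Section Controls.
Context {R : realType}.
Notation mu := (@lebesgue_measure R).
Variables (S : R) (p q : R -> R).
Hypothesis pI : mu.-integrable `[0, S] (EFin \o p).
Hypothesis qI : mu.-integrable `[0, S] (EFin \o q).

Definition primitive (f : R -> R) (t : R) : R := \int[mu]_(s in `[0, t]) f s.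
Definition variation : R -> R := primitive (fun s => `|p s| + `|q s|).
Definition arc_length : R -> R :=
  primitive (fun s => Num.sqrt (p s ^+ 2 + q s ^+ 2)).

Let intD (i : interval R) (f g : R -> R) :
  mu.-integrable [set` i] (EFin \o f) -> mu.-integrable [set` i] (EFin \o g) ->
  mu.-integrable [set` i] (EFin \o (fun x => f x + g x)).
Proof. by move=> fI gI; apply: (integrableD _ fI gI). Qed.

Let intB (i : interval R) (f g : R -> R) :
  mu.-integrable [set` i] (EFin \o f) -> mu.-integrable [set` i] (EFin \o g) ->
  mu.-integrable [set` i] (EFin \o (fun x => f x - g x)).
Proof. by move=> fI gI; apply: (integrableB _ fI gI). Qed.

Let intZ (i : interval R) k (f : R -> R) :
  mu.-integrable [set` i] (EFin \o f) ->
  mu.-integrable [set` i] (EFin \o (fun x => k * f x)).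
Proof. by move=> fI; apply: (integrableZl _ _ fI). Qed.

Let intN (i : interval R) (f : R -> R) :
  mu.-integrable [set` i] (EFin \o f) ->
  mu.-integrable [set` i] (EFin \o (fun x => `|f x|)).
Proof. by move=> fI; apply: (integrable_abse fI). Qed.

Lemma primitive_incr f s t : mu.-integrable `[0, S] (EFin \o f) ->
  0 <= s -> s <= t -> t <= S ->
  primitive f t - primitive f s = \int[mu]_(x in `]s, t]) f x.
Proof.
move=> fI s0 st tS; rewrite /primitive Rintegral_itvB ?bnd_simp//.
by apply: integrableS fI => //; apply: subset_itvl; rewrite bnd_simp.
Qed.

Lemma sub_integrable f s t : mu.-integrable `[0, S] (EFin \o f) ->
  0 <= s -> t <= S -> mu.-integrable `]s, t] (EFin \o f).
Proof.
move=> fI s0 tS; apply: integrableS fI => //.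
by apply: subset_itv; rewrite bnd_simp.
Qed.

Lemma variation_integrable :
  mu.-integrable `[0, S] (EFin \o (fun s => `|p s| + `|q s|)).
Proof. by apply: intD; apply: intN. Qed.

Lemma arc_length_integrable :
  mu.-integrable `[0, S] (EFin \o (fun s => Num.sqrt (p s ^+ 2 + q s ^+ 2))).
Proof.
apply: (le_integrable _ _ _ variation_integrable) => //.
  apply/measurable_EFinP; apply: measurableT_comp.
    apply: continuous_measurable_fun; exact: sqrt_continuous.
  have /measurable_EFinP mp := measurable_int _ pI.
  have /measurable_EFinP mq := measurable_int _ qI.
  by apply: measurable_funD; apply: measurable_funX.
move=> x _ /=; rewrite lee_fin ger0_norm ?sqrtr_ge0// ger0_norm ?addr_ge0//.
rewrite -[leRHS]ger0_norm ?addr_ge0// -sqrtr_sqr ler_wsqrtr//.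
by rewrite -(real_normK (num_real (p x))) -(real_normK (num_real (q x)));
  have := mulr_ge0 (normr_ge0 (p x)) (normr_ge0 (q x)); nra.
Qed.

Lemma variation_cont t0 : 0 <= t0 <= S -> forall e : R, 0 < e ->
  \forall t \near t0, 0 <= t <= S -> `|variation t - variation t0| <= e.
Proof.
move=> /andP[t00 t0S] e e0.
have S0 := le_trans t00 t0S.
have := @parameterized_integral_continuous R 0 S _ S0 variation_integrable.
move=> /subspace_continuousP /(_ t0).
rewrite /= in_itv /= t00 t0S => /(_ isT) /cvgr_dist_le /(_ _ e0).
rewrite /prop_near1 /within /= => H; near=> t => tS.
by rewrite distrC; move: tS; rewrite -[_ && _]/(t \in `[0, S]); near: t; exact: H.
Unshelve. all: by end_near. Qed.

Lemma primitive_comb (c d s t : R) : 0 <= s -> s <= t -> t <= S ->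
  c * (primitive p t - primitive p s) + d * (primitive q t - primitive q s) =
  \int[mu]_(x in `]s, t]) (c * p x + d * q x).
Proof.
move=> s0 st tS; rewrite !primitive_incr//.
have ip := sub_integrable pI s0 tS; have iq := sub_integrable qI s0 tS.
rewrite -!RintegralZl// RintegralD//=.
- exact: intZ.
- exact: intZ.
Qed.

Lemma comb_integrable (c d s t : R) : 0 <= s -> t <= S ->
  mu.-integrable `]s, t] (EFin \o (fun x => c * p x + d * q x)).
Proof.
move=> s0 tS.
have ip := sub_integrable pI s0 tS; have iq := sub_integrable qI s0 tS.
by apply: intD; apply: intZ.
Qed.

Let primitive_variation f s t : mu.-integrable `[0, S] (EFin \o f) ->
  (forall x, `|f x| <= `|p x| + `|q x|) -> 0 <= s -> s <= t -> t <= S ->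
  `|primitive f t - primitive f s| <= variation t - variation s.
Proof.
move=> fI fpq s0 st tS.
rewrite /variation !primitive_incr//; last exact: variation_integrable.
have iI := sub_integrable fI s0 tS.
apply: le_trans (le_normr_Rintegral _ iI) _ => //.
apply: le_Rintegral => //.
- exact: (intN iI).
- exact: (sub_integrable variation_integrable).
Qed.

Lemma variation_p s t : 0 <= s -> s <= t -> t <= S ->
  `|primitive p t - primitive p s| <= variation t - variation s.
Proof. by apply: primitive_variation => // x; rewrite lerDl. Qed.

Lemma variation_q s t : 0 <= s -> s <= t -> t <= S ->
  `|primitive q t - primitive q s| <= variation t - variation s.
Proof. by apply: primitive_variation => // x; rewrite lerDr. Qed.

(** Cauchy-Schwarz under the integral: a covector of norm at most 1 is bounded
    by the length. *)
Lemma arc_length_ge (c d s t : R) : c ^+ 2 + d ^+ 2 <= 1 ->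
  0 <= s -> s <= t -> t <= S ->
  c * (primitive p t - primitive p s) + d * (primitive q t - primitive q s) <=
  arc_length t - arc_length s.
Proof.
move=> cd s0 st tS; rewrite primitive_comb//.
rewrite /arc_length primitive_incr//; last exact: arc_length_integrable.
apply: le_Rintegral => //.
- exact: comb_integrable.
- exact: (sub_integrable arc_length_integrable).
move=> x _; apply: le_trans (ler_norm _) _.
rewrite -sqrtr_sqr ler_wsqrtr//.
have : 0 <= (c * q x - d * p x) ^+ 2 by exact: sqr_ge0.
have : 0 <= (1 - (c ^+ 2 + d ^+ 2)) * (p x ^+ 2 + q x ^+ 2).
  by rewrite mulr_ge0 ?subr_ge0// addr_ge0// sqr_ge0.
nra.
Qed.

(** An integral equation with continuous coefficients gives a differential:
    the coefficients are almost constant near [t0], uniformly, while the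
    controls enter only through their variation. *)
Lemma clock_diff_primitive (f al be : R -> R) t0 : 0 <= t0 <= S ->
  {within `[0, S], continuous al} -> {within `[0, S], continuous be} ->
  (forall t : R, 0 <= t <= S -> f t = f 0 + primitive (fun s => al s * p s + be s * q s) t) ->
  clock_diff S variation (primitive p) (primitive q) f t0 (al t0) (be t0).
Proof.
move=> t0S alc bec fE e e0.
have vI : mu.-integrable `[0, S] (EFin \o (fun s => al s * p s + be s * q s)).
  by apply: intD; exact: integrable_continuousM.
have near_cont (h : R -> R) : {within `[0, S], continuous h} ->
    \forall t \near t0, 0 <= t <= S -> `|h t - h t0| <= e.
  move=> /subspace_continuousP /(_ t0); rewrite /= in_itv /= t0S => /(_ isT).
  move=> /cvgr_dist_le /(_ _ e0); rewrite /prop_near1 /within /= => H.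
  near=> t => tS.
  by rewrite distrC; move: tS; rewrite -[_ && _]/(t \in `[0, S]); near: t; exact: H.
have [d1 /= d10 H1] := near_cont _ alc; have [d2 /= d20 H2] := near_cont _ bec.
have key s t : 0 <= s -> s <= t -> t <= S ->
    (forall x, s <= x <= t -> `|al x - al t0| <= e /\ `|be x - be t0| <= e) ->
    `|f t - f s - (al t0 * (primitive p t - primitive p s) +
      be t0 * (primitive q t - primitive q s))| <= e * (variation t - variation s).
  move=> s0 st tS near_e; have stS := le_trans st tS.
  rewrite (fE t) ?tS ?(le_trans s0)// (fE s) ?s0 ?stS//.
  rewrite (opprD (f 0)) addrACA subrr add0r (primitive_incr vI s0 st tS) primitive_comb//.
  have I1 := sub_integrable vI s0 tS.
  have I2 := comb_integrable (al t0) (be t0) s0 tS.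
  rewrite -RintegralB//.
  have I12 : mu.-integrable `]s, t] (EFin \o (fun x =>
     al x * p x + be x * q x - (al t0 * p x + be t0 * q x))).
    exact: intB.
  apply: le_trans (le_normr_Rintegral _ I12) _ => //.
  rewrite /variation primitive_incr//; last exact: variation_integrable.
  have I3 := sub_integrable variation_integrable s0 tS.
  rewrite -RintegralZl//; apply: le_Rintegral => //.
  - exact: (intN I12).
  - exact: intZ.
  move=> x /=; rewrite in_itv /= => /andP[sx xt].
  have [Ha Hb] : `|al x - al t0| <= e /\ `|be x - be t0| <= e.
    by apply: near_e; rewrite xt (ltW sx).
  have -> : al x * p x + be x * q x - (al t0 * p x + be t0 * q x) =
    (al x - al t0) * p x + (be x - be t0) * q x by ring.
  apply: le_trans (ler_normD _ _) _; rewrite !normrM mulrDr.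
  by apply: lerD; apply: ler_wpM2r.
near=> t => tS.
have nearx x : `|x - t0| <= `|t - t0| -> 0 <= x <= S ->
    `|al x - al t0| <= e /\ `|be x - be t0| <= e.
  move=> xt xS; split.
    apply: H1 => //; rewrite /ball_ /= distrC; apply: le_lt_trans xt _.
    by rewrite distrC; near: t; exists d1.
  apply: H2 => //; rewrite /ball_ /= distrC; apply: le_lt_trans xt _.
  by rewrite distrC; near: t; exists d2.
have mono s r : 0 <= s -> s <= r -> r <= S -> variation s <= variation r.
  move=> s0 sr rS; rewrite -subr_ge0.
  by apply: le_trans (variation_p s0 sr rS).
case/andP: t0S => t00 t0S; case/andP: tS => tge0 tS.
have [tt0|/ltW tt0] := leP t0 t.
  rewrite (ger0_norm (_ : 0 <= variation t - variation t0)) ?subr_ge0 ?mono//.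
  apply: key => // x /andP[x1 x2]; apply: nearx.
    by rewrite !ger0_norm ?subr_ge0// lerD2r.
  by rewrite (le_trans t00)//= (le_trans x2).
rewrite (ler0_norm (_ : variation t - variation t0 <= 0)) ?subr_le0 ?mono//.
rewrite opprB -normrN.
have -> : - (f t - f t0 - (al t0 * (primitive p t - primitive p t0) +
      be t0 * (primitive q t - primitive q t0))) =
  f t0 - f t - (al t0 * (primitive p t0 - primitive p t) +
      be t0 * (primitive q t0 - primitive q t)) by ring.
apply: key => // x /andP[x1 x2]; apply: nearx.
  by rewrite !ler0_norm ?subr_le0// lerN2 lerD2r.
by rewrite (le_trans tge0)//= (le_trans x2).
Unshelve. all: by end_near. Qed.

End Controls.

(** * The group as a group of matrices *)

Section Matrices.
Context {R : realType}.
Implicit Types (C : 'M[R]_3) (g : 'M[R]_4).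

Definition mx3 (a b c d e f p q r : R) : 'M[R]_3 :=
  \matrix_(i, j) nth 0 (nth [::] [:: [:: a; b; c]; [:: d; e; f]; [:: p; q; r]] i) j.

Definition mx4 (a b c d e f p q r w : R) : 'M[R]_4 :=
  \matrix_(i, j) nth 0 (nth [::] [:: [:: a; b; c; 0]; [:: d; e; f; 0];
    [:: p; q; r; 0]; [:: 0; 0; 0; w]] i) j.

Lemma ord3P (i : 'I_3) : [\/ i = 0, i = 1 | i = 2].
Proof.
by case: i => -[|[|[|//]]] Hi; [constructor 1|constructor 2|constructor 3];
  apply/val_inj.
Qed.

Lemma ord4P (i : 'I_4) : [\/ i = 0, i = 1, i = 2 | i = 3].
Proof.
by case: i => -[|[|[|[|//]]]] Hi;
  [constructor 1|constructor 2|constructor 3|constructor 4]; apply/val_inj.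
Qed.

Lemma sum_ord3 (F : 'I_3 -> R) : \sum_i F i = F 0 + F 1 + F 2.
Proof.
rewrite !big_ord_recl big_ord0 addr0 addrA.
by congr (_ + F _ + F _); apply/val_inj.
Qed.

Lemma sum_ord4 (F : 'I_4 -> R) : \sum_i F i = F 0 + F 1 + F 2 + F 3.
Proof.
rewrite !big_ord_recl big_ord0 addr0 !addrA.
by congr (_ + F _ + F _ + F _); apply/val_inj.
Qed.

Lemma mx3_eta C : C = mx3 (C 0 0) (C 0 1) (C 0 2) (C 1 0) (C 1 1) (C 1 2)
  (C 2 0) (C 2 1) (C 2 2).
Proof.
by apply/matrixP => i j; rewrite mxE; case: (ord3P i) => ->; case: (ord3P j) => ->.
Qed.

Lemma mx4_mul a b c d e f p q r w a' b' c' d' e' f' p' q' r' w' :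
  mx4 a b c d e f p q r w *m mx4 a' b' c' d' e' f' p' q' r' w' =
  mx4 (a * a' + b * d' + c * p') (a * b' + b * e' + c * q')
      (a * c' + b * f' + c * r')
      (d * a' + e * d' + f * p') (d * b' + e * e' + f * q')
      (d * c' + e * f' + f * r')
      (p * a' + q * d' + r * p') (p * b' + q * e' + r * q')
      (p * c' + q * f' + r * r') (w * w').
Proof.
apply/matrixP => i j; rewrite !mxE sum_ord4 !mxE.
by case: (ord4P i) => ->; case: (ord4P j) => -> /=;
  rewrite ?mulr0 ?mul0r ?addr0 ?add0r.
Qed.

Lemma mx3_mul a b c d e f p q r a' b' c' d' e' f' p' q' r' :
  mx3 a b c d e f p q r *m mx3 a' b' c' d' e' f' p' q' r' =
  mx3 (a * a' + b * d' + c * p') (a * b' + b * e' + c * q')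
      (a * c' + b * f' + c * r')
      (d * a' + e * d' + f * p') (d * b' + e * e' + f * q')
      (d * c' + e * f' + f * r')
      (p * a' + q * d' + r * p') (p * b' + q * e' + r * q')
      (p * c' + q * f' + r * r').
Proof.
apply/matrixP => i j; rewrite !mxE sum_ord3 !mxE.
by case: (ord3P i) => ->; case: (ord3P j) => -> /=.
Qed.

Lemma mx4E a b c d e f p q r w : let M := mx4 a b c d e f p q r w in
  ((M 0 0 = a) * (M 0 1 = b) * (M 0 2 = c) * (M 0 3 = 0) *
   (M 1 0 = d) * (M 1 1 = e) * (M 1 2 = f) * (M 1 3 = 0) *
   (M 2 0 = p) * (M 2 1 = q) * (M 2 2 = r) * (M 2 3 = 0) *
   (M 3 0 = 0) * (M 3 1 = 0) * (M 3 2 = 0) * (M 3 3 = w))%type.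
Proof. by rewrite /= !mxE. Qed.

Lemma blockCvE a b c d e f p q r v :
  blockCv (mx3 a b c d e f p q r) v = mx4 a b c d e f p q r (expR v).
Proof.
have L (k : 'I_3) : fintype.split (lshift 1 k) = inl k := unsplitK (inl k).
have D (k : 'I_1) : fintype.split (rshift 3 k) = inr k := unsplitK (inr k).
apply/matrixP => i j; rewrite /blockCv.
case: (@split_ordP 3 1 i) => i' ->; case: (@split_ordP 3 1 j) => j' ->;
  rewrite !mxE ?L ?D !mxE ?L ?D !mxE /=.
- by case: (ord3P i') => ->; case: (ord3P j') => ->.
- by case: (ord3P i') => ->; rewrite (ord1 j').
- by case: (ord3P j') => ->; rewrite (ord1 i').
- by rewrite (ord1 i') (ord1 j').
Qed.

Lemma mx3_det a b c d e f p q r : \det (mx3 a b c d e f p q r) =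
  a * (e * r - f * q) - b * (d * r - f * p) + c * (d * q - e * p).
Proof.
rewrite (expand_det_row _ 0) sum_ord3 !mxE /= /cofactor.
rewrite !(expand_det_row _ 0) !big_ord_recl !big_ord0 !mxE /= /cofactor.
rewrite !det_mx11 !mxE /=.
rewrite /bump /= (_ : (1 %% 3 = 1)%N)// (_ : ((1 + 1) %% 3 = 2)%N)//.
by rewrite !addn0 !add0n expr0 expr1 sqrrN expr1n; ring.
Qed.

Lemma mx3_inj a b c d e f p q r a' b' c' d' e' f' p' q' r' :
  mx3 a b c d e f p q r = mx3 a' b' c' d' e' f' p' q' r' ->
  [/\ a = a', b = b' & c = c'] /\ [/\ d = d', e = e' & f = f'] /\
  [/\ p = p', q = q' & r = r'].
Proof.
move=> /matrixP E.
have := (E 0 0, E 0 1, E 0 2, (E 1 0, E 1 1, E 1 2), (E 2 0, E 2 1, E 2 2)).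
by rewrite !mxE /= => -[[[[-> ->] ->] [[-> ->] ->]] [[-> ->] ->]].
Qed.

Lemma mx3_tr a b c d e f p q r :
  (mx3 a b c d e f p q r)^T = mx3 a d p b e q c f r.
Proof.
apply/matrixP => i j; rewrite !mxE.
by case: (ord3P i) => ->; case: (ord3P j) => ->.
Qed.

Lemma mx3_1 : 1%:M = mx3 1 0 0 0 1 0 0 0 1.
Proof.
apply/matrixP => i j; rewrite !mxE.
by case: (ord3P i) => ->; case: (ord3P j) => ->.
Qed.

Lemma mx4_1 : 1%:M = mx4 1 0 0 0 1 0 0 0 1 1.
Proof.
apply/matrixP => i j; rewrite !mxE.
by case: (ord4P i) => ->; case: (ord4P j) => ->.
Qed.

Lemma JmxE : Jmx = mx3 (-1) 0 0 0 1 0 0 0 1.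
Proof.
apply/matrixP => i j; rewrite !mxE.
by case: (ord3P i) => ->; case: (ord3P j) => -> /=; rewrite ?mulr1n ?mulr0n.
Qed.

(** The last two relations say that the first row is the first column turned
    by the rotation with cosine [(e + r) / (1 + a)] and sine
    [(f - q) / (1 + a)]. They hold because the inverse of the matrix is both
    [J C^T J] and its adjugate. *)
Lemma SO0_21_entries a b c d e f p q r : SO0_21 (mx3 a b c d e f p q r) ->
  let m := 1 + a in let x := e + r in let y := f - q in
  [/\ 1 <= a, a ^+ 2 = 1 + d ^+ 2 + p ^+ 2 & a ^+ 2 = 1 + b ^+ 2 + c ^+ 2] /\
  m * d = x * b + y * c /\ m * p = x * c - y * b.
Proof.
move=> [CJC detC a0] m x y; rewrite mxE /= in a0.
set C := mx3 _ _ _ _ _ _ _ _ _ in CJC detC.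
have JJ : Jmx *m Jmx = 1%:M :> 'M[R]_3.
  by rewrite JmxE mx3_mul mx3_1; congr mx3; ring.
have inv1 : (Jmx *m C^T *m Jmx) *m C = 1%:M.
  by rewrite -!mulmxA (mulmxA C^T) CJC JJ.
have inv2 := mulmx1C inv1.
pose A := mx3 (e * r - f * q) (c * q - b * r) (b * f - c * e)
  (f * p - d * r) (a * r - c * p) (c * d - a * f)
  (d * q - e * p) (b * p - a * q) (a * e - b * d).
have AC : A *m C = 1%:M.
  rewrite mx3_mul mx3_1; move: detC; rewrite mx3_det => detC.
  by congr mx3; try ring; rewrite -detC; ring.
have : A = Jmx *m C^T *m Jmx.
  by rewrite -[A]mulmx1 -inv2 mulmxA AC mul1mx.
rewrite mx3_tr JmxE !mx3_mul => /mx3_inj[[A1 A2 A3] [[A4 A5 A6] [A7 A8 A9]]].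
move: CJC inv2; rewrite mx3_tr JmxE !mx3_mul mx3_1.
move=> /mx3_inj[[B1 B2 B3] [[B4 B5 B6] [B7 B8 B9]]].
move=> /mx3_inj[[C1 C2 C3] [[C4 C5 C6] [C7 C8 C9]]].
have a2 : a ^+ 2 = 1 + d ^+ 2 + p ^+ 2 by clear -B1; lra.
split; split.
- by have := sqr_ge0 d; have := sqr_ge0 p; clear -a2 a0; nra.
- exact: a2.
- by clear -C1; lra.
- by rewrite /m /x /y; clear -A2 C4; lra.
- by rewrite /m /x /y; clear -A3 C7; lra.
Qed.

Lemma SO0_21_intro a b c d e f p q r : 0 < a ->
  a * (e * r - f * q) - b * (d * r - f * p) + c * (d * q - e * p) = 1 ->
  a ^+ 2 = 1 + d ^+ 2 + p ^+ 2 -> e ^+ 2 + q ^+ 2 = 1 + b ^+ 2 ->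
  f ^+ 2 + r ^+ 2 = 1 + c ^+ 2 -> a * b = d * e + p * q ->
  a * c = d * f + p * r -> b * c = e * f + q * r ->
  SO0_21 (mx3 a b c d e f p q r).
Proof.
move=> a0 D H1 H2 H3 H4 H5 H6; split; rewrite ?mx3_det ?mxE//.
rewrite mx3_tr JmxE !mx3_mul; congr mx3; nra.
Qed.

(** Only the sign condition is not formal: it is the reversed Cauchy-Schwarz
    inequality for two timelike vectors. *)
Lemma SO0_21_mul C D : SO0_21 C -> SO0_21 D -> SO0_21 (C *m D).
Proof.
move=> HC HD; have [CJC detC C0] := HC; have [DJD detD D0] := HD.
split.
- by rewrite trmx_mul -!mulmxA (mulmxA Jmx) (mulmxA C^T) (mulmxA C^T) CJC !mulmxA.
- by rewrite det_mulmx detC detD mulr1.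
move: HC HD; rewrite (mx3_eta C) (mx3_eta D) => /SO0_21_entries /= [[+ _ +] _].
move=> + + /SO0_21_entries /= [[+ + _] _].
rewrite mx3_mul [in X in _ -> _ -> _ -> _ -> X]mxE /=.
move: (C 0 0) (C 0 1) (C 0 2) (D 0 0) (D 1 0) (D 2 0) => a b c a' d p Ha Ha2 Ha' Ha'2.
clear -Ha Ha2 Ha' Ha'2.
suff : (b * d + c * p) ^+ 2 < (a * a') ^+ 2.
  have : 0 < a * a' by apply: mulr_gt0; lra.
  rewrite -addrA; move: (a * a') (b * d + c * p) => z s z0 sz.
  by rewrite ltNge; apply/negP => zs; nra.
by rewrite exprMn Ha2 Ha'2; have := sqr_ge0 (b * p - c * d); have := sqr_ge0 b;
 have := sqr_ge0 c; have := sqr_ge0 d; have := sqr_ge0 p; nra.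
Qed.

Lemma SO0_21xR_mul g g' : SO0_21xR g -> SO0_21xR g' -> SO0_21xR (g *m g').
Proof.
move=> [C [v [HC ->]]] [D [w [HD ->]]].
exists (C *m D), (v + w); split; first exact: SO0_21_mul.
rewrite (mx3_eta C) (mx3_eta D) mx3_mul !blockCvE mx4_mul expRD.
by congr mx4.
Qed.

Lemma SO0_21xR_mx4 a b c d e f p q r v : SO0_21 (mx3 a b c d e f p q r) ->
  SO0_21xR (mx4 a b c d e f p q r (expR v)).
Proof. by move=> H; exists (mx3 a b c d e f p q r), v; rewrite blockCvE. Qed.

Lemma SO0_21xRE g : SO0_21xR g -> exists a b c d e f p q r v,
  SO0_21 (mx3 a b c d e f p q r) /\ g = mx4 a b c d e f p q r (expR v).
Proof.
move=> [C [v [HC ->]]]; exists (C 0 0), (C 0 1), (C 0 2), (C 1 0), (C 1 1),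
  (C 1 2), (C 2 0), (C 2 1), (C 2 2), v; rewrite -mx3_eta; split => //.
by rewrite [in LHS](mx3_eta C) blockCvE.
Qed.

Lemma control_mxE (u1 u2 u3 : R) : u1 *: e1 + u2 *: e2 + u3 *: e3 =
  mx4 0 u3 u1 u3 0 0 u1 0 0 u2 :> 'M[R]_4.
Proof.
apply/matrixP => i j; rewrite !mxE.
by case: (ord4P i) => ->; case: (ord4P j) => -> /=;
  rewrite ?mulr0 ?mulr1 ?addr0 ?add0r ?mulr0n ?mulr1n//= ?mulr0 ?mulr1 ?addr0 ?add0r.
Qed.

Lemma mul_control g (u1 u2 u3 : R) i :
  let h := g *m (u1 *: e1 + u2 *: e2 + u3 *: e3) in
  [/\ h i 0 = u1 * g i 2 + u3 * g i 1, h i 1 = u3 * g i 0,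
      h i 2 = u1 * g i 0 & h i 3 = u2 * g i 3].
Proof.
rewrite /= control_mxE !mxE !sum_ord4 !mx4E.
by rewrite !mulr0 !addr0 !add0r; split; ring.
Qed.

End Matrices.

(** * Holonomy and calibration of horizontal curves *)

Section Calibration.
Context {R : realType}.
Variables (S : R) (W U V N : R -> R).
Hypothesis WU : forall s t : R, 0 <= s -> s <= t -> t <= S ->
  `|U t - U s| <= W t - W s.
Hypothesis WV : forall s t : R, 0 <= s -> s <= t -> t <= S ->
  `|V t - V s| <= W t - W s.
Hypothesis Wcont : forall t0 : R, 0 <= t0 <= S -> forall e : R, 0 < e ->
  \forall t \near t0, 0 <= t <= S -> `|W t - W t0| <= e.
Hypothesis NUV : forall c d s t : R, c ^+ 2 + d ^+ 2 <= 1 ->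
  0 <= s -> s <= t -> t <= S ->
  c * (U t - U s) + d * (V t - V s) <= N t - N s.
Let diff := clock_diff S W U V.

Section Holonomy.
Variables q0 q1 q2 b1 b2 x y A : R -> R.
Hypothesis q0ge : forall t : R, 0 <= t <= S -> 1 <= q0 t.
Hypothesis rel1 : forall t : R, 0 <= t <= S ->
  (1 + q0 t) * b1 t = x t * q1 t + y t * q2 t.
Hypothesis rel2 : forall t : R, 0 <= t <= S ->
  (1 + q0 t) * b2 t = x t * q2 t - y t * q1 t.
Hypothesis dq0 : forall t : R, 0 <= t <= S -> diff q0 t (q2 t) (q1 t).
Hypothesis dx : forall t : R, 0 <= t <= S -> diff x t (b2 t) (b1 t).
Hypothesis dy : forall t : R, 0 <= t <= S -> diff y t (b1 t) (- b2 t).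
Hypothesis dA : forall t : R, 0 <= t <= S ->
  diff A t (q1 t / (1 + q0 t)) (- (q2 t / (1 + q0 t))).
Hypothesis init : [/\ q0 0 = 1, x 0 = 2, y 0 = 0 & A 0 = 0].

(** [(q0, q1, q2)] and [(q0, b1, b2)] are the first row and the first column
    of a horizontal curve, and [x], [y] the trace and the antisymmetric part of
    its planar block. The form [dA] is the radial primitive of the area form
    of the hyperbolic plane, so [A] is the area between the projected curve and
    its chord. The vector [(x, y)], turned by [- A] and divided by [1 + q0], has
    zero differential; hence [(x, y)] determines [A] modulo [2 * pi]. *)
Lemma holonomy_lift t : 0 <= t <= S ->
  x t = (1 + q0 t) * cos (A t) /\ y t = (1 + q0 t) * sin (A t).
Proof.
move=> tS.
have m0 s : 0 <= s <= S -> 1 + q0 s != 0.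
  by move=> /q0ge H; rewrite gt_eqF//; lra.
have dinv s (sS : 0 <= s <= S) : diff (fun t => (1 + q0 t)^-1) s
    (- ((1 + q0 s) ^- 2) * q2 s) (- ((1 + q0 s) ^- 2) * q1 s).
  have D : is_derive (1 + q0 s) 1 (fun z : R => z^-1) (- ((1 + q0 s) ^- 2)).
    have := @is_deriveV R id (1 + q0 s) 1 1 (m0 _ sS) (is_derive_id _ _).
    by rewrite /GRing.scale /= mulr1.
  have D1 : diff (fun t => 1 + q0 t) s (q2 s) (q1 s).
    have := clock_diffD (clock_diff_cst S W U V 1 s) (dq0 sS).
    by rewrite !add0r.
  exact: (clock_diff_comp WU WV Wcont sS D1 D).
have bE s : 0 <= s <= S -> b1 s = (x s * q1 s + y s * q2 s) / (1 + q0 s) /\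
    b2 s = (x s * q2 s - y s * q1 s) / (1 + q0 s).
  by move=> sS; rewrite -rel1// -rel2// ![(1 + q0 s) * _]mulrC !mulfK ?m0.
(* both components at once: [th] is [0] or [pi / 2] *)
have K th : (x t * cos (A t + th) + y t * sin (A t + th)) * (1 + q0 t)^-1 = cos th.
  have [i1 i2 i3 i4] := init; case/andP: (tS) => t0 tleS.
  transitivity ((x 0 * cos (A 0 + th) + y 0 * sin (A 0 + th)) * (1 + q0 0)^-1); last first.
    by rewrite i1 i2 i3 i4 add0r; field.
  apply: (clock_diff0_cst WU (a := 0) (b := t) (F := fun t =>
    (x t * cos (A t + th) + y t * sin (A t + th)) * (1 + q0 t)^-1)) => // s /andP[s0 st].
  have sS : 0 <= s <= S by rewrite s0 (le_trans st).
  have dth := clock_diffD (dA sS) (clock_diff_cst S W U V th s).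
  have dC := clock_diff_comp WU WV Wcont sS dth (is_derive_cos _).
  have dS := clock_diff_comp WU WV Wcont sS dth (is_derive_sin _).
  have := clock_diffM WU WV Wcont sS (clock_diffD (clock_diffM WU WV Wcont sS (dx sS) dC)
    (clock_diffM WU WV Wcont sS (dy sS) dS)) (dinv _ sS).
  by apply: clock_diff_ext => //; have [-> ->] := bE s sS; field; exact: m0.
have m1 := m0 _ tS.
have := K 0; have := K (pi / 2); rewrite addr0 cosDpihalf sinDpihalf cos0 cos_pihalf.
move=> /(canRL (mulfVK m1)) E2 /(canRL (mulfVK m1)) E1.
rewrite mul1r in E1; rewrite mul0r in E2.
have cs := cos2Dsin2 (A t).
split; rewrite -E1.
  transitivity (x t * (cos (A t) ^+ 2 + sin (A t) ^+ 2) + 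
    sin (A t) * (x t * - sin (A t) + y t * cos (A t))); last by ring.
  by rewrite E2 cs; ring.
transitivity (y t * (cos (A t) ^+ 2 + sin (A t) ^+ 2) -
    cos (A t) * (x t * - sin (A t) + y t * cos (A t))); last by ring.
by rewrite E2 cs; ring.
Qed.

End Holonomy.

Section Eikonal.
Variables q0 q1 q2 A : R -> R.
Hypothesis q0ge : forall t : R, 0 <= t <= S -> 1 <= q0 t.
Hypothesis q0sq : forall t : R, 0 <= t <= S -> q0 t ^+ 2 = 1 + q1 t ^+ 2 + q2 t ^+ 2.
Hypothesis dq0 : forall t : R, 0 <= t <= S -> diff q0 t (q2 t) (q1 t).
Hypothesis dq1 : forall t : R, 0 <= t <= S -> diff q1 t 0 (q0 t).
Hypothesis dq2 : forall t : R, 0 <= t <= S -> diff q2 t (q0 t) 0.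
Hypothesis dA : forall t : R, 0 <= t <= S ->
  diff A t (q1 t / (1 + q0 t)) (- (q2 t / (1 + q0 t))).
Variables (k e : R) (phi : R -> R).
Hypothesis e2 : e ^+ 2 = 1.
Hypothesis dphi : forall z : R, 0 <= z ->
  is_derive z 1 phi (2 * Num.sqrt (1 + (1 - k ^+ 2) * z ^+ 2) / (1 + z ^+ 2)).
Hypothesis phi_bnd : forall z : R, 0 <= z -> 0 <= phi z <= 2 * z.

(** Since [q0] is the hyperbolic cosine of the distance to the base point, this
    is the hyperbolic sine of half that distance. *)
Definition half_sinh (z : R) := Num.sqrt ((z - 1) / 2).

(** With [s = half_sinh q0], the differential of [k A + e phi(s)] has norm 1
    wherever [1 + (1 - k^2) s^2 >= 0]: the derivative of [phi] is the positive
    root of this eikonal equation. So its growth is at most the length. At the base point [half_sinh] is not differentiable; there the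
    inequality holds to first order because [phi(s) <= 2 s] and [2 s] is at
    most the norm of [(q1, q2)], hence at most the length up to [o(dW)]. *)
Lemma calibration_le (a b : R) : 0 <= a -> a <= b -> b <= S ->
  (forall t, a <= t <= b -> 0 <= 1 + (1 - k ^+ 2) * half_sinh (q0 t) ^+ 2) ->
  (k * A b + e * phi (half_sinh (q0 b))) -
  (k * A a + e * phi (half_sinh (q0 a))) <= N b - N a.
Proof.
move=> a0 ab bS strip.
have sub t : a <= t <= b -> 0 <= t <= S.
  by case/andP => t1 t2; rewrite (le_trans a0)//= (le_trans t2).
apply: (clock_increment_le WU (F := fun t => k * A t + e * phi (half_sinh (q0 t)))) => // t0 t0ab ep ep0.
have t0S := sub _ t0ab.
have [q1lt|q1ge] := ltP 1 (q0 t0); last first.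
  have q01 : q0 t0 = 1 by apply/le_anti; rewrite q1ge q0ge.
  have [q10 q20] : q1 t0 = 0 /\ q2 t0 = 0.
    have := q0sq t0S; rewrite q01 expr1n => H.
    have := sqr_ge0 (q1 t0); have := sqr_ge0 (q2 t0) => h1 h2.
    by split; apply/eqP; rewrite -sqrf_eq0 eq_le; apply/andP; split; lra.
  have := dA t0S; rewrite q10 q20 !mul0r oppr0 => dA0.
  have := dq1 t0S; have := dq2 t0S; rewrite q01 => dq20 dq10.
  have hs0 : half_sinh (q0 t0) = 0 by rewrite /half_sinh q01 subrr mul0r sqrtr0.
  have phi0 : phi 0 = 0.
    by have := @phi_bnd 0 (lexx _); rewrite mulr0 => H; apply/le_anti; rewrite andbC.
  (* the error is spent once on [k A] and twice on the norm of [(q1, q2)] *)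
  pose ep' := ep / (`|k| + 2).
  have k20 : 0 < `|k| + 2 by rewrite ltr_wpDl.
  have ep'0 : 0 < ep' by rewrite divr_gt0.
  move: (dA0 _ ep'0) (dq10 _ ep'0) (dq20 _ ep'0) => nA n1 n2.
  have main : \forall t \near t0, 0 <= t <= S ->
      `|k * A t + e * phi (half_sinh (q0 t)) - k * A t0| <= `|N t - N t0| + ep * `|W t - W t0|.
    near=> t => tS.
    have HA : `|A t - A t0 - (0 * (U t - U t0) + 0 * (V t - V t0))| <= ep' * `|W t - W t0|.
      by move: tS; near: t.
    have H1 : `|q1 t - q1 t0 - (0 * (U t - U t0) + 1 * (V t - V t0))| <= ep' * `|W t - W t0|.
      by move: tS; near: t.
    have H2 : `|q2 t - q2 t0 - (1 * (U t - U t0) + 0 * (V t - V t0))| <= ep' * `|W t - W t0|.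
      by move: tS; near: t.
    rewrite !mul0r !addr0 subr0 in HA.
    rewrite q10 mul0r add0r mul1r subr0 in H1.
    rewrite q20 mul0r addr0 mul1r subr0 in H2.
    have -> : k * A t + e * phi (half_sinh (q0 t)) - k * A t0 =
      k * (A t - A t0) + e * phi (half_sinh (q0 t)) by ring.
    apply: le_trans (ler_normD _ _) _; rewrite !normrM.
    have -> : `|e| = 1.
      by apply/eqP; rewrite -(@eqrXn2 _ 2)// ?expr1n// real_normK ?num_real// e2.
    rewrite mul1r.
    have hs : 0 <= half_sinh (q0 t) by rewrite sqrtr_ge0.
    have /andP[p0 p2] := phi_bnd hs; rewrite (ger0_norm p0).
    pose rho := Num.sqrt (q1 t ^+ 2 + q2 t ^+ 2).
    have rho0 : 0 <= rho by rewrite sqrtr_ge0.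
    have rho2E : rho ^+ 2 = q1 t ^+ 2 + q2 t ^+ 2 by rewrite sqr_sqrtr// addr_ge0// sqr_ge0.
    have q0t := q0ge tS.
    have hsrho : 2 * half_sinh (q0 t) <= rho.
      rewrite -(ler_pXn2r (n := 2)) ?nnegrE ?mulr_ge0// exprMn.
      rewrite sqr_sqrtr; last by rewrite divr_ge0// subr_ge0.
      have := q0sq tS; rewrite rho2E; nra.
    have rhoN : rho <= `|N t - N t0| + 2 * ep' * `|W t - W t0|.
      have [->|rhon0] := eqVneq rho 0; first by rewrite addr_ge0// !mulr_ge0// ltW.
      have rhop : 0 < rho by rewrite lt_def rhon0.
      pose c := q2 t / rho; pose d := q1 t / rho.
      have cd1 : c ^+ 2 + d ^+ 2 = 1.
        by rewrite /c /d !expr_div_n -mulrDl addrC -rho2E divff// expf_neq0.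
      have -> : rho = c * q2 t + d * q1 t.
        rewrite /c /d ![_ / _ * _]mulrAC -mulrDl -!expr2 addrC -rho2E.
        by rewrite expr2 mulfK.
      have -> : c * q2 t + d * q1 t = c * (U t - U t0) + d * (V t - V t0) +
        (c * (q2 t - (U t - U t0)) + d * (q1 t - (V t - V t0))) by ring.
      have le1 z : z ^+ 2 <= 1 -> `|z| <= 1 :> R.
        by move=> z1; rewrite -sqrtr_sqr -[leRHS]sqrtr1 ler_wsqrtr.
      have c1 : `|c| <= 1 by apply: le1; rewrite -cd1 lerDl sqr_ge0.
      have d1 : `|d| <= 1 by apply: le1; rewrite -cd1 lerDr sqr_ge0.
      apply: lerD.
        case/andP: (tS) => t1 t2; case/andP: (t0S) => t3 t4.
        have [tt0|/ltW tt0] := leP t0 t.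
          by apply: le_trans (ler_norm _); apply: NUV; rewrite ?cd1.
        rewrite distrC; apply: le_trans (ler_norm _).
        have := @NUV (- c) (- d) t t0; rewrite !sqrrN cd1 => /(_ (lexx _) t1 tt0 t4).
        by lra.
      apply: le_trans (ler_norm _) _; apply: le_trans (ler_normD _ _) _.
      rewrite (normrM c) (normrM d).
      have B1 : `|c| * `|q2 t - (U t - U t0)| <= ep' * `|W t - W t0|.
        exact: le_trans (ler_piMl (normr_ge0 _) c1) H2.
      have B2 : `|d| * `|q1 t - (V t - V t0)| <= ep' * `|W t - W t0|.
        exact: le_trans (ler_piMl (normr_ge0 _) d1) H1.
      have -> : 2 * ep' * `|W t - W t0| = ep' * `|W t - W t0| + ep' * `|W t - W t0|.
        by ring.
      exact: lerD.
    apply: (@le_trans _ _ (`|k| * (ep' * `|W t - W t0|) + (`|N t - N t0| + 2 * ep' * `|W t - W t0|))).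
      by apply: lerD; [exact: ler_wpM2l | apply: le_trans rhoN; exact: le_trans hsrho].
    rewrite addrCA lerD2l.
    have -> : `|k| * (ep' * `|W t - W t0|) + 2 * ep' * `|W t - W t0| =
      (ep' * (`|k| + 2)) * `|W t - W t0| by ring.
    by rewrite /ep' divfK ?gt_eqF.
  have Nmono s t : 0 <= s -> s <= t -> t <= S -> 0 <= N t - N s.
    move=> s0 st tS; have := @NUV 0 0 s t; rewrite !mul0r addr0; apply => //.
    by rewrite expr0n /= addr0.
  move: main; apply: filterS => t main /sub /[dup] /main.
  rewrite -q01 hs0 phi0 mulr0 addr0 => {}main /andP[t1 t2]; case/andP: t0S => t3 t4.
  split => tt0.
    move: main; rewrite (ger0_norm (Nmono _ _ t3 tt0 t2)).
    rewrite (ger0_norm (_ : 0 <= W t - W t0)) ?subr_ge0 ?(clock_le WU)//.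
    by rewrite ler_norml => /andP[_]; lra.
  move: main; rewrite distrC (distrC (N t)) (distrC (W t)) (ger0_norm (Nmono _ _ t1 tt0 t4)).
  rewrite (ger0_norm (_ : 0 <= W t0 - W t)) ?subr_ge0 ?(clock_le WU)//.
  by rewrite ler_norml => /andP[_]; lra.
set s0 := half_sinh (q0 t0).
have s0p : 0 < s0 by rewrite sqrtr_gt0 divr_gt0// subr_gt0.
have s0sq : s0 ^+ 2 = (q0 t0 - 1) / 2 by rewrite sqr_sqrtr// divr_ge0// subr_ge0 ltW.
pose r := Num.sqrt (1 + (1 - k ^+ 2) * s0 ^+ 2).
have rsq : r ^+ 2 = 1 + (1 - k ^+ 2) * s0 ^+ 2 by rewrite sqr_sqrtr// strip.
pose D := (2 * r / (1 + s0 ^+ 2)) * ((2 * s0)^-1 * 2^-1).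
have dhs : diff (fun t => half_sinh (q0 t)) t0 (((2 * s0)^-1 * 2^-1) * q2 t0)
    (((2 * s0)^-1 * 2^-1) * q1 t0).
  have dh : is_derive (q0 t0) 1 half_sinh ((2 * s0)^-1 * 2^-1).
    rewrite /half_sinh.
    have h : 0 < (q0 t0 - 1) / 2 by rewrite divr_gt0// subr_gt0.
    have h2 : is_derive (q0 t0) 1 (fun z : R => (z - 1) / 2) 2^-1.
      by apply: is_derive_eq; rewrite /GRing.scale /=; ring.
    by have := @is_derive1_comp R Num.sqrt (fun z : R => (z - 1) / 2) (q0 t0) _ _ (is_derive1_sqrt h) h2.
  exact: (clock_diff_comp WU WV Wcont t0S (dq0 t0S) dh).
have dF := clock_diffD (clock_diffZ k (dA t0S))
   (clock_diffZ e (clock_diff_comp WU WV Wcont t0S dhs (dphi (ltW s0p)))).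
move: dF; set c := (_ + _ : R); set d := (_ + _ : R) => dF.
have cd1 : c ^+ 2 + d ^+ 2 = 1.
  have q0E : q0 t0 = 1 + 2 * s0 ^+ 2 by rewrite s0sq; field.
  have ss : 0 < 1 + s0 ^+ 2 by rewrite ltr_pwDl// sqr_ge0.
  have m0 : 1 + q0 t0 = 2 * (1 + s0 ^+ 2) by rewrite q0E; ring.
  have rho : q1 t0 ^+ 2 + q2 t0 ^+ 2 = 4 * s0 ^+ 2 * (1 + s0 ^+ 2).
    have := q0sq t0S; rewrite q0E => H.
    have -> : q1 t0 ^+ 2 + q2 t0 ^+ 2 = (1 + 2 * s0 ^+ 2) ^+ 2 - 1 by rewrite H; ring.
    by ring.
  transitivity ((q1 t0 ^+ 2 + q2 t0 ^+ 2) * (k ^+ 2 / (1 + q0 t0) ^+ 2 + e ^+ 2 * D ^+ 2)).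
    by rewrite /c /d /D -/r; field; rewrite m0 !gt_eqF//= ?mulr_gt0.
  rewrite rho m0 e2 mul1r.
  transitivity ((k ^+ 2 * s0 ^+ 2 + r ^+ 2) / (1 + s0 ^+ 2)).
    by rewrite /D; field; rewrite !gt_eqF.
  by rewrite rsq; field; rewrite gt_eqF.
have cd1' : c ^+ 2 + d ^+ 2 <= 1 by rewrite cd1.
have := clock_diff_bound WU t0S dF (fun s t => @NUV c d s t cd1') ep0.
by apply: filterS => t H /sub; exact: H.
Unshelve. all: by end_near. Qed.

End Eikonal.
End Calibration.

(** * Real functions and half-time trigonometry *)

Section RealFunctions.
Context {R : realType}.
Notation mu := (@lebesgue_measure R).
Implicit Types (f df : R -> R).

Lemma is_derive_continuous f df (a b : R) :
  (forall x, a <= x <= b -> is_derive x 1 f (df x)) ->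
  {within `[a, b], continuous f}.
Proof.
move=> H; apply: derivable_within_continuous => x xab.
by apply: ex_derive; apply: H; move: xab; rewrite in_itv.
Qed.

Lemma derive_nondecreasing f df (a b : R) : a <= b ->
  (forall x, a <= x <= b -> is_derive x 1 f (df x)) ->
  (forall x, a < x < b -> 0 <= df x) -> f a <= f b.
Proof.
rewrite le_eqVlt => /predU1P[->//|ab] D P.
have [] := @MVT R f df a b ab _ (is_derive_continuous D).
  by move=> x; rewrite in_itv /= => /andP[? ?]; apply: D; rewrite !ltW.
move=> c; rewrite in_itv /= => cab E; rewrite -subr_ge0 E mulr_ge0 ?P//.
by rewrite subr_ge0 ltW.
Qed.

Lemma derive_increasing f df (a b : R) : a < b ->
  (forall x, a <= x <= b -> is_derive x 1 f (df x)) ->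
  (forall x, a < x < b -> 0 < df x) -> f a < f b.
Proof.
move=> ab D P; have [] := @MVT R f df a b ab _ (is_derive_continuous D).
  by move=> x; rewrite in_itv /= => /andP[? ?]; apply: D; rewrite !ltW.
move=> c; rewrite in_itv /= => cab E; rewrite -subr_gt0 E mulr_gt0 ?P//.
by rewrite subr_gt0.
Qed.

Lemma derive0_constant f (a b : R) : a <= b ->
  (forall x, a <= x <= b -> is_derive x 1 f 0) -> f b = f a.
Proof.
move=> ab D; apply/le_anti/andP; split; last exact: (derive_nondecreasing ab D).
rewrite -lerN2; apply: (derive_nondecreasing (f := fun x => - f x) (df := fun=> 0)) => // x /D H.
by rewrite -oppr0; exact: is_deriveN.
Qed.

(** The integral starts at [-1], so that differentiability at [0] is
    two-sided. *)
Definition antiderivative f (x : R) : R :=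
  \int[mu]_(t in `[-1, x]) f t - \int[mu]_(t in `[-1, 0]) f t.

Lemma antiderivative0 f : antiderivative f 0 = 0.
Proof. by rewrite /antiderivative subrr. Qed.

Lemma is_derive_antiderivative f (x : R) : continuous f -> -1 < x ->
  is_derive x 1 (antiderivative f) (f x).
Proof.
move=> fc x1.
have [||dF vF] := @continuous_FTC1_closed R f (-1) x (x + 1) _ _ x1 (fc x).
- by rewrite ltrDl.
- apply: continuous_compact_integrable; first exact: segment_compact.
  exact: continuous_subspaceT.
set F := (fun y => _) in dF vF.
have D : is_derive x 1 F (f x).
  by apply: (DeriveDef dF); rewrite -derive1E; exact: vF.
have := is_deriveB D (is_derive_cst (\int[mu]_(t in `[-1, 0]) f t) x 1).
by rewrite subr0.
Qed.

End RealFunctions.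

Section Trigonometry.
Context {R : realType}.
Implicit Types (c k t : R).

(** [sn c] and [cn c] solve [s' = h / 2], [h' = c s / 2] with [s 0 = 0] and
    [h 0 = 1]. For [c = 1 - k ^+ 2], an arc of length [t] and geodesic
    curvature [k] has end points at distance [2 arcsinh (sn c t)]. *)
Definition sn c t : R :=
  if 0 < c then sinh (Num.sqrt c * t / 2) / Num.sqrt c
  else if c < 0 then sin (Num.sqrt (- c) * t / 2) / Num.sqrt (- c) else t / 2.

Definition cn c t : R :=
  if 0 < c then cosh (Num.sqrt c * t / 2)
  else if c < 0 then cos (Num.sqrt (- c) * t / 2) else 1.

Lemma is_derive_sinh (x : R) : is_derive x 1 (@sinh R) (cosh x).
Proof.
rewrite /sinh /cosh; apply: is_derive_eq.
by rewrite /GRing.scale /=; ring.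
Qed.

Lemma is_derive_cosh (x : R) : is_derive x 1 (@cosh R) (sinh x).
Proof.
rewrite /sinh /cosh; apply: is_derive_eq.
by rewrite /GRing.scale /=; ring.
Qed.

Lemma cosh2_sinh2 (x : R) : cosh x ^+ 2 - sinh x ^+ 2 = 1.
Proof.
rewrite /sinh /cosh; transitivity (expR x * expR (- x)); first by field.
by rewrite -expRD subrr expR0.
Qed.

Let is_derive_lin (w t : R) : is_derive t 1 (fun t => w * t / 2) (w / 2).
Proof. by apply: is_derive_eq; rewrite /GRing.scale /=; ring. Qed.

Lemma is_derive_sn c t : is_derive t 1 (sn c) (cn c t / 2).
Proof.
rewrite /sn /cn; case: ltgtP => c0.
- have w0 : Num.sqrt c != 0 by rewrite gt_eqF// sqrtr_gt0.
  have D : is_derive t 1 (fun t => sinh (Num.sqrt c * t / 2)) (cosh (Num.sqrt c * t / 2) * (Num.sqrt c / 2)).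
    exact: (@is_derive1_comp R (@sinh R) _ _ _ _ (is_derive_sinh _) (is_derive_lin _ _)).
  apply: is_derive_eq; rewrite /GRing.scale /=; field; exact: w0.
- have w0 : Num.sqrt (- c) != 0 by rewrite gt_eqF// sqrtr_gt0 oppr_gt0.
  have D : is_derive t 1 (fun t => sin (Num.sqrt (- c) * t / 2)) (cos (Num.sqrt (- c) * t / 2) * (Num.sqrt (- c) / 2)).
    exact: (@is_derive1_comp R (@sin R) _ _ _ _ (is_derive_sin _) (is_derive_lin _ _)).
  apply: is_derive_eq; rewrite /GRing.scale /=; field; exact: w0.
- apply: is_derive_eq; rewrite /GRing.scale /=; ring.
Qed.

Lemma is_derive_cn c t : is_derive t 1 (cn c) (c * sn c t / 2).
Proof.
rewrite /sn /cn; case: ltgtP => c0.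
- have w0 : Num.sqrt c != 0 by rewrite gt_eqF// sqrtr_gt0.
  have D : is_derive t 1 (fun t => cosh (Num.sqrt c * t / 2)) (sinh (Num.sqrt c * t / 2) * (Num.sqrt c / 2)).
    exact: (@is_derive1_comp R (@cosh R) _ _ _ _ (is_derive_cosh _) (is_derive_lin _ _)).
  apply: is_derive_eq; rewrite /GRing.scale /=.
  have : c = Num.sqrt c ^+ 2 by rewrite sqr_sqrtr// ltW.
  move: w0; set w := Num.sqrt c => w0 ->; field; exact: w0.
- have w0 : Num.sqrt (- c) != 0 by rewrite gt_eqF// sqrtr_gt0 oppr_gt0.
  have D : is_derive t 1 (fun t => cos (Num.sqrt (- c) * t / 2)) (- sin (Num.sqrt (- c) * t / 2) * (Num.sqrt (- c) / 2)).
    exact: (@is_derive1_comp R (@cos R) _ _ _ _ (is_derive_cos _) (is_derive_lin _ _)).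
  apply: is_derive_eq; rewrite /GRing.scale /=.
  have : c = - Num.sqrt (- c) ^+ 2 by rewrite sqr_sqrtr ?opprK// oppr_ge0 ltW.
  move: w0; set w := Num.sqrt (- c) => w0 ->; field; exact: w0.
- by apply: is_derive_eq; rewrite -c0; ring.
Qed.

Lemma sn0 c : sn c 0 = 0.
Proof.
by rewrite /sn !mulr0 !mul0r sin0 /sinh oppr0 subrr !mul0r !if_same.
Qed.

Lemma cn0 c : cn c 0 = 1.
Proof.
rewrite /cn !mulr0 !mul0r cos0 /cosh oppr0 expR0.
by case: ifP => _; [field | case: ifP].
Qed.

Lemma cn_sn c t : cn c t ^+ 2 = 1 + c * sn c t ^+ 2.
Proof.
rewrite /sn /cn; case: ltgtP => c0.
- rewrite [in RHS]expr_div_n sqr_sqrtr ?(ltW c0)//.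
  have := cosh2_sinh2 (Num.sqrt c * t / 2) => H.
  move: (cosh _) (sinh _) H => A B H.
  rewrite (_ : c * (B ^+ 2 / c) = B ^+ 2); first by lra.
  by field; rewrite gt_eqF.
- rewrite [in RHS]expr_div_n sqr_sqrtr ?oppr_ge0 ?(ltW c0)//.
  have := cos2Dsin2 (Num.sqrt (- c) * t / 2) => H.
  move: (cos _) (sin _) H => A B H.
  rewrite (_ : c * (B ^+ 2 / - c) = - B ^+ 2); first by lra.
  by field; rewrite lt_eqF.
- by rewrite -c0 mul0r addr0 expr1n.
Qed.

End Trigonometry.

(** * Holonomy of an arc of constant curvature *)

Section HolonomyAngle.
Context {R : realType}.
Implicit Types (k t z : R).

(** The polar angle of the end point of the arc of length [t] and curvature
    [k], seen from its origin and from its initial direction; [om_cos_sin]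
    gives its value. The integral selects the continuous branch. *)
Definition om k : R -> R :=
  antiderivative (fun t => k / 2 / (1 + sn (1 - k ^+ 2) t ^+ 2)).
(** The area between the arc and its chord, by the Gauss-Bonnet formula. *)
Definition hol k t : R := k * t - 2 * om k t.
(** The radial part of the calibration of curvature [k]; the square root is
    meant where its argument is nonnegative. *)
Definition phi k : R -> R :=
  antiderivative (fun z => 2 * Num.sqrt (1 + (1 - k ^+ 2) * z ^+ 2) / (1 + z ^+ 2)).

Lemma sqr1_gt0 z : 0 < 1 + z ^+ 2.
Proof. by rewrite ltr_pwDl// sqr_ge0. Qed.

Lemma sn_continuous (c : R) : continuous (sn c).
Proof.
by move=> t; apply: differentiable_continuous; apply/derivable1_diffP;
  apply: ex_derive; exact: is_derive_sn.
Qed.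

Lemma is_derive_om k t : -1 < t ->
  is_derive t 1 (om k) (k / 2 / (1 + sn (1 - k ^+ 2) t ^+ 2)).
Proof.
move=> t1; apply: (is_derive_antiderivative (f := fun t => k / 2 / (1 + sn (1 - k ^+ 2) t ^+ 2))) => // x.
apply: cvgM; first exact: cvg_cst.
apply: cvgV; first by rewrite gt_eqF// sqr1_gt0.
apply: cvgD; first exact: cvg_cst.
by apply: cvgM; exact: sn_continuous.
Qed.

Lemma om0 k : om k 0 = 0.
Proof. exact: antiderivative0. Qed.

Lemma hol0 k : hol k 0 = 0.
Proof. by rewrite /hol om0 !mulr0 subrr. Qed.

Lemma is_derive_hol k t : -1 < t -> is_derive t 1 (hol k)
  (k * sn (1 - k ^+ 2) t ^+ 2 / (1 + sn (1 - k ^+ 2) t ^+ 2)).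
Proof.
move=> /(is_derive_om k) D; rewrite /hol; apply: is_derive_eq.
by rewrite /GRing.scale /=; field; rewrite gt_eqF// sqr1_gt0.
Qed.

Lemma is_derive_phi k z : -1 < z -> is_derive z 1 (phi k)
  (2 * Num.sqrt (1 + (1 - k ^+ 2) * z ^+ 2) / (1 + z ^+ 2)).
Proof.
move=> z1; apply: (is_derive_antiderivative (f := fun z => 2 * Num.sqrt (1 + (1 - k ^+ 2) * z ^+ 2) / (1 + z ^+ 2))) => // x.
have sq : (fun y : R => y ^+ 2) @ x --> x ^+ 2 by apply: cvgM; exact: cvg_id.
apply: cvgM.
  apply: cvgM; first exact: cvg_cst.
  apply: (@cvg_comp _ _ _ (fun z => 1 + (1 - k ^+ 2) * z ^+ 2) Num.sqrt).
    by apply: cvgD; [exact: cvg_cst|apply: cvgM; [exact: cvg_cst|exact: sq]].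
  exact: sqrt_continuous.
apply: cvgV; first by rewrite gt_eqF// sqr1_gt0.
by apply: cvgD; [exact: cvg_cst|exact: sq].
Qed.

Lemma phi_bounds k z : 0 <= z -> 0 <= phi k z <= 2 * z.
Proof.
move=> z0.
have gt (x : R) : 0 <= x -> -1 < x :> R by move=> x0; lra.
have p0 : phi k 0 = 0 by exact: antiderivative0.
have D (x : R) : 0 <= x <= z -> is_derive x 1 (phi k)
    (2 * Num.sqrt (1 + (1 - k ^+ 2) * x ^+ 2) / (1 + x ^+ 2)).
  by move=> /andP[x0 _]; apply: is_derive_phi; exact: gt.
apply/andP; split.
  rewrite -p0; apply: (derive_nondecreasing z0 D) => x _.
  by rewrite divr_ge0 ?mulr_ge0 ?sqrtr_ge0// ltW// sqr1_gt0.
rewrite -subr_ge0 -[leLHS](_ : 2 * 0 - phi k 0 = 0); last by rewrite p0 mulr0 subrr.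
have := @derive_nondecreasing R (fun x => 2 * x - phi k x)
  (fun x => 2 - 2 * Num.sqrt (1 + (1 - k ^+ 2) * x ^+ 2) / (1 + x ^+ 2)) 0 z z0.
apply=> [x /D Dx|x _].
  by apply: is_derive_eq; rewrite /GRing.scale /=; ring.
rewrite subr_ge0 ler_pdivrMr ?sqr1_gt0// ler_pM2l// .
rewrite -[leRHS](ger0_norm (ltW (sqr1_gt0 x))) -sqrtr_sqr ler_wsqrtr//.
by have := sqr_ge0 x; have := sqr_ge0 (k * x); nra.
Qed.

Lemma cn_k_sn k t :
  cn (1 - k ^+ 2) t ^+ 2 + k ^+ 2 * sn (1 - k ^+ 2) t ^+ 2 =
  1 + sn (1 - k ^+ 2) t ^+ 2.
Proof. by rewrite cn_sn; ring. Qed.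

(** The vector [(cn, k sn)], divided by its norm and turned by [- om], is
    constant. *)
Lemma om_cos_sin k t : 0 <= t ->
  let s := sn (1 - k ^+ 2) t in let r := Num.sqrt (1 + s ^+ 2) in
  cn (1 - k ^+ 2) t = r * cos (om k t) /\ k * s = r * sin (om k t).
Proof.
move=> t0 s r; set c := 1 - k ^+ 2 in s r *.
have gt (x : R) : 0 <= x <= t -> -1 < x :> R by move=> /andP[x0 _]; lra.
pose q x := (Num.sqrt (1 + sn c x ^+ 2))^-1.
have dq (x : R) : is_derive x 1 q (- (sn c x * cn c x / 2) * q x ^+ 3).
  have p0 := sqr1_gt0 (sn c x).
  have r0 : Num.sqrt (1 + sn c x ^+ 2) != 0 by rewrite gt_eqF// sqrtr_gt0.
  have d1 : is_derive x 1 (fun x => 1 + sn c x ^+ 2) (sn c x * cn c x).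
    have := is_derive_sn c x => D.
    by apply: is_derive_eq; rewrite /GRing.scale /=; field.
  have d2 := @is_derive1_comp R Num.sqrt (fun x => 1 + sn c x ^+ 2) x _ _
    (is_derive1_sqrt p0) d1.
  have d3 : is_derive x 1 q (- (Num.sqrt (1 + sn c x ^+ 2)) ^- 2 *: ((2 * Num.sqrt (1 + sn c x ^+ 2))^-1 * (sn c x * cn c x))).
    exact: (is_deriveV (f := fun x => Num.sqrt (1 + sn c x ^+ 2)) r0 d2).
  apply: is_derive_eq; rewrite /GRing.scale /= /q; field; exact: r0.
have q2 x : q x ^+ 3 = q x * (1 + sn c x ^+ 2)^-1.
  by rewrite exprS /q exprVn sqr_sqrtr// ltW// sqr1_gt0.
(* both components at once: [th] is [0] or [pi / 2] *)
have K th : (cn c t * cos (om k t + th) + k * sn c t * sin (om k t + th)) * q t =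
    cos th.
  pose P x := (cn c x * cos (om k x + th) + k * sn c x * sin (om k x + th)) * q x.
  transitivity (P 0).
    apply: (derive0_constant (f := P)) => // x xt; have x1 := gt _ xt.
    have dom : is_derive x 1 (fun x => om k x + th) (k / 2 / (1 + sn c x ^+ 2)).
      have := is_deriveD (is_derive_om k x1) (is_derive_cst th x 1).
      by rewrite addr0.
    have H1 : is_derive x 1 (fun x => cos (om k x + th))
        (- sin (om k x + th) * (k / 2 / (1 + sn c x ^+ 2))).
      exact: (@is_derive1_comp R (@cos R) _ _ _ _ (is_derive_cos _) dom).
    have H2 : is_derive x 1 (fun x => sin (om k x + th))
        (cos (om k x + th) * (k / 2 / (1 + sn c x ^+ 2))).
      exact: (@is_derive1_comp R (@sin R) _ _ _ _ (is_derive_sin _) dom).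
    have := is_derive_sn c x; have := is_derive_cn c x; have := dq x; rewrite q2 => H3 H4 H5.
    apply: is_derive_eq; rewrite /GRing.scale /=.
    have h2 := cn_sn c x; have p0 := sqr1_gt0 (sn c x).
    transitivity (q x / (1 + sn c x ^+ 2) / 2 * (cos (om k x + th) * sn c x *
       (1 + c * sn c x ^+ 2 - cn c x ^+ 2))).
      by rewrite /c; field; rewrite gt_eqF.
    by rewrite h2 subrr !mulr0.
  by rewrite /P /q om0 sn0 cn0 expr0n /= addr0 sqrtr1 invr1 add0r; ring.
have r0 : r != 0 by rewrite gt_eqF// sqrtr_gt0 sqr1_gt0.
have := K 0; have := K (pi / 2); rewrite addr0 cosDpihalf sinDpihalf cos0 cos_pihalf.
rewrite /q -/s -/r => /(canRL (mulfVK r0)) E2 /(canRL (mulfVK r0)) E1.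
rewrite mul1r in E1; rewrite mul0r in E2.
have cs := cos2Dsin2 (om k t).
split; rewrite -E1.
  transitivity (cn c t * (cos (om k t) ^+ 2 + sin (om k t) ^+ 2) +
    sin (om k t) * (cn c t * - sin (om k t) + k * s * cos (om k t))); last by ring.
  by rewrite E2 cs; ring.
transitivity (k * s * (cos (om k t) ^+ 2 + sin (om k t) ^+ 2) -
    cos (om k t) * (cn c t * - sin (om k t) + k * s * cos (om k t))); last by ring.
by rewrite E2 cs; ring.
Qed.

End HolonomyAngle.

(** * Arcs of constant curvature in the hyperbolic plane *)

Section CircleArcs.
Context {R : realType}.
Implicit Types (k t z : R).

(** A circle of geodesic curvature [k > 1] has length [2 * pi / kap k]. *)
Definition kap k : R := Num.sqrt (k ^+ 2 - 1).

Lemma kap_gt0 k : 1 < k -> 0 < kap k.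
Proof. by move=> k1; rewrite sqrtr_gt0; nra. Qed.

Lemma kap2 k : 1 <= k -> kap k ^+ 2 = k ^+ 2 - 1.
Proof. by move=> k1; rewrite sqr_sqrtr//; nra. Qed.

Lemma half_le_full k : 1 < k -> pi / kap k <= 2 * pi / kap k.
Proof.
by move=> k1; rewrite -mulrA ler_pMl ?ler1n// divr_gt0 ?pi_gt0 ?kap_gt0.
Qed.

Lemma sn_cn_circle k t : 1 < k ->
  sn (1 - k ^+ 2) t = sin (kap k * t / 2) / kap k /\
  cn (1 - k ^+ 2) t = cos (kap k * t / 2).
Proof.
move=> k1; have c0 : 1 - k ^+ 2 < 0 by nra.
by rewrite /sn /cn ltNge (ltW c0) /= c0 opprB.
Qed.

Lemma cosh_gt0 (x : R) : 0 < cosh x.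
Proof. by rewrite divr_gt0// addr_gt0// expR_gt0. Qed.

Lemma cn_gt0 k t : 0 < k -> k <= 1 -> 0 < cn (1 - k ^+ 2) t.
Proof.
move=> k0 k1; have c0 : 0 <= 1 - k ^+ 2 by nra.
rewrite /cn; case: ifP => _; first exact: cosh_gt0.
by rewrite [1 - _ < 0]ltNge c0 /= ltr01.
Qed.

Lemma cn_ge0 k t : 0 < k -> 0 <= t -> (1 < k -> t <= pi / kap k) ->
  0 <= cn (1 - k ^+ 2) t.
Proof.
move=> k0 t0 tk; have [k1|k1] := ltP 1 k; last by rewrite ltW// cn_gt0.
have [_ ->] := sn_cn_circle t k1; have kp := kap_gt0 k1.
have h1 : kap k * t <= pi by rewrite mulrC -ler_pdivlMr// tk.
have h2 : 0 <= kap k * t by rewrite mulr_ge0// ltW.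
by rewrite cos_ge0_pihalf//; have := pi_gt0 R; lra.
Qed.

Lemma sn_nondecreasing k s t : 1 < k -> 0 <= s -> s <= t -> t <= pi / kap k ->
  sn (1 - k ^+ 2) s <= sn (1 - k ^+ 2) t.
Proof.
move=> k1 s0 st tk.
apply: (derive_nondecreasing (df := fun t => cn (1 - k ^+ 2) t / 2) st) => [y _|y].
  exact: is_derive_sn.
move=> /andP[sy yt]; rewrite divr_ge0// cn_ge0//; [lra|lra|].
by move=> _; rewrite (le_trans (ltW yt)).
Qed.

Lemma sn_gt0 k t : 0 < k -> 0 < t -> (1 < k -> t < 2 * pi / kap k) ->
  0 < sn (1 - k ^+ 2) t.
Proof.
move=> k0 t0 tk; have [k1|k1] := ltP 1 k.
  have [-> _] := sn_cn_circle t k1; have kp := kap_gt0 k1.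
  rewrite divr_gt0// sin_gt0_pi// divr_gt0 ?mulr_gt0//=.
  by move: (tk k1); rewrite ltr_pdivlMr// ltr_pdivrMr// mulrC [pi * _]mulrC.
rewrite -(sn0 (1 - k ^+ 2)).
apply: (derive_increasing (df := fun t => cn (1 - k ^+ 2) t / 2)) => // x _.
  exact: is_derive_sn.
by rewrite divr_gt0// cn_gt0.
Qed.

Lemma sn_ge0 k t : 0 < k -> 0 <= t -> (1 < k -> t <= 2 * pi / kap k) ->
  0 <= sn (1 - k ^+ 2) t.
Proof.
move=> k0; rewrite le_eqVlt => /predU1P[<- _|t0 tk]; first by rewrite sn0.
have [k1|k1] := ltP 1 k; last by rewrite ltW// sn_gt0// ltNge k1.
have [-> _] := sn_cn_circle t k1; have kp := kap_gt0 k1.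
apply: divr_ge0; last exact: ltW.
apply: sin_ge0_pi; rewrite divr_ge0 ?mulr_ge0 ?(ltW kp) ?(ltW t0)//=.
by move: (tk k1); rewrite ler_pdivlMr// ler_pdivrMr// mulrC [pi * _]mulrC.
Qed.

Lemma om_ge0 k t : 0 < k -> 0 <= t -> 0 <= om k t.
Proof.
move=> k0 t0; rewrite -(om0 k).
apply: (derive_nondecreasing (df := fun t => k / 2 / (1 + sn (1 - k ^+ 2) t ^+ 2))) => // x.
  by move=> /andP[x0 _]; apply: is_derive_om; lra.
by move=> _; rewrite !divr_ge0 ?ltW// sqr1_gt0.
Qed.

Lemma om_continuous k t : {within `[0, t], continuous (om k)}.
Proof.
apply: (is_derive_continuous (df := fun t => k / 2 / (1 + sn (1 - k ^+ 2) t ^+ 2))).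
by move=> x /andP[x0 _]; apply: is_derive_om; lra.
Qed.

Lemma hol_continuous k t : {within `[0, t], continuous (hol k)}.
Proof.
apply: (is_derive_continuous (df := fun t => k * sn (1 - k ^+ 2) t ^+ 2 / (1 + sn (1 - k ^+ 2) t ^+ 2))).
by move=> x /andP[x0 _]; apply: is_derive_hol; lra.
Qed.

(** To exceed [pi], [om] would take the value [pi] at a time where [sn]
    vanishes, that is, not before a full turn. *)
Lemma om_lepi k t : 0 < k -> 0 <= t -> (1 < k -> t <= 2 * pi / kap k) ->
  om k t <= pi.
Proof.
move=> k0 t0 tk; rewrite leNgt; apply/negP => opi.
have [|s] := IVT t0 (om_continuous (k := k) (t := t)) (v := pi).
  rewrite om0 ge_min pi_ge0 /= le_max (ltW opi) orbT//.
rewrite in_itv /= => /andP[s0 st] os.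
have sneq : sn (1 - k ^+ 2) s = 0.
  have [_] := om_cos_sin k s0; rewrite os sinpi mulr0 => /eqP.
  by rewrite mulf_eq0 gt_eqF// => /eqP.
have sp : 0 < s.
  by rewrite lt_def s0 andbT; apply/eqP => s00; move: os (pi_gt0 R); rewrite s00 om0 => <-; rewrite ltxx.
have slt : s < t.
  by rewrite lt_def st andbT; apply/eqP => ts; move: opi; rewrite ts os ltxx.
have : 0 < sn (1 - k ^+ 2) s.
  by apply: sn_gt0 => // /tk; apply: lt_le_trans.
by rewrite sneq ltxx.
Qed.

Lemma om_strict k t : 0 < k -> 0 < t -> (1 < k -> t < 2 * pi / kap k) ->
  0 < om k t < pi.
Proof.
move=> k0 t0 tk; have sp := sn_gt0 k0 t0 tk.
have [_ E] := om_cos_sin k (ltW t0).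
have S0 : sin (om k t) != 0.
  by apply/eqP => S0; move: E; rewrite S0 mulr0 => /eqP; rewrite mulf_eq0 !gt_eqF.
have o0 := om_ge0 k0 (ltW t0).
have opi : om k t <= pi by apply: om_lepi => //; [exact: ltW | move=> /tk /ltW].
apply/andP; split; rewrite lt_def ?o0 ?opi andbT.
  by apply: contraNneq S0 => ->; rewrite sin0.
by apply: contraNneq S0 => <-; rewrite sinpi.
Qed.

Lemma half_turn k : 1 < k -> sn (1 - k ^+ 2) (pi / kap k) = (kap k)^-1 /\
  om k (pi / kap k) = pi / 2.
Proof.
move=> k1; have kp := kap_gt0 k1; have k0 : 0 < k by lra.
have [sE cE] := sn_cn_circle (pi / kap k) k1.
have e1 : kap k * (pi / kap k) / 2 = pi / 2 by field; rewrite gt_eqF.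
rewrite e1 sin_pihalf mul1r in sE; rewrite e1 cos_pihalf in cE.
split => //.
have t0 : 0 <= pi / kap k by rewrite divr_ge0 ?pi_ge0 ?ltW.
have [C _] := om_cos_sin k t0.
have c0 : cos (om k (pi / kap k)) = 0.
  move: C; rewrite cE => /esym/eqP; rewrite mulf_eq0 gt_eqF ?sqrtr_gt0 ?sqr1_gt0//=.
  by move=> /eqP.
apply: cos_inj; rewrite ?in_itv /= ?c0 ?cos_pihalf//.
  by rewrite om_ge0//= om_lepi// => _; exact: half_le_full.
by have := pi_gt0 R; lra.
Qed.

Lemma full_turn k : 1 < k -> sn (1 - k ^+ 2) (2 * pi / kap k) = 0 /\
  om k (2 * pi / kap k) = pi.
Proof.
move=> k1; have kp := kap_gt0 k1; have k0 : 0 < k by lra.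
have [sE cE] := sn_cn_circle (2 * pi / kap k) k1.
have e1 : kap k * (2 * pi / kap k) / 2 = pi by field; rewrite gt_eqF.
rewrite e1 sinpi mul0r in sE; rewrite e1 cospi in cE.
split => //.
have t0 : 0 <= 2 * pi / kap k by rewrite divr_ge0 ?mulr_ge0 ?pi_ge0 ?ltW.
have [C _] := om_cos_sin k t0.
apply: cos_inj; rewrite ?in_itv /= ?lexx ?pi_ge0//.
  by rewrite om_ge0//= om_lepi.
move: C; rewrite cE sE expr0n /= addr0 sqrtr1 mul1r => <-.
by rewrite cospi.
Qed.

Lemma sn_sym k t : 1 < k ->
  sn (1 - k ^+ 2) (2 * pi / kap k - t) = sn (1 - k ^+ 2) t /\
  cn (1 - k ^+ 2) (2 * pi / kap k - t) = - cn (1 - k ^+ 2) t.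
Proof.
move=> k1; have kp := kap_gt0 k1.
have [-> ->] := sn_cn_circle (2 * pi / kap k - t) k1.
have [-> ->] := sn_cn_circle t k1.
have -> : kap k * (2 * pi / kap k - t) / 2 = - (kap k * t / 2) + pi.
  by field; rewrite gt_eqF.
by rewrite sinDpi cosDpi sinN cosN opprK.
Qed.

Lemma om_sym k t : 1 < k -> 0 <= t <= 2 * pi / kap k ->
  om k (2 * pi / kap k - t) = pi - om k t.
Proof.
move=> k1 /andP[t0 t1]; have kp := kap_gt0 k1; have k0 : 0 < k by lra.
have t'0 : 0 <= 2 * pi / kap k - t by rewrite subr_ge0.
have o0 := om_ge0 k0 t0; have o1 : om k t <= pi by apply: om_lepi.
have r0 : Num.sqrt (1 + sn (1 - k ^+ 2) t ^+ 2) != 0.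
  by rewrite gt_eqF// sqrtr_gt0 sqr1_gt0.
apply: cos_inj; rewrite ?in_itv /=.
- by rewrite om_ge0//= om_lepi// => _; rewrite gerBl.
- by rewrite subr_ge0 o1 gerBl.
apply: (mulfI r0); rewrite (addrC pi) cosDpi cosN mulrN.
have [<- _] := om_cos_sin k t0.
have [sE cE] := sn_sym t k1.
by have [] := om_cos_sin k t'0; rewrite sE cE => <-.
Qed.

(** An arc and its complement on the circle have the same chord and together
    enclose the disc. *)
Lemma hol_complement k t : 1 < k -> 0 <= t <= 2 * pi / kap k ->
  hol k t + hol k (2 * pi / kap k - t) = 2 * pi * k / kap k - 2 * pi.
Proof.
move=> k1 tk; have kp := kap_gt0 k1.
by rewrite /hol om_sym//; field; rewrite gt_eqF.
Qed.

Lemma hol_increasing k s t : 0 < k -> 0 <= s -> s < t ->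
  (1 < k -> t <= 2 * pi / kap k) -> hol k s < hol k t.
Proof.
move=> k0 s0 st tk.
apply: (derive_increasing (f := hol k) (df := fun t => k * sn (1 - k ^+ 2) t ^+ 2 / (1 + sn (1 - k ^+ 2) t ^+ 2)) st) => x.
  by move=> /andP[x0 _]; apply: is_derive_hol; lra.
move=> /andP[sx xt]; rewrite divr_gt0 ?sqr1_gt0// mulr_gt0// exprn_gt0//.
apply: sn_gt0 => //; first exact: le_lt_trans sx.
by move=> /tk; apply: lt_le_trans.
Qed.

Lemma hol_ge0 k t : 0 < k -> 0 <= t -> (1 < k -> t <= 2 * pi / kap k) ->
  0 <= hol k t.
Proof.
move=> k0; rewrite le_eqVlt => /predU1P[<- _|t0 tk]; first by rewrite hol0.
by rewrite -(hol0 k) ltW// hol_increasing.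
Qed.

Lemma is_derive_phi_sn k k' t : 0 < k -> 0 <= t ->
  (1 < k -> t <= 2 * pi / kap k) ->
  let s := sn (1 - k ^+ 2) t in
  is_derive t 1 (fun t => phi k' (sn (1 - k ^+ 2) t))
   (Num.sqrt (1 + (1 - k' ^+ 2) * s ^+ 2) / (1 + s ^+ 2) * cn (1 - k ^+ 2) t).
Proof.
move=> k0 t0 tk s; have s0 : 0 <= s by apply: sn_ge0.
have s1 : -1 < s by lra.
have D := @is_derive1_comp R (phi k') (sn (1 - k ^+ 2)) t _ _ (is_derive_phi k' s1) (is_derive_sn (1 - k ^+ 2) t).
by apply: (is_derive_eq D); field; rewrite gt_eqF// sqr1_gt0.
Qed.

(** Equality case of the calibration: along the arc of curvature [k] that has
    not passed the antipode of its origin, length is exactly calibrated. *)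
Lemma minor_arc k t : 0 < k -> 0 <= t -> (1 < k -> t <= pi / kap k) ->
  t = k * hol k t + phi k (sn (1 - k ^+ 2) t).
Proof.
move=> k0 t0 tk.
have tk2 x : 0 <= x <= t -> 1 < k -> x <= 2 * pi / kap k.
  by move=> /andP[_ xt] k1; apply: le_trans xt (le_trans (tk k1) (half_le_full k1)).
have cn0' x : 0 <= x <= t -> 0 <= cn (1 - k ^+ 2) x.
  by move=> /andP[x0 xt]; apply: cn_ge0 => // /tk; apply: le_trans.
have := @derive0_constant R (fun t => t - k * hol k t - phi k (sn (1 - k ^+ 2) t)) 0 t t0.
rewrite sn0 hol0 (_ : phi k 0 = 0); last exact: antiderivative0.
rewrite mulr0 !subr0 => H; suff : t - k * hol k t - phi k (sn (1 - k ^+ 2) t) = 0 by lra.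
apply: H => x xt; have x0 : 0 <= x by case/andP: xt.
have D1 := is_derive_phi_sn k k0 x0 (tk2 _ xt).
have x1 : -1 < x by lra.
  have D2 := is_derive_hol k x1.
apply: is_derive_eq; rewrite /GRing.scale /=.
have -> : 1 + (1 - k ^+ 2) * sn (1 - k ^+ 2) x ^+ 2 = cn (1 - k ^+ 2) x ^+ 2.
  by rewrite cn_sn.
rewrite sqrtr_sqr (ger0_norm (cn0' _ xt)).
transitivity ((1 + (1 - k ^+ 2) * sn (1 - k ^+ 2) x ^+ 2 - cn (1 - k ^+ 2) x ^+ 2)
   / (1 + sn (1 - k ^+ 2) x ^+ 2)).
  by field; rewrite gt_eqF// sqr1_gt0.
by rewrite cn_sn subrr mul0r.
Qed.

(** The calibration of another curvature is still a lower bound for the length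
    of an arc: its defect of exactness is a sum of squares. *)
Lemma arc_calibrated k k' t : 0 < k -> 0 <= t ->
  (1 < k -> t <= 2 * pi / kap k) ->
  (forall x, 0 <= x <= t -> 0 <= 1 + (1 - k' ^+ 2) * sn (1 - k ^+ 2) x ^+ 2) ->
  k' * hol k t + phi k' (sn (1 - k ^+ 2) t) <= t.
Proof.
move=> k0 t0 tk strip.
have tk2 x : 0 <= x <= t -> 1 < k -> x <= 2 * pi / kap k.
  by move=> /andP[x0 xt] k1; apply: le_trans xt (tk k1).
rewrite -subr_ge0.
have p0 : phi k' 0 = 0 by exact: antiderivative0.
have := @derive_nondecreasing R (fun t => t - (k' * hol k t + phi k' (sn (1 - k ^+ 2) t)))
  (fun x => 1 - (k' * (k * sn (1 - k ^+ 2) x ^+ 2 / (1 + sn (1 - k ^+ 2) x ^+ 2)) +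
   Num.sqrt (1 + (1 - k' ^+ 2) * sn (1 - k ^+ 2) x ^+ 2) / (1 + sn (1 - k ^+ 2) x ^+ 2) *
   cn (1 - k ^+ 2) x)) 0 t t0.
rewrite sn0 hol0 p0 mulr0 !addr0 subr0; apply => x xt.
  have x0 : 0 <= x by case/andP: xt.
  have D1 := is_derive_phi_sn k' k0 x0 (tk2 _ xt).
  have x1 : -1 < x by lra.
  have D2 := is_derive_hol k x1.
  by apply: is_derive_eq; rewrite /GRing.scale /=; ring.
have xt' : 0 <= x <= t by case/andP: xt => a b; rewrite !ltW.
have p := sqr1_gt0 (sn (1 - k ^+ 2) x).
have := cn_k_sn k x; have := strip x xt'; move: p.
move: (sn _ x) (cn _ x) => s h p st hE.
have := sqr_sqrtr st; move: (Num.sqrt _) => q q2.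
have -> : 1 - (k' * (k * s ^+ 2 / (1 + s ^+ 2)) + q / (1 + s ^+ 2) * h) =
  (1 + s ^+ 2 - (k' * k * s ^+ 2 + q * h)) / (1 + s ^+ 2) by field; rewrite gt_eqF.
apply: divr_ge0; last exact: ltW.
have H1 := sqr_ge0 (h - q); have H2 := sqr_ge0 (k * s - k' * s). lra.
Qed.

End CircleArcs.

(** * The isoperimetric lower bound *)

Section DidoLowerBound.
Context {R : realType}.
Variables (S : R) (W U V N : R -> R).
Hypothesis WU : forall s t : R, 0 <= s -> s <= t -> t <= S ->
  `|U t - U s| <= W t - W s.
Hypothesis WV : forall s t : R, 0 <= s -> s <= t -> t <= S ->
  `|V t - V s| <= W t - W s.
Hypothesis Wcont : forall t0 : R, 0 <= t0 <= S -> forall e : R, 0 < e ->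
  \forall t \near t0, 0 <= t <= S -> `|W t - W t0| <= e.
Hypothesis NUV : forall c d s t : R, c ^+ 2 + d ^+ 2 <= 1 ->
  0 <= s -> s <= t -> t <= S ->
  c * (U t - U s) + d * (V t - V s) <= N t - N s.
Let diff := clock_diff S W U V.
Variables q0 q1 q2 A : R -> R.
Hypothesis q0ge : forall t : R, 0 <= t <= S -> 1 <= q0 t.
Hypothesis q0sq : forall t : R, 0 <= t <= S -> q0 t ^+ 2 = 1 + q1 t ^+ 2 + q2 t ^+ 2.
Hypothesis dq0 : forall t : R, 0 <= t <= S -> diff q0 t (q2 t) (q1 t).
Hypothesis dq1 : forall t : R, 0 <= t <= S -> diff q1 t 0 (q0 t).
Hypothesis dq2 : forall t : R, 0 <= t <= S -> diff q2 t (q0 t) 0.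
Hypothesis dA : forall t : R, 0 <= t <= S ->
  diff A t (q1 t / (1 + q0 t)) (- (q2 t / (1 + q0 t))).
Hypothesis q0cont : {within `[0, S], continuous q0}.
Hypothesis S0 : 0 <= S.
Hypothesis q00 : q0 0 = 1.
Hypothesis A0 : A 0 = 0.

Let hs t := half_sinh (q0 t).

(** The sign of the curvature of the calibration and the sign of its radial part
    may be chosen at will. *)
Let calibrated (k' sg e a b : R) : sg ^+ 2 = 1 -> e ^+ 2 = 1 ->
  0 <= a -> a <= b -> b <= S ->
  (forall t : R, a <= t <= b -> 0 <= 1 + (1 - k' ^+ 2) * hs t ^+ 2) ->
  sg * k' * (A b - A a) + e * (phi k' (hs b) - phi k' (hs a)) <= N b - N a.
Proof.
move=> sg2 e2 a0 ab bS strip.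
have kk : (sg * k') ^+ 2 = k' ^+ 2 by rewrite exprMn sg2 mul1r.
have := @calibration_le R S W U V N WU WV Wcont NUV q0 q1 q2 A q0ge q0sq dq0
  dq1 dq2 dA (sg * k') e (phi k') e2 _ (phi_bounds k') a b a0 ab bS _.
rewrite kk => H; apply: le_trans (H _ strip); last first.
  by move=> z z0; apply: is_derive_phi; apply: lt_le_trans z0; rewrite ltrN10.
rewrite /hs; move: (phi k' _) (phi k' _) => x y; lra.
Qed.

(** Since [hol k T <= pi], the equality of cosines forces the area [|A S|] to be
    at least [hol k T]. If the arc does not pass the antipode of its origin and
    the competitor stays in the disc where the calibration of curvature [k] is
    defined, this calibration gives the bound. Otherwise the calibration of
    curvature [k'] is used, whose disc has for radius the largest distance
    reached by the competitor: with increasing radial part up to that point,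
    with decreasing radial part after it. The complementary arc of length
    [2 * pi / kap k - T] bounds the remaining terms, and what is left is
    [k' k - kap k' kap k >= 1], a reversed Cauchy-Schwarz inequality. *)
Lemma dido_lower_bound k T : 0 < k -> 0 < T ->
  (1 < k -> T <= 2 * pi / kap k) -> hol k T <= pi ->
  q0 S = 1 + 2 * sn (1 - k ^+ 2) T ^+ 2 -> cos (A S) = cos (hol k T) ->
  T <= N S - N 0.
Proof.
move=> k0 T0 Tk holpi q0S cosA.
have sT0 : 0 <= sn (1 - k ^+ 2) T by apply: sn_ge0 => //; exact: ltW.
have hol0 : 0 < hol k T by rewrite -(hol0 k) hol_increasing.
have hs0 : hs 0 = 0 by rewrite /hs /half_sinh q00 subrr mul0r sqrtr0.
have hsS : hs S = sn (1 - k ^+ 2) T.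
  rewrite /hs /half_sinh q0S (_ : (1 + 2 * _ - 1) / 2 = sn (1 - k ^+ 2) T ^+ 2).
    by rewrite sqrtr_sqr ger0_norm.
  by field.
have hsge0 t : 0 <= hs t by rewrite sqrtr_ge0.
have phi0 k' : phi k' 0 = 0 by exact: antiderivative0.
have absA : hol k T <= `|A S|.
  rewrite leNgt; apply/negP => lt.
  have : cos (A S) = cos `|A S| by case: (ger0P (A S)); rewrite ?cosN.
  rewrite cosA => /(@cos_inj R); rewrite !in_itv /= normr_ge0 (ltW hol0) holpi.
  rewrite (le_trans (ltW lt) holpi) => /(_ isT isT) e.
  by move: lt; rewrite -e ltxx.
have [sg [sg2 sgA]] : exists sg, sg ^+ 2 = 1 /\ sg * A S = `|A S|.
  case: (ger0P (A S)) => _; [exists 1 | exists (-1)].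
    by rewrite expr1n mul1r.
  by rewrite sqrrN expr1n mulN1r.
have e1 : (1 : R) ^+ 2 = 1 by rewrite expr1n.
have e1' : (-1 : R) ^+ 2 = 1 by rewrite sqrrN expr1n.
have direct : (forall t : R, 0 <= t <= S -> 0 <= 1 + (1 - k ^+ 2) * hs t ^+ 2) ->
    (1 < k -> T <= pi / kap k) -> T <= N S - N 0.
  move=> strip Tk'.
  rewrite [leLHS](minor_arc k0 (ltW T0) Tk').
  have := calibrated (a := 0) (b := S) sg2 e1 (lexx _) S0 (lexx _) strip.
  rewrite hs0 hsS phi0 A0 !subr0 mul1r mulrAC sgA; apply: le_trans.
  by rewrite lerD2r mulrC ler_wpM2r// ltW.
have [k1|k1] := ltP 1 k; last first.
  apply: direct => [t _|]; last by rewrite ltNge k1.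
  by rewrite addr_ge0// mulr_ge0 ?sqr_ge0//; nra.
have kp := kap_gt0 k1; have kp2 := kap2 (ltW k1).
have hscont : {within `[0, S], continuous hs}.
  move=> t; apply: (continuous_comp (q0cont (x := t)) (g := half_sinh)).
  move: (q0 t) => x; rewrite /half_sinh.
  apply: (@cvg_comp _ _ _ (fun z : R => (z - 1) / 2) Num.sqrt); last exact: sqrt_continuous.
  by apply: cvgM; [apply: cvgB; [exact: cvg_id|exact: cvg_cst]|exact: cvg_cst].
have [tm] := EVT_max S0 hscont.
rewrite in_itv /= => /andP[tm0 tmS] tmax.
have hmax t : 0 <= t <= S -> hs t <= hs tm by move=> tS; apply: tmax; rewrite in_itv.
have SS : 0 <= S <= S by rewrite S0 lexx.
pose sm := hs tm; have smT : sn (1 - k ^+ 2) T <= sm by rewrite -hsS; exact: hmax.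
have [[sm1 Tpi]|major] := pselect (sm <= (kap k)^-1 /\ T <= pi / kap k).
  apply: direct => // t tS.
  have := hmax t tS; rewrite -/sm => h1; have h2 := le_trans h1 sm1.
  have : hs t * kap k <= 1 by rewrite -ler_pdivlMr// mul1r.
  have : 0 <= hs t * kap k by rewrite mulr_ge0 ?hsge0 ?(ltW kp).
  by nra.
have bound k' : (forall t, 0 <= t <= S -> 0 <= 1 + (1 - k' ^+ 2) * hs t ^+ 2) ->
   0 <= k' ->
   k' * hol k T + 2 * phi k' sm - phi k' (sn (1 - k ^+ 2) T) <= N S - N 0.
  move=> strip k'0.
  have h1 t : 0 <= t <= tm -> 0 <= t <= S.
    by move=> /andP[-> /le_trans]; apply.
  have h2 t : tm <= t <= S -> 0 <= t <= S.
    by move=> /andP[/(le_trans tm0) -> ->].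
  have P1 := calibrated sg2 e1 (lexx _) tm0 tmS (fun t h => strip t (h1 t h)).
  have P2 := calibrated sg2 e1' tm0 tmS (lexx _) (fun t h => strip t (h2 t h)).
  move: P1 P2; rewrite hs0 hsS phi0 A0 -/sm !subr0 => P1 P2.
  have : k' * hol k T <= sg * k' * A S by rewrite mulrAC sgA mulrC ler_wpM2r.
  by move: P1 P2; lra.
(* a competitor that never leaves the base point: every curvature is allowed *)
have [sm0|smn0] := eqVneq sm 0.
  pose k' := T / hol k T.
  have k'0 : 0 <= k' by rewrite divr_ge0 ?(ltW T0) ?(ltW hol0).
  have sn0T : sn (1 - k ^+ 2) T = 0 by apply/le_anti; rewrite sT0 -sm0 smT.
  have := bound k' _ k'0; rewrite sm0 sn0T phi0 mulr0 subr0 addr0.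
  rewrite /k' divfK ?gt_eqF//; apply => t tS.
  have -> : hs t = 0 by apply/le_anti; rewrite hsge0 andbT -sm0; exact: hmax.
  by rewrite expr0n /= mulr0 addr0.
have smp : 0 < sm by rewrite lt_def smn0 hsge0.
(* [K] is [kap k'], so that [sm] is the hyperbolic sine of half the diameter of
   a circle of curvature [k'] *)
pose K := sm^-1; have K0 : 0 < K by rewrite invr_gt0.
pose k' := Num.sqrt (1 + K ^+ 2).
have k'2 : k' ^+ 2 = 1 + K ^+ 2 by rewrite sqr_sqrtr// ltW// sqr1_gt0.
have k'1 : 1 < k'.
  have : 0 <= k' by rewrite sqrtr_ge0.
  have : 0 < K ^+ 2 by rewrite exprn_gt0.
  move=> K2 k'0; rewrite ltNge; apply/negP => h.
  suff : k' ^+ 2 <= 1 by rewrite k'2; lra.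
  by rewrite expr2 mulr_ile1.
have kapk' : kap k' = K by rewrite /kap k'2 (addrC 1) addrK sqrtr_sqr ger0_norm ?(ltW K0).
have strip z : 0 <= z -> z <= sm -> 0 <= 1 + (1 - k' ^+ 2) * z ^+ 2.
  move=> z0 zs; have : z * K <= 1 by rewrite ler_pdivrMr// mul1r.
  have : 0 <= z * K by rewrite mulr_ge0 ?(ltW K0).
  by rewrite k'2; nra.
have k'0 : 0 <= k' by lra.
have B := bound k' (fun t tS => strip _ (hsge0 t) (hmax t tS)) k'0.
have phism : phi k' sm = pi * (k' - K).
  have [E1 E2] := half_turn k'1; rewrite kapk' in E1 E2.
  have h : 0 < k' by lra.
  have t0 : 0 <= pi / K by rewrite divr_ge0 ?pi_ge0// ltW.
  have := minor_arc h t0; rewrite kapk' => /(_ (fun _ => lexx _)).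
  rewrite E1 /hol E2 invrK => E.
  have -> : phi k' sm = pi * sm * (1 - k' ^+ 2) + k' * pi by lra.
  by rewrite k'2 /K; field; rewrite gt_eqF.
have T1 := Tk k1.
have c0 : 0 <= 2 * pi / kap k - T by rewrite subr_ge0.
have [sE _] := sn_sym T k1.
have snle x : 0 <= x <= 2 * pi / kap k - T -> sn (1 - k ^+ 2) x <= sm.
  move=> /andP[x0 xT].
  have [smk|smk] := leP sm (kap k)^-1; last first.
    apply: le_trans (ltW smk); have [-> _] := sn_cn_circle x k1.
    by rewrite ler_piMl ?invr_ge0 ?(ltW kp)// sin_le1.
  have Tpi : pi / kap k < T by rewrite ltNge; apply/negP => h; apply: major.
  apply: le_trans smT; rewrite -sE.
  apply: sn_nondecreasing => //; move: (ltW Tpi).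
  have -> : 2 * pi / kap k = pi / kap k + pi / kap k by field; rewrite gt_eqF.
  by lra.
have C := @arc_calibrated R k k' (2 * pi / kap k - T) k0 c0 _ _.
have {}C := C (fun _ => _); rewrite sE in C.
have T0' := ltW T0.
have {}C : k' * hol k (2 * pi / kap k - T) + phi k' (sn (1 - k ^+ 2) T) <= 2 * pi / kap k - T.
  apply: C => [|x xT]; first by rewrite gerBl.
  apply: strip; last exact: snle.
  apply: sn_ge0 => //; first by case/andP: xT.
  by move=> _; case/andP: xT => _ /le_trans; apply; rewrite gerBl.
have HC := @hol_complement R k T k1; rewrite T0' T1 in HC; have {}HC := HC isT.
have key : 2 * pi / kap k <= 2 * pi * (k' * k / kap k - K).
  rewrite ler_pM2l ?mulr_gt0 ?pi_gt0//.
  rewrite -(ler_pM2r kp) mulrBl mulVf ?gt_eqF// divfK ?gt_eqF// lerBrDr.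
  rewrite -(@ler_pXn2r _ 2) ?nnegrE ?addr_ge0 ?mulr_ge0 ?(ltW K0) ?(ltW kp) ?(ltW k0)//.
  rewrite [leRHS]exprMn k'2.
  have -> : k ^+ 2 = 1 + kap k ^+ 2 by rewrite kp2; ring.
  by have := sqr_ge0 (K - kap k); lra.
have E : k' * hol k T + k' * hol k (2 * pi / kap k - T) + 2 * phi k' sm =
    2 * pi * (k' * k / kap k - K).
  by rewrite -mulrDr HC phism; field; rewrite gt_eqF.
by move: B C key; rewrite -E; lra.
Qed.

End DidoLowerBound.

(** * Horizontal curves and their length *)

Section HorizontalCurves.
Context {R : realType}.
Notation mu := (@lebesgue_measure R).
Variables (S : R) (g : R -> 'M[R]_4) (u1 u2 u3 : R -> R).
Hypothesis S0 : 0 <= S.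
Hypothesis hg : horizontal S g u1 u2 u3.

Let u1I : mu.-integrable `[0, S] (EFin \o u1). Proof. by case: hg => _ _ []. Qed.
Let u2I : mu.-integrable `[0, S] (EFin \o u2). Proof. by case: hg => _ _ []. Qed.
Let u3I : mu.-integrable `[0, S] (EFin \o u3). Proof. by case: hg => _ _ []. Qed.

Lemma entry_continuous i j : {within `[0, S], continuous (fun t => g t i j)}.
Proof.
have [_ gc _ _] := hg => t.
apply: (continuous_comp (gc t) (g := fun M : 'M[R]_4 => M i j)).
exact: coord_continuous.
Qed.

Let cst0 : {within `[0, S], continuous (fun _ : R => 0 : R)}.
Proof. by apply: continuous_subspaceT => x; exact: cvg_cst. Qed.

Let diff := clock_diff S (variation u1 u3) (primitive u1) (primitive u3).

Let entry_primitive (al be : R -> R) i j :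
  (forall s, (g s *m (u1 s *: e1 + u2 s *: e2 + u3 s *: e3)) i j =
     al s * u1 s + be s * u3 s) ->
  {within `[0, S], continuous al} -> {within `[0, S], continuous be} ->
  forall t : R, 0 <= t <= S -> diff (fun t => g t i j) t (al t) (be t).
Proof.
move=> E alc bec t tS.
apply: (clock_diff_primitive u1I u3I (al := al) (be := be)) => // s sS.
have [_ _ _ ->//] := hg; congr (_ + _).
by rewrite /primitive; apply: eq_Rintegral => x _; rewrite E.
Qed.

Lemma entry_diff0 i (t : R) : 0 <= t <= S ->
  diff (fun t => g t i 0) t (g t i 2) (g t i 1).
Proof.
apply: (entry_primitive (al := fun t => g t i 2) (be := fun t => g t i 1));
  [move=> s|exact: entry_continuous..].
by have [-> _ _ _] := mul_control (g s) (u1 s) (u2 s) (u3 s) i; ring.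
Qed.

Lemma entry_diff1 i (t : R) : 0 <= t <= S ->
  diff (fun t => g t i 1) t 0 (g t i 0).
Proof.
apply: (entry_primitive (al := fun=> 0) (be := fun t => g t i 0)); [move=> s|exact: cst0|exact: entry_continuous].
by have [_ -> _ _] := mul_control (g s) (u1 s) (u2 s) (u3 s) i; ring.
Qed.

Lemma entry_diff2 i (t : R) : 0 <= t <= S ->
  diff (fun t => g t i 2) t (g t i 0) 0.
Proof.
apply: (entry_primitive (al := fun t => g t i 0) (be := fun=> 0)); [move=> s|exact: entry_continuous|exact: cst0].
by have [_ _ -> _] := mul_control (g s) (u1 s) (u2 s) (u3 s) i; ring.
Qed.

Let WU := variation_p u1I u3I.
Let WV := variation_q u1I u3I.
Let Wc := variation_cont u1I u3I.

Lemma horizontal_entries t : 0 <= t <= S ->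
  let m := 1 + g t 0 0 in let x := g t 1 1 + g t 2 2 in
  let y := g t 1 2 - g t 2 1 in
  [/\ 1 <= g t 0 0, g t 0 0 ^+ 2 = 1 + g t 0 1 ^+ 2 + g t 0 2 ^+ 2,
      m * g t 1 0 = x * g t 0 1 + y * g t 0 2 &
      m * g t 2 0 = x * g t 0 2 - y * g t 0 1].
Proof.
move=> tS; have [+ _ _ _] := hg => /(_ t tS) /SO0_21xRE.
move=> [a [b [c [d [e [f [p [q [r [v [H ->]]]]]]]]]]].
by have [[h1 h2 h3] [h4 h5]] := SO0_21_entries H; rewrite !mx4E.
Qed.

Lemma horizontal_integrand_integrable i j : mu.-integrable `[0, S]
  (EFin \o (fun s => (g s *m (u1 s *: e1 + u2 s *: e2 + u3 s *: e3)) i j)).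
Proof.
have E s := mul_control (g s) (u1 s) (u2 s) (u3 s) i.
have P i' j' u : mu.-integrable `[0, S] (EFin \o u) ->
    mu.-integrable `[0, S] (EFin \o (fun s => g s i' j' * u s)).
  by apply: integrable_continuousM; exact: entry_continuous.
case: (ord4P j) => ->.
- apply: eq_integrable (integrableD _ (P i 2 u1 u1I) (P i 1 u3 u3I)) => //= s _.
  by have [-> _ _ _] := E s; rewrite -EFinD; congr (_%:E); ring.
- apply: eq_integrable (P i 0 u3 u3I) => //= s _.
  by have [_ -> _ _] := E s; rewrite mulrC.
- apply: eq_integrable (P i 0 u1 u1I) => //= s _.
  by have [_ _ -> _] := E s; rewrite mulrC.
- apply: eq_integrable (P i 3 u2 u2I) => //= s _.
  by have [_ _ _ ->] := E s; rewrite mulrC.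
Qed.

(** By rotational symmetry the bound does not involve the polar angle of the end
    point, only its distance and the holonomy modulo [2 * pi]. *)
Lemma horizontal_length_ge k T : g 0 = 1%:M -> 0 < k -> 0 < T ->
  (1 < k -> T <= 2 * pi / kap k) -> hol k T <= pi ->
  g S 0 0 = 1 + 2 * sn (1 - k ^+ 2) T ^+ 2 ->
  g S 1 1 + g S 2 2 = (1 + g S 0 0) * cos (hol k T) ->
  T <= arc_length u1 u3 S.
Proof.
move=> g0 k0 T0 Tk holpi E0 Ex.
pose al t := g t 0 1 / (1 + g t 0 0); pose be t := - (g t 0 2 / (1 + g t 0 0)).
pose A := primitive (fun s => al s * u1 s + be s * u3 s).
have m0 t : 0 <= t <= S -> 1 + g t 0 0 != 0.
  by move=> /horizontal_entries [h _ _ _]; rewrite gt_eqF//; lra.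
have prim0 f : primitive f 0 = 0 :> R by rewrite /primitive set_itv1 Rintegral_set1.
have quot j : {within `[0, S], continuous (fun t => g t 0 j / (1 + g t 0 0))}.
  apply/subspace_continuousP => x; rewrite /= in_itv /= => xS.
  have := @entry_continuous 0 j; move=> /subspace_continuousP /(_ x); rewrite /= in_itv /= => /(_ xS) c1.
  have := @entry_continuous 0 0; move=> /subspace_continuousP /(_ x); rewrite /= in_itv /= => /(_ xS) c2.
  apply: cvgM => //; apply: cvgV; first exact: m0.
  by apply: cvgD => //; exact: cvg_cst.
have bec : {within `[0, S], continuous be}.
  apply/subspace_continuousP => x xS.
  by apply: cvgN; move/subspace_continuousP : (quot 2) => /(_ x xS).
have dA (t : R) : 0 <= t <= S -> diff A t (g t 0 1 / (1 + g t 0 0)) (- (g t 0 2 / (1 + g t 0 0))).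
  move=> tS; apply: (clock_diff_primitive u1I u3I (al := al) (be := be) tS (quot 1) bec).
  by move=> s sS; rewrite /A prim0 add0r.
have [h00 h11 h22 h12] : [/\ g 0 0 0 = 1, g 0 1 1 + g 0 2 2 = 2,
    g 0 1 2 - g 0 2 1 = 0 & A 0 = 0].
  by rewrite g0 mx4_1 !mx4E subrr /A prim0; split => //; ring.
have SS : 0 <= S <= S by rewrite S0 lexx.
have [lx _] : g S 1 1 + g S 2 2 = (1 + g S 0 0) * cos (A S) /\
    g S 1 2 - g S 2 1 = (1 + g S 0 0) * sin (A S).
  apply: (@holonomy_lift R S (variation u1 u3) (primitive u1) (primitive u3) WU WV Wc
    (fun t => g t 0 0) (fun t => g t 0 1) (fun t => g t 0 2) (fun t => g t 1 0) (fun t => g t 2 0)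
    (fun t => g t 1 1 + g t 2 2) (fun t => g t 1 2 - g t 2 1) A) => //.
  - by move=> t /horizontal_entries [].
  - by move=> t /horizontal_entries [].
  - by move=> t /horizontal_entries [].
  - exact: entry_diff0.
  - move=> t tS; have := clock_diffD (entry_diff1 1 tS) (entry_diff2 2 tS).
    by rewrite add0r addr0.
  - move=> t tS; have := clock_diffB (entry_diff2 1 tS) (entry_diff1 2 tS).
    by rewrite subr0 sub0r.
have -> : arc_length u1 u3 S = arc_length u1 u3 S - arc_length u1 u3 0.
  by rewrite [X in _ - X]prim0 subr0.
have := @dido_lower_bound R S (variation u1 u3) (primitive u1) (primitive u3)
  (arc_length u1 u3) WU WV Wc (arc_length_ge u1I u3I)
  (fun t => g t 0 0) (fun t => g t 0 1) (fun t => g t 0 2) A.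
apply.
- by move=> t /horizontal_entries [].
- by move=> t /horizontal_entries [].
- exact: entry_diff0.
- exact: entry_diff1.
- exact: entry_diff2.
- exact: dA.
- exact: entry_continuous.
- exact: S0.
- exact: h00.
- exact: h12.
- exact: k0.
- exact: T0.
- exact: Tk.
- exact: holpi.
- exact: E0.
- by apply: (mulfI (m0 _ SS)); rewrite -lx -Ex.
Qed.

Lemma horizontal_vertical : g 0 = 1%:M -> ln (g S 3 3) = primitive u2 S.
Proof.
move=> g0.
have WU2 := variation_p u2I u2I; have Wc2 := variation_cont u2I u2I.
have prim0 f : primitive f 0 = 0 :> R by rewrite /primitive set_itv1 Rintegral_set1.
have gp t : 0 <= t <= S -> 0 < g t 3 3.
  have [+ _ _ _] := hg => /(_ t) H /H /SO0_21xRE.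
  move=> [a [b [c [d [e [f [p [q [r [v [_ ->]]]]]]]]]]].
  by rewrite !mx4E expR_gt0.
have cst1 : {within `[0, S], continuous (fun _ : R => 1 : R)}.
  by apply: continuous_subspaceT => x; exact: cvg_cst.
have D (t : R) : 0 <= t <= S -> clock_diff S (variation u2 u2) (primitive u2) (primitive u2)
    (fun t => g t 3 3) t (g t 3 3) 0.
  move=> tS.
  apply: (clock_diff_primitive u2I u2I (al := fun t => g t 3 3) (be := fun=> 0)) => //.
    exact: entry_continuous.
  move=> s sS; have [_ _ _ ->//] := hg; congr (_ + _).
  rewrite /primitive; apply: eq_Rintegral => x _.
  by have [_ _ _ ->] := mul_control (g x) (u1 x) (u2 x) (u3 x) 3; ring.
have D2 (t : R) : 0 <= t <= S -> clock_diff S (variation u2 u2) (primitive u2) (primitive u2)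
    (primitive u2) t 1 0.
  move=> tS.
  apply: (clock_diff_primitive u2I u2I (al := fun=> 1) (be := fun=> 0)) => // s sS.
  rewrite prim0 add0r /primitive; apply: eq_Rintegral => x _; ring.
have H : ln (g S 3 3) - primitive u2 S = ln (g 0 3 3) - primitive u2 0.
  apply: (clock_diff0_cst WU2 (V := primitive u2) (F := fun t => ln (g t 3 3) - primitive u2 t)) => // t tS.
  have := clock_diffB (clock_diff_comp WU2 WU2 Wc2 tS (D t tS) (is_derive1_ln (gp t tS))) (D2 t tS).
  rewrite mulVf ?gt_eqF ?gp// mulr0 subrr subr0; exact.
by move: H; rewrite g0 mx4_1 mx4E ln1 prim0 subrr => /eqP; rewrite subr_eq0 => /eqP.
Qed.

Lemma speed_integrable : mu.-integrable `[0, S]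
  (EFin \o (fun s => Num.sqrt (u1 s ^+ 2 + u2 s ^+ 2 + u3 s ^+ 2))).
Proof.
have H := arc_length_integrable (arc_length_integrable u1I u2I) u3I.
apply: eq_integrable H => // x _ /=.
by rewrite sqr_sqrtr// addr_ge0// sqr_ge0.
Qed.

Lemma control_lengthE : control_length S u1 u2 u3 =
  (\int[mu]_(s in `[0, S]) Num.sqrt (u1 s ^+ 2 + u2 s ^+ 2 + u3 s ^+ 2))%:E.
Proof.
rewrite /control_length /Rintegral fineK//.
exact: integrable_fin_num speed_integrable.
Qed.

(** The length in the product is at least any unit combination of the lengths
    of the two factors. *)
Lemma control_length_ge a b : 0 <= a -> a ^+ 2 + b ^+ 2 = 1 ->
  ((a * arc_length u1 u3 S + b * primitive u2 S)%:E <= control_length S u1 u2 u3)%E.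
Proof.
move=> a0 ab; rewrite control_lengthE lee_fin /arc_length /primitive.
have I1 := arc_length_integrable u1I u3I.
have I1' : mu.-integrable `[0, S] (EFin \o (fun x => a * Num.sqrt (u1 x ^+ 2 + u3 x ^+ 2))).
  by apply: (integrableZl _ _ I1).
have I2' : mu.-integrable `[0, S] (EFin \o (fun x => b * u2 x)).
  by apply: (integrableZl _ _ u2I).
rewrite -!RintegralZl// -RintegralD//.
apply: le_Rintegral => //.
- exact: (integrableD _ I1' I2').
- exact: speed_integrable.
move=> x _; have p0 : 0 <= u1 x ^+ 2 + u3 x ^+ 2 by rewrite addr_ge0// sqr_ge0.
have := sqr_sqrtr p0; move: (Num.sqrt _) => z z2.
rewrite addrAC -z2; apply: le_trans (ler_norm _) _; rewrite -sqrtr_sqr ler_wsqrtr//.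
have -> : z ^+ 2 + u2 x ^+ 2 = (a ^+ 2 + b ^+ 2) * (z ^+ 2 + u2 x ^+ 2) by rewrite ab mul1r.
by have := sqr_ge0 (a * u2 x - b * z); lra.
Qed.

End HorizontalCurves.

(** * Concatenation of horizontal curves *)

Section SmoothCurves.
Context {R : realType}.
Notation mu := (@lebesgue_measure R).
Implicit Types (g : R -> 'M[R]_4) (u : R -> R) (i j : 'I_4).

(** All explicit curves are defined and differentiable on the whole line, with
    continuous controls; this is stable under translation and change of time. *)
Definition smooth_horizontal g u1 u2 u3 :=
  [/\ forall t, SO0_21xR (g t),
      forall (t : R) i j, is_derive t 1 (fun t : R => g t i j)
        ((g t *m (u1 t *: e1 + u2 t *: e2 + u3 t *: e3)) i j),
      continuous u1, continuous u2 & continuous u3].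

Lemma FTC2_Rintegral (f F : R -> R) (a b : R) : a <= b -> continuous f ->
  (forall t : R, is_derive t 1 F (f t)) -> \int[mu]_(s in `[a, b]) f s = F b - F a.
Proof.
rewrite le_eqVlt => /predU1P[<- _ _|ab fc FD].
  by rewrite set_itv1 Rintegral_set1 subrr.
have Fc : continuous F.
  by move=> t; apply: differentiable_continuous; apply/derivable1_diffP.
rewrite /Rintegral (@continuous_FTC2 R f F a b)//.
- exact: continuous_subspaceT.
- split => [x _||]; first by have [] := FD x.
  + by apply: cvg_at_right_filter; exact: Fc.
  + by apply: cvg_at_left_filter; exact: Fc.
- by move=> x _; rewrite derive1E derive_val.
Qed.

Lemma continuous_mxP (g : R -> 'M[R]_4) :
  (forall i j, continuous (fun t => g t i j)) -> continuous g.
Proof.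
move=> H t.
have gE : g = (fun t => \sum_(ij : 'I_4 * 'I_4) g t ij.1 ij.2 *: delta_mx ij.1 ij.2).
  by apply/funext => s; rewrite [LHS]matrix_sum_delta pair_big.
rewrite gE; apply: cvg_big => [|ij _]; first exact: add_continuous.
by apply: cvgZr_tmp; exact: H.
Qed.

Lemma smooth_entry_continuous g u1 u2 u3 i j : smooth_horizontal g u1 u2 u3 ->
  continuous (fun t => g t i j).
Proof.
move=> [_ D _ _ _] t; apply: differentiable_continuous; apply/derivable1_diffP.
by have [] := D t i j.
Qed.

Lemma smooth_integrand_continuous g u1 u2 u3 i j : smooth_horizontal g u1 u2 u3 ->
  continuous (fun t => (g t *m (u1 t *: e1 + u2 t *: e2 + u3 t *: e3)) i j).
Proof.
move=> sg; have gc i' j' := smooth_entry_continuous (i := i') (j := j') sg.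
have [_ _ c1 c2 c3] := sg.
have E t := mul_control (g t) (u1 t) (u2 t) (u3 t) i.
case: (ord4P j) => ->.
- rewrite (_ : (fun t => _) = (fun t => u1 t * g t i 2 + u3 t * g t i 1)).
    by move=> t; apply: cvgD; apply: cvgM; [exact: c1|exact: gc|exact: c3|exact: gc].
  by apply/funext => t; have [] := E t.
- rewrite (_ : (fun t => _) = (fun t => u3 t * g t i 0)).
    by move=> t; apply: cvgM; [exact: c3|exact: gc].
  by apply/funext => t; have [] := E t.
- rewrite (_ : (fun t => _) = (fun t => u1 t * g t i 0)).
    by move=> t; apply: cvgM; [exact: c1|exact: gc].
  by apply/funext => t; have [] := E t.
- rewrite (_ : (fun t => _) = (fun t => u2 t * g t i 3)).
    by move=> t; apply: cvgM; [exact: c2|exact: gc].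
  by apply/funext => t; have [] := E t.
Qed.

Lemma continuous_integrable u (a b : R) : continuous u ->
  mu.-integrable `[a, b] (EFin \o u).
Proof.
move=> uc; apply: continuous_compact_integrable; first exact: segment_compact.
exact: continuous_subspaceT.
Qed.

Lemma smooth_is_horizontal g u1 u2 u3 S : smooth_horizontal g u1 u2 u3 ->
  horizontal S g u1 u2 u3.
Proof.
move=> sg; have [G D c1 c2 c3] := sg; split => //.
- apply: continuous_subspaceT; apply: continuous_mxP => i j.
  exact: smooth_entry_continuous sg.
- by split; exact: continuous_integrable.
- move=> t /andP[t0 tS] i j.
  rewrite (FTC2_Rintegral t0 _ (fun t => D t i j)); first by rewrite subrKC.
  exact: smooth_integrand_continuous.
Qed.

Lemma smooth_left L g u1 u2 u3 : SO0_21xR L -> smooth_horizontal g u1 u2 u3 ->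
  smooth_horizontal (fun t => L *m g t) u1 u2 u3.
Proof.
move=> HL [G D c1 c2 c3]; split => // [t|t i j]; first exact: SO0_21xR_mul.
have E s : (L *m g s) i j = L i 0 * g s 0 j + L i 1 * g s 1 j + L i 2 * g s 2 j
    + L i 3 * g s 3 j by rewrite mxE sum_ord4.
rewrite -mulmxA mxE sum_ord4.
have -> : (fun t => (L *m g t) i j) = (fun s => L i 0 * g s 0 j + L i 1 * g s 1 j
   + L i 2 * g s 2 j + L i 3 * g s 3 j) by apply/funext => s; exact: E.
have D0 := D t 0 j; have D1 := D t 1 j; have D2 := D t 2 j; have D3 := D t 3 j.
apply: is_derive_eq.
by rewrite /GRing.scale /=; ring.
Qed.

Lemma smooth_affine g u1 u2 u3 a l : smooth_horizontal g u1 u2 u3 ->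
  smooth_horizontal (fun t => g (a + l * t)) (fun t => l * u1 (a + l * t))
   (fun t => l * u2 (a + l * t)) (fun t => l * u3 (a + l * t)).
Proof.
move=> [G D c1 c2 c3].
have ac : continuous (fun t : R => a + l * t).
  by move=> t; apply: cvgD; [exact: cvg_cst|apply: cvgM; [exact: cvg_cst|exact: cvg_id]].
have cc u : continuous u -> continuous (fun t => l * u (a + l * t)).
  move=> uc t; apply: cvgM; first exact: cvg_cst.
  exact: (continuous_comp (ac t) (uc _)).
split => [t|t i j|||]; [exact: G| |exact: cc..].
have Da : is_derive t 1 (fun t : R => a + l * t) l.
  by apply: is_derive_eq; rewrite /GRing.scale /=; ring.
have := @is_derive1_comp R (fun t => g t i j) _ t _ _ (D (a + l * t) i j) Da.
move=> H; apply: (is_derive_eq H).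
set c := a + l * t.
have -> : (l * u1 c) *: e1 + (l * u2 c) *: e2 + (l * u3 c) *: e3 =
    l *: (u1 c *: e1 + u2 c *: e2 + u3 c *: e3) :> 'M[R]_4.
  by rewrite !scalerDr !scalerA.
by rewrite -scalemxAr [in RHS]mxE mulrC.
Qed.

Definition reach (x y : 'M[R]_4) (l : R) := exists S g u1 u2 u3,
  [/\ 0 <= S, g 0 = x, g S = y, horizontal S g u1 u2 u3 &
      control_length S u1 u2 u3 = l%:E].

Lemma rho2_le x y l : reach x y l -> (rho2 x y <= l%:E)%E.
Proof.
move=> [S [g [u1 [u2 [u3 [S0 gx gy hg El]]]]]]; apply: ereal_inf_lbound.
by exists S, g; split => //; exists u1, u2, u3; split.
Qed.

Lemma smooth_length S u1 u2 u3 c : 0 <= S -> 0 <= c ->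
  (forall t, u1 t ^+ 2 + u2 t ^+ 2 + u3 t ^+ 2 = c ^+ 2) ->
  control_length S u1 u2 u3 = (c * S)%:E.
Proof.
move=> S0 c0 H; rewrite /control_length.
under eq_integral do rewrite H sqrtr_sqr ger0_norm//.
rewrite integral_cst//= lebesgue_measure_itv /= lte_fin.
case: ltgtP S0 => // [_ _|<- _]; first by rewrite -EFinD subr0.
by rewrite mule0 mulr0.
Qed.

Lemma reach_refl x : SO0_21xR x -> reach x x 0.
Proof.
move=> Gx; exists 0, (fun=> x), (fun=> 0), (fun=> 0), (fun=> 0); split => //.
  apply: smooth_is_horizontal; split => //; try by move=> t; exact: cvg_cst.
  move=> t i j; apply: (is_derive_eq (is_derive_cst (x i j) t 1)).
  by rewrite !scale0r !addr0 mulmx0 mxE.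
rewrite (@smooth_length _ _ _ _ 0)// ?mulr0// => t.
by rewrite expr0n /= !addr0.
Qed.

Let integrable_patch (p q : R -> R) (a b : R) : 0 <= a -> a <= b ->
  mu.-integrable `[0, a] (EFin \o p) -> continuous q ->
  mu.-integrable `[0, b] (EFin \o (fun t => if t <= a then p t else q t)).
Proof.
move=> a0 ab pI qc.
have e1 : `[0, a]%classic `&` `[0, b] = `[0, a]%classic.
  by apply/setIidPl; apply: subset_itvl; rewrite bnd_simp.
have e2 : `]a, b]%classic `&` `[0, b] = `]a, b]%classic.
  by apply/setIidPl; apply: subset_itv; rewrite bnd_simp.
have I1 : mu.-integrable `[0, b] ((EFin \o p) \_ `[0, a]).
  by apply/integrable_restrict => //; rewrite setIC e1.
have I2 : mu.-integrable `[0, b] ((EFin \o q) \_ `]a, b]).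
  apply/integrable_restrict => //; rewrite setIC e2.
  apply: integrableS (continuous_integrable a b qc) => //.
  by apply: subset_itv_oc_cc.
apply: eq_integrable (integrableD _ I1 I2) => //= x.
rewrite inE /= in_itv /= => /andP[x0 xb].
rewrite /patch; case: (leP x a) => xa.
  rewrite mem_set /= ?in_itv /= ?x0// memNset ?adde0//= in_itv /= ltNge xa //.
by rewrite memNset /= ?in_itv /= ?x0 /= ?leNgt ?xa// mem_set /= ?in_itv /= ?xa// add0e.
Qed.

(** The integral equation of the concatenation splits at [S]; after [S] it is the
    fundamental theorem of calculus. *)
Lemma reach_extend x y l g u1 u2 u3 b c : reach x y l -> 0 <= b -> 0 <= c ->
  smooth_horizontal g u1 u2 u3 -> g 0 = y ->
  (forall t, u1 t ^+ 2 + u2 t ^+ 2 + u3 t ^+ 2 = c ^+ 2) ->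
  reach x (g b) (l + c * b).
Proof.
move=> [S [h [v1 [v2 [v3 [S0 h0 hS hh El]]]]]] b0 c0 sg g0 speed.
have := smooth_affine (- S) 1 sg.
set g' := fun t => g (- S + 1 * t); set u1' := fun t => 1 * u1 _.
set u2' := fun t => 1 * u2 _; set u3' := fun t => 1 * u3 _ => sg'.
have g'S : g' S = y by rewrite /g' mul1r addNr.
have [G' D' c1' c2' c3'] := sg'.
have [Gh hc [v1I v2I v3I] hE] := hh.
have SSb : S <= S + b by rewrite lerDl.
pose k t := if t <= S then h t else g' t.
pose w1 t := if t <= S then v1 t else u1' t.
pose w2 t := if t <= S then v2 t else u2' t.
pose w3 t := if t <= S then v3 t else u3' t.
have w1I : mu.-integrable `[0, S + b] (EFin \o w1) by exact: integrable_patch.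
have w2I : mu.-integrable `[0, S + b] (EFin \o w2) by exact: integrable_patch.
have w3I : mu.-integrable `[0, S + b] (EFin \o w3) by exact: integrable_patch.
have kg t : S <= t -> k t = g' t.
  rewrite /k le_eqVlt => /predU1P[<-|St]; last by rewrite leNgt St.
  by rewrite lexx hS g'S.
have kh t : t <= S -> k t = h t by rewrite /k => ->.
have hk : horizontal (S + b) k w1 w2 w3.
  split.
    + move=> t /andP[t0 tb]; rewrite /k; case: leP => tS; last exact: G'.
      by apply: Gh; rewrite t0.
    + have -> : `[0, S + b]%classic = `[0, S]%classic `|` `[S, S + b]%classic.
        apply/seteqP; split => z /=; rewrite !in_itv /=.
          by move=> /andP[x0 xb]; case: (leP z S) => xS; [left|right]; rewrite ?x0 ?xb ?(ltW xS).
        move=> [/andP[x0 xS]|/andP[xS xb]]; first by rewrite x0 (le_trans xS).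
        by rewrite xb (le_trans S0 xS).
      apply: withinU_continuous; [exact: itv_closed|exact: itv_closed| |].
        apply: (subspace_eq_continuous (f := h)) => // z; rewrite inE /= in_itv /= => /andP[_ xS].
        exact/esym/kh.
      apply: (subspace_eq_continuous (f := g')) => //.
        by move=> z; rewrite inE /= in_itv /= => /andP[xS _]; exact/esym/kg.
      apply: continuous_subspaceT; apply: continuous_mxP => i j.
      exact: smooth_entry_continuous sg'.
    + by split.
    + move=> t /andP[t0 tb] i j.
      have k0 : k 0 = h 0 by rewrite /k S0.
      pose fh s := (h s *m (v1 s *: e1 + v2 s *: e2 + v3 s *: e3)) i j.
      pose fg s := (g' s *m (u1' s *: e1 + u2' s *: e2 + u3' s *: e3)) i j.
      pose fk s := (k s *m (w1 s *: e1 + w2 s *: e2 + w3 s *: e3)) i j.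
      have fk1 s : s <= S -> fk s = fh s by rewrite /fk /fh /k /w1 /w2 /w3 => ->.
      have fk2 s : S < s -> fk s = fg s by rewrite /fk /fg /k /w1 /w2 /w3 leNgt => ->.
      have int1 a : a <= S -> \int[mu]_(s in `[0, a]) fk s = \int[mu]_(s in `[0, a]) fh s.
        move=> aS; apply: eq_Rintegral => s; rewrite inE /= in_itv /= => /andP[_ sa].
        by rewrite fk1// (le_trans sa).
      case: (leP t S) => tS.
        by rewrite {1}/k tS k0 int1// hE// t0.
      rewrite kg ?ltW// k0.
      have St := ltW tS.
      have fgc : continuous fg by exact: smooth_integrand_continuous.
      have -> : \int[mu]_(s in `[0, t]) fk s =
          \int[mu]_(s in `[0, S]) fk s + \int[mu]_(s in `]S, t]) fk s.
        have fhI : mu.-integrable `[0, S] (EFin \o fh).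
          exact: horizontal_integrand_integrable.
        have fkI : mu.-integrable `[0, t] (EFin \o fk).
          apply: eq_integrable (integrable_patch S0 St fhI fgc) => //= s _.
          by case: leP => sS; [rewrite fk1|rewrite fk2].
        have := primitive_incr fkI S0 St (lexx _).
        by rewrite /primitive => <-; rewrite subrKC.
      rewrite int1//.
      have -> : \int[mu]_(s in `]S, t]) fk s = \int[mu]_(s in `[S, t]) fg s.
        rewrite -Rintegral_itv_obnd_cbnd//; last first.
          by apply: integrableS (continuous_integrable S t fgc) => //; exact: subset_itv_oc_cc.
        by apply: eq_Rintegral => s; rewrite inE /= in_itv /= => /andP[Ss _]; exact: fk2.
      rewrite (FTC2_Rintegral St fgc (fun t => D' t i j)).
      have := hE S; rewrite S0 lexx => /(_ isT i j) E.
      by rewrite -/fh in E; rewrite addrA -E hS g'S subrKC.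
exists (S + b), k, w1, w2, w3; split => //.
- by rewrite addr_ge0.
- by rewrite /k S0.
- by rewrite kg// /g' mul1r addKr.
rewrite (control_lengthE hk); congr (_%:E).
have := primitive_incr (speed_integrable hk) S0 SSb (lexx _).
rewrite /primitive => /(canRL (subrK _)) ->; rewrite addrC; congr (_ + _).
  move: El; rewrite (control_lengthE hh) => -[<-].
  apply: eq_Rintegral => s; rewrite inE /= in_itv /= => /andP[_ sS].
  by rewrite /w1 /w2 /w3 sS.
transitivity (\int[mu]_(s in `]S, S + b]) (cst c) s).
  apply: eq_Rintegral => s; rewrite inE /= in_itv /= => /andP[Ss _].
  by rewrite /w1 /w2 /w3 leNgt Ss /= /u1' /u2' /u3' !mul1r speed sqrtr_sqr ger0_norm.
rewrite Rintegral_cst//= lebesgue_measure_itv /= lte_fin.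
case: ltgtP SSb => // [_ _|SE _]; first by rewrite -EFinD /= addrC addKr.
suff -> : b = 0 by rewrite /= !mulr0.
by apply: (addrI S); rewrite addr0.
Qed.

End SmoothCurves.

(** * Geodesics in polar form *)

Section Geodesics.
Context {R : realType}.
Implicit Types (th ph ka s h v t : R).

(** [exp (- th e4)], see [mxexp_e4]. *)
Definition rotm th : 'M[R]_4 :=
  mx4 1 0 0 0 (cos th) (sin th) 0 (- sin th) (cos th) 1.

(** The boost of rapidity [2 arcsinh s] along the first axis, with vertical
    coordinate [v]. *)
Definition boost s v : 'M[R]_4 := let r := Num.sqrt (1 + s ^+ 2) in
  mx4 (1 + 2 * s ^+ 2) (2 * s * r) 0 (2 * s * r) (1 + 2 * s ^+ 2) 0 0 0 1
    (expR v).

Lemma rotmD a b : rotm a *m rotm b = rotm (a + b).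
Proof. by rewrite mx4_mul; congr mx4; rewrite ?cosD ?sinD; ring. Qed.

Lemma rotm0 : rotm 0 = 1%:M.
Proof. by rewrite /rotm cos0 sin0 oppr0 mx4_1. Qed.

Lemma rotmDK a b (M : 'M[R]_4) : rotm a *m (rotm b *m M) = rotm (a + b) *m M.
Proof. by rewrite mulmxA rotmD. Qed.

Lemma rotm2pi th : rotm (th + 2 * pi) = rotm th.
Proof.
have -> : th + 2 * pi = th + pi *+ 2 by rewrite mulr2n; ring.
by rewrite /rotm cosD2pi sinD2pi.
Qed.

Lemma rotm_SO th : SO0_21xR (rotm th).
Proof.
rewrite /rotm -[X in mx4 _ _ _ _ _ _ _ _ _ X]expR0; apply: SO0_21xR_mx4.
have := cos2Dsin2 th => cs.
by apply: SO0_21_intro; rewrite ?ltr01//; lra.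
Qed.

Lemma sqr_r s : Num.sqrt (1 + s ^+ 2) ^+ 2 = 1 + s ^+ 2.
Proof. by rewrite sqr_sqrtr// ltW// sqr1_gt0. Qed.

Lemma boost_SO s v : SO0_21xR (boost s v).
Proof.
rewrite /boost; apply: SO0_21xR_mx4.
have := sqr_r s; move: (Num.sqrt _) => r r2.
have e : (2 * s * r) ^+ 2 = 4 * s ^+ 2 * (1 + s ^+ 2) by rewrite -r2; ring.
by apply: SO0_21_intro; try lra; rewrite ltr_pwDl// mulr_ge0// sqr_ge0.
Qed.

Lemma boost_opp s v w : boost s v *m boost (- s) w = boost 0 (v + w).
Proof.
rewrite /boost mx4_mul sqrrN expr0n /= addr0 sqrtr1; have := sqr_r s.
move: (Num.sqrt _) => r r2.
have e : (2 * s * r) ^+ 2 = 4 * s ^+ 2 * (1 + s ^+ 2) by rewrite -r2; ring.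
congr mx4; rewrite ?expRD//; try ring.
  transitivity ((1 + 2 * s ^+ 2) ^+ 2 - (2 * s * r) ^+ 2); first by ring.
  by rewrite e; ring.
transitivity ((1 + 2 * s ^+ 2) ^+ 2 - (2 * s * r) ^+ 2); first by ring.
by rewrite e; ring.
Qed.

Lemma boost_rotpi s v : boost (- s) v = rotm pi *m boost s v *m rotm (- pi).
Proof.
rewrite /boost /rotm !mx4_mul cosN sinN cospi sinpi sqrrN.
by congr mx4; ring.
Qed.

(** Two sides of the same length with the angle [pi - 2 * u] between them: the
    third side and the angles [mu] of the isosceles triangle. *)
Lemma boost_rot_boost s v w u mu s3 : let r := Num.sqrt (1 + s ^+ 2) in
  s3 = 2 * r * s * cos u ->
  (1 + 2 * s ^+ 2) * cos u = Num.sqrt (1 + s3 ^+ 2) * cos mu ->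
  sin u = Num.sqrt (1 + s3 ^+ 2) * sin mu ->
  boost s v *m rotm (2 * u) *m boost s w = rotm mu *m boost s3 (v + w) *m rotm mu.
Proof.
move=> r s3E E1 E2.
have C2 : cos (2 * u) = cos u ^+ 2 - sin u ^+ 2 by rewrite mulr_natl mulr2n cosD -!expr2.
have S2 : sin (2 * u) = 2 * sin u * cos u by rewrite mulr_natl mulr2n sinD; ring.
rewrite /boost /rotm C2 S2 !mx4_mul expRD.
have r2 := sqr_r s; rewrite -/r in r2 *.
move: E1 E2; have := sqr_r s3; move: (Num.sqrt (1 + s3 ^+ 2)) => r3 r32 E1 E2.
have := cos2Dsin2 u; have := cos2Dsin2 mu.
move: (cos u) (sin u) (cos mu) (sin mu) s3E E1 E2 => c d C D s3E E1 E2 CD cd.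
have hs : s3 ^+ 2 = 4 * (1 + s ^+ 2) * s ^+ 2 * c ^+ 2 by rewrite s3E -r2; ring.
have sr : s * r * (s * r) = s ^+ 2 * (1 + s ^+ 2) by rewrite -r2; ring.
have h1 : r3 * C * s3 = (1 + 2 * s ^+ 2) * c * (2 * r * s * c) by rewrite -E1 s3E.
have h2 : r3 * D * s3 = d * (2 * r * s * c) by rewrite -E2 s3E.
have h3 : (r3 * C) ^+ 2 = ((1 + 2 * s ^+ 2) * c) ^+ 2 by rewrite E1.
have h4 : (r3 * D) ^+ 2 = d ^+ 2 by rewrite E2.
have h5 : (r3 * C) * (r3 * D) = (1 + 2 * s ^+ 2) * c * d by rewrite -E1 -E2.
have d2 : d ^+ 2 = 1 - c ^+ 2 by lra.
have D2 : D ^+ 2 = 1 - C ^+ 2 by lra.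
congr mx4; try by ring.
- rewrite hs.
  transitivity ((1 + 2 * s ^+ 2) ^+ 2 + 4 * (s * r * (s * r)) * (c ^+ 2 - d ^+ 2)); first by ring.
  by rewrite sr d2; ring.
- transitivity (2 * (r3 * C * s3)); last by ring.
  rewrite h1; transitivity ((1 + 2 * s ^+ 2) * (2 * s * r) * (1 + (c ^+ 2 - d ^+ 2))); first by ring.
  by rewrite d2; ring.
- transitivity (2 * (r3 * D * s3)); last by ring.
  by rewrite h2; ring.
- transitivity (2 * (r3 * C * s3)); last by ring.
  rewrite h1; transitivity ((1 + 2 * s ^+ 2) * (2 * s * r) * (1 + (c ^+ 2 - d ^+ 2))); first by ring.
  by rewrite d2; ring.
- transitivity (2 * (r3 * C) ^+ 2 - 1 + (1 + 2 * s3 ^+ 2) * C ^+ 2 - D ^+ 2 - 2 * (r3 * C) ^+ 2 + 1); last by ring.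
  rewrite D2; transitivity (2 * (r3 * C) ^+ 2 - 1 + 2 * C ^+ 2 * (1 + s3 ^+ 2 - r3 ^+ 2)); last by ring.
  rewrite r32 subrr mulr0 addr0 h3.
  transitivity (4 * (s * r * (s * r)) + (1 + 2 * s ^+ 2) ^+ 2 * (c ^+ 2 - d ^+ 2)); first by ring.
  by rewrite sr d2; ring.
- transitivity (2 * ((r3 * C) * (r3 * D)) + 2 * C * D * (1 + s3 ^+ 2 - r3 ^+ 2)); last by ring.
  by rewrite r32 h5; ring.
- transitivity (- (2 * (r3 * D * s3))); last by ring.
  by rewrite h2; ring.
- transitivity (- (2 * ((r3 * C) * (r3 * D)) + 2 * C * D * (1 + s3 ^+ 2 - r3 ^+ 2))); last by ring.
  by rewrite r32 h5; ring.
- transitivity (1 - 2 * (r3 * D) ^+ 2 + 2 * D ^+ 2 * (r3 ^+ 2 - 1 - s3 ^+ 2) + (C ^+ 2 + D ^+ 2 - 1)); last by ring.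
  have -> : 2 * D ^+ 2 * (r3 ^+ 2 - 1 - s3 ^+ 2) = 0 by rewrite r32; ring.
  by rewrite h4; lra.
Qed.

(** [exp t (e3 + ka e4)], with vertical coordinate [v]; [sn] and [cn] are taken
    at half time. *)
Definition helix ka t v : 'M[R]_4 :=
  let s := sn (1 - ka ^+ 2) t in let h := cn (1 - ka ^+ 2) t in
  mx4 (1 + 2 * s ^+ 2) (2 * s * h) (- (2 * s ^+ 2 * ka))
      (2 * s * h) (1 + 2 * s ^+ 2 * (1 - ka ^+ 2)) (- (2 * s * h * ka))
      (2 * s ^+ 2 * ka) (2 * s * h * ka) (1 - 2 * s ^+ 2 * ka ^+ 2) (expR v).

Lemma helix_KAK ka t v : 0 <= t ->
  helix ka t v = rotm (- om ka t) *m boost (sn (1 - ka ^+ 2) t) v *m rotm (- om ka t).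
Proof.
move=> t0; have [hE sE] := om_cos_sin ka t0.
rewrite /helix /boost /rotm !mx4_mul hE cosN sinN.
have := cos2Dsin2 (om ka t); move: hE sE; set s := sn _ _; have := sqr_r s.
move: (Num.sqrt _) (cos _) (sin _) => r C D r2 hE sE CD.
have e1 : 2 * s ^+ 2 * ka = 2 * s * (r * D) by rewrite -sE; ring.
have e2 : s ^+ 2 * ka ^+ 2 = (1 + s ^+ 2) * D ^+ 2.
  by rewrite -r2; transitivity ((ka * s) ^+ 2); [ring|rewrite sE; ring].
have e3 : 2 * s * (r * C) * ka = 2 * (1 + s ^+ 2) * C * D.
  by rewrite -r2; transitivity (2 * (r * C) * (ka * s)); [ring|rewrite sE; ring].
have C2 : C ^+ 2 = 1 - D ^+ 2 by lra.
congr mx4; try by ring.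
- by rewrite e1; ring.
- transitivity (1 + 2 * s ^+ 2 - 2 * (s ^+ 2 * ka ^+ 2)); first by ring.
  rewrite e2; transitivity ((1 + 2 * s ^+ 2) * C ^+ 2 - D ^+ 2); last by ring.
  by rewrite C2; ring.
- by rewrite e3; ring.
- by rewrite e1; ring.
- by rewrite e3; ring.
- transitivity (1 - 2 * (s ^+ 2 * ka ^+ 2)); first by ring.
  rewrite e2; transitivity (C ^+ 2 - (1 + 2 * s ^+ 2) * D ^+ 2); last by ring.
  by rewrite C2; ring.
Qed.

(** [gamma2E] identifies these curves with the geodesics; [ka] is the geodesic
    curvature of the projection and [ph] its initial direction. *)
Definition geod ph ka t v : 'M[R]_4 :=
  rotm (- ph) *m (helix ka t v *m rotm (ph + ka * t)).

(** Rotation, boost, rotation: the end point of the projection in polar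
    coordinates, and the holonomy as the sum of the two angles. *)
Lemma geod_KAK ph ka t v : 0 <= t ->
  geod ph ka t v = rotm (- (ph + om ka t)) *m boost (sn (1 - ka ^+ 2) t) v *m
    rotm (ph + om ka t + hol ka t).
Proof.
move=> t0; rewrite /geod helix_KAK// !mulmxA rotmD -!mulmxA rotmD /hol.
by congr (rotm _ *m (_ *m rotm _)); ring.
Qed.

Lemma helix_row_derive (a b c : R -> R) ka ph t :
  is_derive t 1 a (b t) -> is_derive t 1 b (a t + ka * c t) ->
  is_derive t 1 c (- ka * b t) ->
  is_derive t 1 (fun t => b t * cos (ph + ka * t) - c t * sin (ph + ka * t))
     (cos (ph + ka * t) * a t) /\
  is_derive t 1 (fun t => b t * sin (ph + ka * t) + c t * cos (ph + ka * t))
     (sin (ph + ka * t) * a t).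
Proof.
move=> da db dc.
have dth : is_derive t 1 (fun t : R => ph + ka * t) ka.
  by apply: is_derive_eq; rewrite /GRing.scale /=; ring.
have dC := @is_derive1_comp R (@cos R) (fun t => ph + ka * t) t _ _ (is_derive_cos _) dth.
have dS := @is_derive1_comp R (@sin R) (fun t => ph + ka * t) t _ _ (is_derive_sin _) dth.
have d1 := is_deriveM db dC; have d2 := is_deriveM dc dS.
have d3 := is_deriveM db dS; have d4 := is_deriveM dc dC.
split; [apply: (is_derive_eq (is_deriveB d1 d2))|apply: (is_derive_eq (is_deriveD d3 d4))];
  rewrite /GRing.scale /=; ring.
Qed.

Lemma geod_SO ph ka t v : 0 <= t -> SO0_21xR (geod ph ka t v).
Proof.
by move=> t0; rewrite geod_KAK//; apply: SO0_21xR_mul (rotm_SO _);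
  apply: SO0_21xR_mul (rotm_SO _) (boost_SO _ _).
Qed.

Lemma helix_SO ka t v : SO0_21xR (helix ka t v).
Proof.
rewrite /helix; apply: SO0_21xR_mx4.
have := cn_sn (1 - ka ^+ 2) t; move: (sn _ _) (cn _ _) => s h h2.
have H z : h ^+ 2 * z = (1 + (1 - ka ^+ 2) * s ^+ 2) * z by rewrite h2.
have H1 := H (s ^+ 2); have H2 := H (s ^+ 2 * ka ^+ 2); have H3 := H (s ^+ 4).
have H4 := H (s ^+ 4 * ka ^+ 2); have H5 := H (s ^+ 4 * ka ^+ 4).
have H6 := H (s ^+ 2 * ka).
by apply: SO0_21_intro; try lra; rewrite ltr_pwDl// mulr_ge0// sqr_ge0.
Qed.

Lemma mul_rotm (P : 'M[R]_4) th i :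
  [/\ (P *m rotm th) i 0 = P i 0,
     (P *m rotm th) i 1 = P i 1 * cos th - P i 2 * sin th,
     (P *m rotm th) i 2 = P i 1 * sin th + P i 2 * cos th &
     (P *m rotm th) i 3 = P i 3].
Proof. by rewrite !mxE !sum_ord4 /rotm !mx4E; split; ring. Qed.

(** The rows [(a, b, c)] of [helix] satisfy [a' = b], [b' = a + ka c],
    [c' = - ka b]; the final rotation turns them into solutions of the
    horizontal equation with planar controls of norm 1. *)
Lemma geod_smooth L ph ka v0 mu : SO0_21xR L ->
  smooth_horizontal (fun t => L *m geod ph ka t (v0 + mu * t))
    (fun t => sin (ph + ka * t)) (fun=> mu) (fun t => cos (ph + ka * t)).
Proof.
move=> HL; rewrite /geod.
apply: smooth_left => //; apply: smooth_left; first exact: rotm_SO.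
have thc : continuous (fun t : R => ph + ka * t).
  by move=> t; apply: cvgD; [exact: cvg_cst|apply: cvgM; [exact: cvg_cst|exact: cvg_id]].
split.
- by move=> t; apply: SO0_21xR_mul; [exact: helix_SO|exact: rotm_SO].
- move=> t i j.
  have [E0 E1 E2 E3] := mul_control (helix ka t (v0 + mu * t) *m rotm (ph + ka * t))
    (sin (ph + ka * t)) mu (cos (ph + ka * t)) i.
  pose s t := sn (1 - ka ^+ 2) t; pose h t := cn (1 - ka ^+ 2) t.
  have ds : is_derive t 1 s (h t / 2) by exact: is_derive_sn.
  have dh : is_derive t 1 h ((1 - ka ^+ 2) * s t / 2) by exact: is_derive_cn.
  have h2 : h t ^+ 2 = 1 + (1 - ka ^+ 2) * s t ^+ 2 by exact: cn_sn.
  have ds2 : is_derive t 1 (fun t => s t ^+ 2) (s t * h t).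
    by apply: is_derive_eq; rewrite /GRing.scale /=; field.
  have dsh : is_derive t 1 (fun t => s t * h t) ((h t ^+ 2 + (1 - ka ^+ 2) * s t ^+ 2) / 2).
    by apply: (is_derive_eq (is_deriveM ds dh)); rewrite /GRing.scale /=; field.
  have aff (p q r : R) : is_derive t 1 (fun t => p + q * s t ^+ 2 + r * (s t * h t))
      (q * (s t * h t) + r * ((h t ^+ 2 + (1 - ka ^+ 2) * s t ^+ 2) / 2)).
    by apply: is_derive_eq; rewrite /GRing.scale /=; ring.
  have affE (f : R -> R) (p q r d : R) :
      (forall t, f t = p + q * s t ^+ 2 + r * (s t * h t)) ->
      d = (q * (s t * h t) + r * ((h t ^+ 2 + (1 - ka ^+ 2) * s t ^+ 2) / 2)) ->
      is_derive t 1 f d by move=> /funext -> ->.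
  pose M t := helix ka t (v0 + mu * t).
  have row k : [/\ is_derive t 1 (fun t => M t k 0) (M t k 1),
      is_derive t 1 (fun t => M t k 1) (M t k 0 + ka * M t k 2),
      is_derive t 1 (fun t => M t k 2) (- ka * M t k 1) &
      is_derive t 1 (fun t => M t k 3) (mu * M t k 3)].
    have h2' := congr1 (fun z => z * ka) h2; rewrite /= in h2'.
    rewrite /M /helix; case: (ord4P k) => ->; rewrite !mx4E -/(s t) -/(h t).
    - split; [apply: (affE _ 1 2 0)|apply: (affE _ 0 0 2)|apply: (affE _ 0 (- (2 * ka)) 0)|apply: (affE _ 0 0 0)];
        try (by move=> x; rewrite mx4E /s /h; ring); lra.
    - split; [apply: (affE _ 0 0 2)|apply: (affE _ 1 (2 * (1 - ka ^+ 2)) 0)|apply: (affE _ 0 0 (- (2 * ka)))|apply: (affE _ 0 0 0)];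
        try (by move=> x; rewrite mx4E /s /h; ring); lra.
    - split; [apply: (affE _ 0 (2 * ka) 0)|apply: (affE _ 0 0 (2 * ka))|apply: (affE _ 1 (- (2 * ka ^+ 2)) 0)|apply: (affE _ 0 0 0)];
        try (by move=> x; rewrite mx4E /s /h; ring); lra.
    - split; [apply: (affE _ 0 0 0)..|]; try (by move=> x; rewrite mx4E /s /h; ring);
        try lra.
      have dv : is_derive t 1 (fun t : R => v0 + mu * t) mu.
        by apply: is_derive_eq; rewrite /GRing.scale /=; ring.
      rewrite [F in is_derive _ _ F _](_ : _ = @expR R \o (fun x : R => v0 + mu * x)).
        have := @is_derive1_comp R (@expR R) (fun x => v0 + mu * x) t _ _ (is_derive_expR _) dv.
        by rewrite mulrC.
      by apply/funext => x; rewrite mx4E.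
  have [r0 r1 r2 r3] := row i.
  have [c1 c2] := helix_row_derive ph r0 r1 r2.
  have N x := mul_rotm (M x) (ph + ka * x) i.
  have [N0 N1 N2 N3] := N t.
  case: (ord4P j) => ->.
  + rewrite E0 -/(M t) N1 N2.
    rewrite [F in is_derive _ _ F _](_ : _ = fun t => M t i 0); last by apply/funext => x; have [] := N x.
    apply: (is_derive_eq r0); have := cos2Dsin2 (ph + ka * t) => cs.
    transitivity (M t i 1 * (cos (ph + ka * t) ^+ 2 + sin (ph + ka * t) ^+ 2)); last by ring.
    by rewrite cs mulr1.
  + rewrite E1 -/(M t) N0.
    by rewrite [F in is_derive _ _ F _](_ : _ = fun x => M x i 1 * cos (ph + ka * x) - M x i 2 * sin (ph + ka * x)) //; apply/funext => x; have [] := N x.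
  + rewrite E2 -/(M t) N0.
    by rewrite [F in is_derive _ _ F _](_ : _ = fun x => M x i 1 * sin (ph + ka * x) + M x i 2 * cos (ph + ka * x)) //; apply/funext => x; have [] := N x.
  + rewrite E3 -/(M t) N3.
    by rewrite [F in is_derive _ _ F _](_ : _ = fun x => M x i 3) //; apply/funext => x; have [] := N x.
- by move=> t; apply: (@continuous_comp _ _ _ (fun t : R => ph + ka * t) (@sin R));
    [exact: thc|exact: continuous_sin].
- by move=> t; exact: cvg_cst.
- by move=> t; apply: (@continuous_comp _ _ _ (fun t : R => ph + ka * t) (@cos R));
    [exact: thc|exact: continuous_cos].
Qed.

End Geodesics.

(** * Shortcuts beyond holonomy pi *)

Section Shortcuts.
Context {R : realType}.
Implicit Types (k ka ph s t v mu : R).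

Lemma sinh_increasing (x y : R) : x < y -> sinh x < sinh y.
Proof.
move=> xy; apply: (derive_increasing (df := @cosh R) xy) => z _.
  exact: is_derive_sinh.
exact: cosh_gt0.
Qed.

Lemma sinh_lt_reflect (x y : R) : sinh x < sinh y -> x < y.
Proof.
move=> H; rewrite ltNge le_eqVlt; apply/negP => /predU1P[e|/sinh_increasing].
  by move: H; rewrite e ltxx.
by move=> /(lt_trans H); rewrite ltxx.
Qed.

Lemma sinh0 : sinh (0 : R) = 0.
Proof. by rewrite /sinh oppr0 subrr mul0r. Qed.

Lemma cosh_lt (x y : R) : 0 <= x -> x < y -> cosh x < cosh y.
Proof.
move=> x0 xy; apply: (derive_increasing (df := @sinh R) xy) => z.
  by move=> _; exact: is_derive_cosh.
by move=> /andP[xz _]; rewrite -sinh0 sinh_increasing// (le_lt_trans x0).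
Qed.

Lemma cosh0 : cosh (0 : R) = 1.
Proof. by rewrite /cosh oppr0 expR0; field. Qed.

(** A chord is shorter than its arc. *)
Lemma sn_lt_sinh k t : 0 < k -> 0 < t -> sn (1 - k ^+ 2) t < sinh (t / 2).
Proof.
move=> k0 t0.
have cnlt x : 0 < x -> cn (1 - k ^+ 2) x < cosh (x / 2).
  move=> x0; have x2 : 0 < x / 2 by rewrite divr_gt0.
  have c1 : 1 < cosh (x / 2) by have := cosh_lt (lexx 0) x2; rewrite cosh0.
  rewrite /cn; case: ifP => c0.
    apply: cosh_lt; first by rewrite divr_ge0// mulr_ge0 ?sqrtr_ge0// ltW.
    rewrite ltr_pM2r ?invr_gt0// gtr_pMl// -[ltRHS]sqrtr1 ltr_sqrt//.
    by rewrite gtrBl exprn_gt0.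
  by case: ifP => _ //; apply: le_lt_trans c1; exact: cos_le1.
have D (x : R) : is_derive x 1 (fun x => sinh (x / 2) - sn (1 - k ^+ 2) x)
    (cosh (x / 2) / 2 - cn (1 - k ^+ 2) x / 2).
  have d1 : is_derive x 1 (fun x : R => x / 2) 2^-1.
    by apply: is_derive_eq; rewrite /GRing.scale /=; ring.
  have d2 := @is_derive1_comp R (@sinh R) (fun x => x / 2) x _ _ (is_derive_sinh _) d1.
  exact: (is_deriveB d2 (is_derive_sn _ _)).
have := @derive_increasing R (fun x => sinh (x / 2) - sn (1 - k ^+ 2) x)
  (fun x => cosh (x / 2) / 2 - cn (1 - k ^+ 2) x / 2) 0 t t0 (fun x _ => D x).
rewrite mul0r sinh0 sn0 subrr subr_gt0; apply => x /andP[x0 _].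
by rewrite subr_gt0 ltr_pM2r ?invr_gt0// cnlt.
Qed.

(** The witness is [2 arcsinh s]. *)
Lemma rapidity s : 0 < s -> exists2 rho : R, 0 < rho & sinh (rho / 2) = s.
Proof.
move=> s0; pose z := s + Num.sqrt (1 + s ^+ 2).
have r2 := sqr_r s; have r0 : 0 < Num.sqrt (1 + s ^+ 2) by rewrite sqrtr_gt0 sqr1_gt0.
have z0 : 0 < z by rewrite addr_gt0.
have z1 : 1 < z.
  rewrite ltNge; apply/negP => h; move: h r2 r0; rewrite /z.
  move: (Num.sqrt _) => r h r2 r0; nra.
exists (2 * ln z); first by rewrite mulr_gt0// ln_gt0.
have -> : 2 * ln z / 2 = ln z by field.
rewrite /sinh expRN lnK ?posrE//.
have -> : z^-1 = Num.sqrt (1 + s ^+ 2) - s.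
  apply: (mulfI (lt0r_neq0 z0)); rewrite divff ?lt0r_neq0// /z.
  by transitivity (Num.sqrt (1 + s ^+ 2) ^+ 2 - s ^+ 2); [rewrite r2|]; ring.
by rewrite /z; field.
Qed.

Lemma om_opp k t : 0 <= t -> om (- k) t = - om k t.
Proof.
move=> t0; suff : om (- k) t + om k t = om (- k) 0 + om k 0.
  by rewrite !om0 addr0 => /eqP; rewrite addr_eq0 => /eqP.
apply: (derive0_constant (f := fun t => om (- k) t + om k t)) => // x /andP[x0 _].
have x1 : -1 < x by lra.
apply: (is_derive_eq (is_deriveD (is_derive_om (- k) x1) (is_derive_om k x1))).
by rewrite sqrrN !mulNr addNr.
Qed.

Lemma hol_opp k t : 0 <= t -> hol (- k) t = - hol k t.
Proof. by move=> t0; rewrite /hol om_opp//; ring. Qed.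

Lemma om_zero t : 0 <= t -> om 0 t = 0.
Proof.
move=> t0; have := om_opp 0 t0; rewrite oppr0 => /eqP.
by rewrite -addr_eq0 -mulr2n mulrn_eq0 /= => /eqP.
Qed.

Lemma boost0_1 : boost 0 0 = 1%:M :> 'M[R]_4.
Proof. by rewrite /boost expr0n /= mulr0 mul0r !addr0 expR0 mx4_1. Qed.

Lemma geod0 ph ka : geod ph ka 0 0 = 1%:M.
Proof.
rewrite geod_KAK// om0 hol0 !addr0 sn0 boost0_1 mulmx1 rotmD addNr.
exact: rotm0.
Qed.

Lemma reach_geod x L ph ka v0 mu s t l : SO0_21xR L -> s <= t ->
  reach x (L *m geod ph ka s (v0 + mu * s)) l ->
  reach x (L *m geod ph ka t (v0 + mu * t)) (l + Num.sqrt (1 + mu ^+ 2) * (t - s)).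
Proof.
move=> HL st H.
have sg := smooth_affine s 1 (geod_smooth ph ka v0 mu HL).
have := reach_extend (b := t - s) (c := Num.sqrt (1 + mu ^+ 2)) H _ (sqrtr_ge0 _) sg.
rewrite /= (_ : s + 1 * 0 = s); last by ring.
rewrite (_ : s + 1 * (t - s) = t); last by ring.
apply => //.
  by rewrite subr_ge0.
move=> y; rewrite !mul1r sqr_r.
by have := cos2Dsin2 (ph + ka * (s + y)); lra.
Qed.

(** A boost is a geodesic of curvature [0]. *)
Lemma reach_chord x L s w et l rho : SO0_21xR L -> 0 < rho ->
  sinh (rho / 2) = s -> reach x L l ->
  reach x (L *m (rotm (- et) *m boost s w *m rotm et)) (l + Num.sqrt (rho ^+ 2 + w ^+ 2)).
Proof.
move=> HL r0 sE H.
have := @reach_geod x L et 0 0 (w / rho) 0 rho l HL (ltW r0).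
rewrite mulr0 addr0 geod0 mulmx1 => /(_ H).
rewrite add0r divfK ?gt_eqF// geod_KAK ?ltW// om_zero ?ltW// /hol om_zero ?ltW//.
rewrite mul0r mulr0 subrr !addr0 expr0n /= subr0.
have -> : sn 1 rho = s by rewrite /sn ltr01 sqrtr1 mul1r divr1.
rewrite subr0; suff -> : Num.sqrt (1 + (w / rho) ^+ 2) * rho = Num.sqrt (rho ^+ 2 + w ^+ 2) by [].
have {2}-> : rho = Num.sqrt (rho ^+ 2) by rewrite sqrtr_sqr gtr0_norm.
rewrite -sqrtrM ?addr_ge0 ?sqr_ge0//; congr Num.sqrt.
by field; rewrite gt_eqF.
Qed.

(** Let the holonomy at [T2] be [v], between [pi] and [2 * pi]. The reflected
    arc has holonomy [- v], which differs from [v] modulo [2 * pi] by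
    [2 * v - 2 * pi]; the initial part of the reflected arc that has this
    holonomy, up to sign, is replaced by its chord, which has none. This corrects
    the difference and saves length. *)
Lemma shortcut_holonomy k ka ph mu T : 0 < k -> ka = k \/ ka = - k -> 0 < T ->
  (1 < k -> T <= 2 * pi / kap k) -> pi < hol k T ->
  exists2 l, l < Num.sqrt (1 + mu ^+ 2) * T &
    reach 1%:M (geod ph ka T (mu * T)) l.
Proof.
move=> k0 kak T0 Tk holT; have pi0 := pi_gt0 R.
(* [v < 2 * pi] makes [2 * v - 2 * pi < v], so that [s0] precedes [T2] *)
pose v := Num.min (hol k T) (3 / 2 * pi).
have vpi : pi < v by rewrite lt_min holT; lra.
have v2pi : v < 2 * pi by rewrite gt_min; apply/orP; right; lra.
have vT : v <= hol k T by rewrite ge_min lexx.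
have [|T2] := IVT (ltW T0) (hol_continuous (k := k) (t := T)) (v := v).
  by rewrite hol0 ge_min le_max vT orbT andbT; apply/orP; left; lra.
rewrite in_itv /= => /andP[T20 T2T] holT2.
have A00 : 0 < 2 * v - 2 * pi by lra.
have [|s0] := IVT T20 (hol_continuous (k := k) (t := T2)) (v := 2 * v - 2 * pi).
  by rewrite hol0 holT2 ge_min le_max (ltW A00) /=; apply/orP; right; lra.
rewrite in_itv /= => /andP[s00 s0T2] hols0.
have s0p : 0 < s0.
  by rewrite lt_def s00 andbT; apply/eqP => e; move: hols0 A00; rewrite e hol0 => <-; rewrite ltxx.
have s0T : s0 < T2.
  rewrite lt_def s0T2 andbT; apply/eqP => e; move: hols0; rewrite -e holT2 => E.
  by move: v2pi; lra.
have sp : 0 < sn (1 - k ^+ 2) s0.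
  by apply: sn_gt0 => // /Tk; apply: lt_le_trans; apply: lt_le_trans s0T T2T.
have [rho rho0 rhoE] := rapidity sp.
have rhos0 : rho < s0.
  have : sinh (rho / 2) < sinh (s0 / 2) by rewrite rhoE sn_lt_sinh.
  by move=> /sinh_lt_reflect; rewrite ltr_pM2r ?invr_gt0.
have ka2 : ka ^+ 2 = k ^+ 2 by case: kak => ->; rewrite ?sqrrN.
pose ph' := hol ka s0 + ph + 2 * om ka T2.
pose et := ph' - om ka s0 - hol ka s0.
have holmod : rotm (hol ka s0 - hol ka T2 + (ph + om ka T2)) =
    rotm (ph + om ka T2 + hol ka T2).
  have eh : hol k s0 = 2 * hol k T2 - 2 * pi by rewrite hols0 holT2.
  case: kak => ->.
    by rewrite -[LHS]rotm2pi; congr rotm; rewrite eh; ring.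
  by rewrite !hol_opp// -[RHS]rotm2pi; congr rotm; rewrite eh; ring.
have H0 : reach 1%:M (1%:M : 'M[R]_4) 0.
  by apply: reach_refl; rewrite -rotm0; exact: rotm_SO.
have HI : SO0_21xR (1%:M : 'M[R]_4) by rewrite -rotm0; exact: rotm_SO.
have := reach_chord (mu * s0) et HI rho0 rhoE H0.
have -> : 1%:M *m (rotm (- et) *m boost (sn (1 - k ^+ 2) s0) (mu * s0) *m rotm et) =
    rotm (hol ka s0) *m geod ph' (- ka) s0 (0 + mu * s0).
  rewrite mul1mx add0r geod_KAK// om_opp// (hol_opp ka)// sqrrN ka2 !mulmxA rotmD.
  by congr (rotm _ *m _ *m rotm _); rewrite /et /ph'; ring.
move=> /(reach_geod (rotm_SO _) s0T2).
have -> : rotm (hol ka s0) *m geod ph' (- ka) T2 (0 + mu * T2) =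
    1%:M *m geod ph ka T2 (0 + mu * T2).
  rewrite mul1mx add0r !geod_KAK// om_opp// (hol_opp ka)// sqrrN !mulmxA rotmD -holmod.
  by congr (rotm _ *m _ *m rotm _); rewrite /ph'; ring.
move=> /(reach_geod HI T2T); rewrite mul1mx add0r => H.
exists (0 + Num.sqrt (rho ^+ 2 + (mu * s0) ^+ 2) + Num.sqrt (1 + mu ^+ 2) * (T2 - s0) +
  Num.sqrt (1 + mu ^+ 2) * (T - T2)); last exact: H.
suff : Num.sqrt (rho ^+ 2 + (mu * s0) ^+ 2) < Num.sqrt (1 + mu ^+ 2) * s0 by lra.
have {2}-> : s0 = Num.sqrt (s0 ^+ 2) by rewrite sqrtr_sqr gtr0_norm.
rewrite -sqrtrM ?addr_ge0 ?sqr_ge0// ltr_sqrt; last first.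
  by rewrite mulr_gt0 ?exprn_gt0// sqr1_gt0.
by nra.
Qed.

End Shortcuts.

(** * Shortcuts beyond a full turn *)

Section FullTurn.
Context {R : realType}.
Implicit Types (k ka ph s t v mu : R).

Lemma om_period k t : 1 < k -> 0 <= t -> om k (2 * pi / kap k + t) = pi + om k t.
Proof.
move=> k1 t0; have kp := kap_gt0 k1.
have p0 : 0 <= 2 * pi / kap k by rewrite divr_ge0 ?mulr_ge0 ?pi_ge0// ltW.
suff : om k (2 * pi / kap k + t) - om k t = om k (2 * pi / kap k + 0) - om k 0.
  by rewrite om0 addr0 subr0 (full_turn k1).2 => /(canRL (subrK _)).
apply: (derive0_constant (f := fun t => om k (2 * pi / kap k + t) - om k t)) => // x /andP[x0 _].
have x1 : -1 < x by lra.
have x2 : -1 < 2 * pi / kap k + x by lra.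
have d1 : is_derive x 1 (fun x : R => 2 * pi / kap k + x) 1.
  apply: (is_derive_eq (is_deriveD (is_derive_cst (2 * pi / kap k) x 1) (is_derive_id x 1))).
  exact: add0r.
have d2 := @is_derive1_comp R (om k) (fun x => 2 * pi / kap k + x) x _ _ (is_derive_om k x2) d1.
apply: (is_derive_eq (is_deriveB d2 (is_derive_om k x1))).
have [-> _] := sn_cn_circle (2 * pi / kap k + x) k1.
have [-> _] := sn_cn_circle x k1.
have -> : kap k * (2 * pi / kap k + x) / 2 = kap k * x / 2 + pi by field; rewrite gt_eqF.
by rewrite sinDpi mulNr sqrrN mulr1 subrr.
Qed.

Lemma sn_period k t : 1 < k ->
  sn (1 - k ^+ 2) (2 * pi / kap k + t) = - sn (1 - k ^+ 2) t.
Proof.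
move=> k1; have kp := kap_gt0 k1.
have [-> _] := sn_cn_circle (2 * pi / kap k + t) k1.
have [-> _] := sn_cn_circle t k1.
have -> : kap k * (2 * pi / kap k + t) / 2 = kap k * t / 2 + pi by field; rewrite gt_eqF.
by rewrite sinDpi mulNr.
Qed.

Lemma sin_le (x : R) : 0 <= x -> sin x <= x.
Proof.
move=> x0; rewrite -subr_ge0.
have := @derive_nondecreasing R (fun x => x - sin x) (fun x => 1 - cos x) 0 x x0.
rewrite sin0 subrr; apply=> y _.
by rewrite subr_ge0 cos_le1.
Qed.

(** The area is of third order in the length, the square of the chord of second
    order; [t <= 1 / k] makes this explicit. *)
Lemma hol_small k t : 1 < k -> 0 < t -> t <= pi / kap k -> k * t <= 1 ->
  hol k t * (1 + sn (1 - k ^+ 2) t ^+ 2) <= sn (1 - k ^+ 2) t ^+ 2.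
Proof.
move=> k1 t0 tk kt; set s := sn _ t; have kp := kap_gt0 k1; have k0 : 0 < k by lra.
have sp := sqr1_gt0 s.
suff H : hol k t <= k * (s ^+ 2 / (1 + s ^+ 2)) * t.
  have : hol k t <= s ^+ 2 / (1 + s ^+ 2).
    apply: le_trans H _; rewrite mulrAC ler_piMl//.
    by rewrite divr_ge0 ?sqr_ge0// ltW.
  by rewrite ler_pdivlMr.
rewrite -subr_ge0.
have := @derive_nondecreasing R (fun x => k * (s ^+ 2 / (1 + s ^+ 2)) * x - hol k x)
  (fun x => k * (s ^+ 2 / (1 + s ^+ 2)) -
    k * sn (1 - k ^+ 2) x ^+ 2 / (1 + sn (1 - k ^+ 2) x ^+ 2)) 0 t (ltW t0).
rewrite hol0 mulr0 subrr; apply => x.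
  move=> /andP[x0 _]; have x1 : -1 < x by lra.
  have D := is_derive_hol k x1.
  by apply: is_derive_eq; rewrite /GRing.scale /=; ring.
move=> /andP[x0 xt]; rewrite subr_ge0 -mulrA ler_pM2l//.
have sx : sn (1 - k ^+ 2) x <= s by apply: sn_nondecreasing; rewrite // ltW.
have sx0 : 0 <= sn (1 - k ^+ 2) x.
  apply: sn_ge0 => //; first exact: ltW.
  by move=> _; apply: le_trans (ltW xt) (le_trans tk (half_le_full k1)).
rewrite ler_pdivrMr ?sqr1_gt0// mulrAC ler_pdivlMr//.
move: (sn _ x) sx sx0 => y sx sx0.
have : y ^+ 2 <= s ^+ 2 by rewrite ler_pXn2r// nnegrE// (le_trans sx0).
by lra.
Qed.

(** A full circle may be turned about its base point without changing the end
    point of the curve or its length. The last part of length [ta] of the turned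
    circle and the first part of length [ta] of the continuation then form a
    corner, where their chords turn by [2 * u]; both parts are replaced by one
    chord. The corner is chosen so that the holonomy lost with them is the area
    of the triangle of the three chords, and the triangle inequality saves
    length. *)
Lemma shortcut_full_turn k ka ph mu T : 1 < k -> ka = k \/ ka = - k ->
  2 * pi / kap k < T ->
  exists2 l, l < Num.sqrt (1 + mu ^+ 2) * T &
    reach 1%:M (geod ph ka T (mu * T)) l.
Proof.
move=> k1 kak T1T; have pi0 := pi_gt0 R; have pi2 := pi_ge2 R.
have kp := kap_gt0 k1; have k0 : 0 < k by lra.
set T1 := 2 * pi / kap k in T1T *.
have T1E : T1 = 2 * (pi / kap k) by rewrite /T1; ring.
have T10 : 0 < pi / kap k by rewrite divr_gt0.
(* the three bounds: stay before [T], make [hol_small] apply, and stay within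
   half a turn *)
pose ta := Num.min (T - T1) (Num.min (k^-1) (pi / kap k)).
have ta0 : 0 < ta by rewrite !lt_min subr_gt0 T1T invr_gt0 k0 T10.
have taT : T1 + ta <= T by rewrite -lerBrDl ge_min lexx.
have tak : k * ta <= 1.
  have : ta <= k^-1 by rewrite !ge_min lexx orbT.
  by rewrite -(ler_pM2l k0) divff ?gt_eqF.
have tapi : ta <= pi / kap k by rewrite !ge_min lexx !orbT.
have taT1 : ta < T1 by rewrite T1E; lra.
set s := sn (1 - k ^+ 2) ta.
have s0 : 0 < s by apply: sn_gt0.
have := hol_small k1 ta0 tapi tak; rewrite /= -/s; set A := hol k ta => Asm.
have A0 : 0 <= A by apply: hol_ge0 => //; [exact: ltW|move=> _; exact: ltW].
have s2 : 0 < s ^+ 2 by rewrite exprn_gt0.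
have A1 : A < 1 by nra.
have cA : 0 < cos A by apply: cos_gt0_pihalf; apply/andP; split; lra.
have sA0 : 0 <= sin A by apply: sin_ge0_pi; apply/andP; split; lra.
(* [th = u + m], [A = u - m]: the condition on the triangle is then
   [sin th * s ^+ 2 = sin A * (1 + s ^+ 2)] *)
pose z := sin A * (1 + s ^+ 2) / s ^+ 2.
have z0 : 0 <= z by rewrite divr_ge0 ?sqr_ge0// mulr_ge0// ltW// sqr1_gt0.
have z1 : z <= 1.
  rewrite ler_pdivrMr// mul1r; apply: le_trans Asm.
  by rewrite ler_pM2r ?sqr1_gt0// sin_le.
have zI : z \in `[-1, 1] by rewrite in_itv /= z1 andbT; lra.
pose th := asin z.
have sth : sin th = z by exact: asinK.
have zI' : -1 <= z <= 1 by move: zI; rewrite in_itv.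
have thN := asin_geNpi2 zI'; have thpi : th <= pi / 2 by exact: asin_lepi2.
rewrite -/th in thN.
have th0 : 0 <= th.
  rewrite leNgt; apply/negP => thneg.
  have : 0 < sin (- th) by apply: sin_gt0_pi; apply/andP; split; lra.
  by rewrite sinN sth; lra.
pose u := (th + A) / 2; pose m := (th - A) / 2.
have um : u - m = A by rewrite /u /m; field.
have cu : 0 < cos u by apply: cos_gt0_pihalf; rewrite /u; apply/andP; split; lra.
have cm : 0 < cos m by apply: cos_gt0_pihalf; rewrite /m; apply/andP; split; lra.
pose r := Num.sqrt (1 + s ^+ 2); have r2 : r ^+ 2 = 1 + s ^+ 2 by exact: sqr_r.
have r0 : 0 < r by rewrite sqrtr_gt0 sqr1_gt0.
pose s3 := 2 * r * s * cos u.
have s30 : 0 < s3 by rewrite !mulr_gt0.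
pose r3 := Num.sqrt (1 + s3 ^+ 2); have r32 : r3 ^+ 2 = 1 + s3 ^+ 2 by exact: sqr_r.
have r30 : 0 < r3 by rewrite sqrtr_gt0 sqr1_gt0.
have cross : (1 + 2 * s ^+ 2) * cos u * sin m = sin u * cos m.
  have e1 : sin th = sin u * cos m + cos u * sin m.
    by rewrite -sinD; congr sin; rewrite /u /m; field.
  have e2 : sin A = sin u * cos m - cos u * sin m by rewrite -sinB um.
  have : sin th * s ^+ 2 = sin A * (1 + s ^+ 2) by rewrite sth /z divfK ?gt_eqF.
  by rewrite e1 e2; lra.
have dot : (1 + 2 * s ^+ 2) * cos u * cos m + sin u * sin m = r3.
  have d0 : 0 < (1 + 2 * s ^+ 2) * cos u * cos m + sin u * sin m.
    have : cos A = cos u * cos m + sin u * sin m by rewrite -cosB um.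
    have : 0 < s ^+ 2 * (cos u * cos m) by rewrite !mulr_gt0.
    by move=> h e; move: cA; rewrite e; lra.
  apply/eqP; rewrite -(@eqrXn2 _ 2)// ?(ltW d0) ?(ltW r30)//; apply/eqP.
  have cu2 := cos2Dsin2 u; have cm2 := cos2Dsin2 m.
  transitivity (((1 + 2 * s ^+ 2) * cos u) ^+ 2 * (cos m ^+ 2 + sin m ^+ 2) +
    sin u ^+ 2 * (cos m ^+ 2 + sin m ^+ 2) -
    ((1 + 2 * s ^+ 2) * cos u * sin m - sin u * cos m) ^+ 2); first by ring.
  rewrite cm2 cross subrr expr0n /= subr0 !mulr1 r32.
  have -> : s3 ^+ 2 = 4 * (1 + s ^+ 2) * s ^+ 2 * cos u ^+ 2 by rewrite /s3 -r2; ring.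
  have -> : sin u ^+ 2 = 1 - cos u ^+ 2 by lra.
  by ring.
have E1 : (1 + 2 * s ^+ 2) * cos u = r3 * cos m.
  rewrite -dot; have cm2 := cos2Dsin2 m.
  transitivity ((1 + 2 * s ^+ 2) * cos u * (cos m ^+ 2 + sin m ^+ 2)).
    by rewrite cm2 mulr1.
  transitivity ((1 + 2 * s ^+ 2) * cos u * cos m ^+ 2 +
    (1 + 2 * s ^+ 2) * cos u * sin m * sin m); first by ring.
  by rewrite cross; ring.
have E2 : sin u = r3 * sin m.
  rewrite -dot; have cm2 := cos2Dsin2 m.
  transitivity (sin u * (cos m ^+ 2 + sin m ^+ 2)); first by rewrite cm2 mulr1.
  transitivity (sin u * cos m * cos m + sin u * sin m ^+ 2); first by ring.
  by rewrite -cross; ring.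
have [rho rho0 rhoE] := rapidity s30.
have rhota : rho < 2 * ta.
  suff : sinh (rho / 2) < sinh ta by move=> /sinh_lt_reflect; rewrite ltr_pdivrMr// mulrC.
  rewrite rhoE; have ss := sn_lt_sinh k0 ta0; rewrite -/s in ss.
  have c2 := cosh2_sinh2 (ta / 2).
  have -> : sinh ta = 2 * cosh (ta / 2) * sinh (ta / 2).
    have {1}-> : ta = ta / 2 + ta / 2 by field.
    by rewrite /sinh /cosh opprD !expRD; field.
  have cr : r < cosh (ta / 2).
    rewrite -[ltRHS](gtr0_norm (cosh_gt0 _)) -sqrtr_sqr ltr_sqrt ?exprn_gt0 ?cosh_gt0//.
    have : s ^+ 2 < sinh (ta / 2) ^+ 2.
      by rewrite ltr_pXn2r// nnegrE ?(ltW s0)// ltW// (lt_trans s0).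
    by lra.
  have : r * s < cosh (ta / 2) * sinh (ta / 2) by apply: ltr_pM => //; exact: ltW.
  have : s3 <= 2 * (r * s).
    by rewrite /s3 -mulrA -mulrA ler_pM2l// mulrA ler_piMr ?cos_le1// mulr_ge0// ltW.
  by lra.
have [sg [sg2 [kaE sgE]]] : exists sg : R, sg ^+ 2 = 1 /\ ka = sg * k /\
    (sg = 1 \/ sg = -1).
  case: kak => ->; [exists 1|exists (-1)]; rewrite ?expr1n ?sqrrN ?expr1n ?mul1r ?mulN1r.
    by split => //; split => //; left.
  by split => //; split => //; right.
have ka2 : ka ^+ 2 = k ^+ 2 by rewrite kaE exprMn sg2 mul1r.
have omS t : 0 <= t -> om ka t = sg * om k t.
  by move=> t0; rewrite kaE; case: sgE => ->; rewrite ?mul1r ?mulN1r// om_opp.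
have csg x : cos (sg * x) = cos x by case: sgE => ->; rewrite ?mul1r ?mulN1r ?cosN.
have ssg x : sin (sg * x) = sg * sin x by case: sgE => ->; rewrite ?mul1r ?mulN1r ?sinN.
pose u' := sg * u; pose m' := sg * m.
have um' : 2 * u' - 2 * m' = 2 * hol ka ta.
  rewrite /hol omS ?(ltW ta0)// kaE.
  have -> : 2 * u' - 2 * m' = 2 * sg * A by rewrite -um /u' /m'; ring.
  by rewrite /A /hol; ring.
have tri v w : boost s v *m rotm (2 * u') *m boost s w =
    rotm m' *m boost s3 (v + w) *m rotm m'.
  apply: boost_rot_boost; rewrite /u' /m' ?csg ?ssg//.
  by rewrite -/r3 mulrCA -E2.
pose ph' := 2 * u' + ph + 2 * om ka ta.
have T1ta : 0 <= T1 - ta by rewrite subr_ge0 ltW.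
have T1p : 0 <= T1 + ta by rewrite addr_ge0 ?(ltW ta0)// T1E mulr_ge0// ltW.
have w1 : om ka (T1 - ta) = sg * pi - om ka ta.
  rewrite !omS// ?(ltW ta0)// om_sym//; first by ring.
  by rewrite (ltW ta0) (ltW taT1).
have w2 : om ka (T1 + ta) = sg * pi + om ka ta.
  by rewrite !omS// ?(ltW ta0)// (om_period k1 (ltW ta0)); ring.
have sE1 : sn (1 - ka ^+ 2) (T1 - ta) = s by rewrite ka2 /T1 (sn_sym _ k1).1.
have sE2 : sn (1 - ka ^+ 2) (T1 + ta) = - s by rewrite ka2 /T1 (sn_period _ k1).
pose et := ph' + om ka (T1 - ta) + hol ka (T1 - ta) - m' + pi.
have HI : SO0_21xR (1%:M : 'M[R]_4) by rewrite -rotm0; exact: rotm_SO.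
have H0 : reach 1%:M (1%:M *m geod ph' ka 0 (0 + mu * 0)) 0.
  by rewrite mulr0 addr0 geod0 mulmx1; apply: reach_refl.
have := reach_geod HI T1ta H0; rewrite mul1mx add0r => H1.
have := reach_chord (mu * (2 * ta)) et (geod_SO _ _ _ T1ta) rho0 rhoE H1.
have -> : geod ph' ka (T1 - ta) (mu * (T1 - ta)) *m
    (rotm (- et) *m boost s3 (mu * (2 * ta)) *m rotm et) =
    1%:M *m geod ph ka (T1 + ta) (0 + mu * (T1 + ta)).
  set v := mu * (2 * ta); set v1 := mu * (T1 - ta).
  have b3 : boost s3 v = rotm (pi - m') *m boost (- s) 0 *m rotm (2 * u' - pi) *m
      boost s v *m rotm (- m').
    have E0 : boost s 0 = rotm pi *m boost (- s) 0 *m rotm (- pi).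
      by rewrite -boost_rotpi opprK.
    have := tri 0 v; rewrite add0r => E.
    transitivity (rotm (- m') *m (rotm m' *m boost s3 v *m rotm m') *m rotm (- m')).
      by rewrite -!mulmxA rotmD subrr rotm0 mulmx1 rotmDK addNr rotm0 mul1mx.
    rewrite -E E0 !mulmxA rotmD -!mulmxA rotmDK.
    by congr (rotm _ *m (_ *m (rotm _ *m _))); ring.
  have b0 x : boost 0 v1 *m rotm x = rotm x *m boost 0 v1.
    by rewrite /boost /rotm !mx4_mul expr0n /= addr0 sqrtr1; congr mx4; ring.
  have b0s : boost 0 v1 *m boost s v = boost s (v1 + v).
    by rewrite /boost mx4_mul expr0n /= addr0 sqrtr1 expRD; congr mx4; ring.
  rewrite mul1mx add0r !geod_KAK//.
  rewrite sE1 sE2 boost_rotpi b3 -!mulmxA rotmDK rotmDK.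
  rewrite (_ : ph' + om ka (T1 - ta) + hol ka (T1 - ta) + - et + (pi - m') = 0); last first.
    by rewrite /et; ring.
  rewrite rotm0 mul1mx !mulmxA -(mulmxA _ (boost s v1)) boost_opp addr0.
  rewrite -(mulmxA _ (boost 0 v1)) b0 !mulmxA rotmD -(mulmxA _ (boost 0 v1)) b0s.
  rewrite -!mulmxA !rotmD !mulmxA rotmD.
  have -> : v1 + v = mu * (T1 + ta) by rewrite /v1 /v; ring.
  congr (_ *m _ *m _).
    by rewrite -[LHS]rotm2pi; congr rotm; rewrite /ph' w1 w2; ring.
  rewrite -[RHS]rotm2pi; congr rotm; rewrite /et /ph' [hol ka (T1 - ta)]/hol.
  rewrite [hol ka (T1 + ta)]/hol w1 w2.
  have := um'; rewrite /hol; lra.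
move=> /(reach_geod HI taT); rewrite mul1mx add0r => H.
exists (0 + Num.sqrt (1 + mu ^+ 2) * (T1 - ta - 0) +
  Num.sqrt (rho ^+ 2 + (mu * (2 * ta)) ^+ 2) +
  Num.sqrt (1 + mu ^+ 2) * (T - (T1 + ta))); last exact: H.
suff : Num.sqrt (rho ^+ 2 + (mu * (2 * ta)) ^+ 2) < Num.sqrt (1 + mu ^+ 2) * (2 * ta) by lra.
have ta20 : 0 < 2 * ta by rewrite mulr_gt0.
have {2}-> : 2 * ta = Num.sqrt ((2 * ta) ^+ 2) by rewrite sqrtr_sqr gtr0_norm.
rewrite -sqrtrM ?addr_ge0 ?sqr_ge0// ltr_sqrt; last first.
  by rewrite mulr_gt0 ?exprn_gt0// sqr1_gt0.
have : rho ^+ 2 < (2 * ta) ^+ 2 by rewrite ltr_pXn2r// nnegrE ltW.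
by lra.
Qed.

End FullTurn.

(** * Exponentials of cubic matrices *)

Section MatrixExponential.
Context {R : realType}.
Implicit Types (c t v : R).

(** A matrix with [M ^+ 3 = c *: M] has, up to scalars, only [M] and [M ^+ 2] as
    powers of positive exponent; these are their coefficients in the exponential
    series of [t *: M]. *)
Definition odd_coeff c t (k : nat) : R :=
  if odd k then c ^+ k./2 * t ^+ k / k`!%:R else 0.
Definition even_coeff c t (k : nat) : R :=
  if odd k || (k == 0)%N then 0 else c ^+ (k./2).-1 * t ^+ k / k`!%:R.

Let cvg_expR (x : R) : series (exp_coeff x) @ \oo --> expR x.
Proof. exact: is_cvg_series_exp_coeff. Qed.
Let cvg_sin (x : R) : series (sin_coeff x) @ \oo --> sin x.
Proof. by rewrite sin.unlock; exact: is_cvg_series_sin_coeff. Qed.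
Let cvg_cos (x : R) : series (cos_coeff x) @ \oo --> cos x.
Proof. by rewrite cos.unlock; exact: is_cvg_series_cos_coeff. Qed.

Lemma cvg_series_ext (a b : R^nat) (l : R) : (forall k, a k = b k) ->
  series a @ \oo --> l -> series b @ \oo --> l.
Proof. by move=> ab; have -> : a = b by apply/funext. Qed.

Let cvg_seriesD (a b : R^nat) (x y : R) : series a @ \oo --> x ->
  series b @ \oo --> y -> series (fun k => a k + b k) @ \oo --> x + y.
Proof.
move=> ax bY; have -> : series (fun k => a k + b k) = (fun n => series a n + series b n).
  by apply/funext => n; rewrite /series /= big_split.
exact: cvgD.
Qed.

Let cvg_seriesZ (a : R^nat) (r x : R) : series a @ \oo --> x ->
  series (fun k => r * a k) @ \oo --> r * x.
Proof.
move=> ax; have -> : series (fun k => r * a k) = (fun n => r * series a n).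
  by apply/funext => n; rewrite /series /= mulr_sumr.
by apply: cvgM => //; exact: cvg_cst.
Qed.

Lemma cvg_series_delta (m : nat) (x : R) :
  series (fun k => if k == m then x else 0) @ \oo --> x.
Proof.
apply: cvg_near_cst; near=> n.
have mn : (m < n)%N by near: n; exact: nbhs_infty_gt.
by rewrite /series /= big_mkord (bigD1 (Ordinal mn))//= eqxx big1 ?addr0// => i im; rewrite ifN.
Unshelve. all: by end_near. Qed.

Lemma sinh_double (x : R) : sinh (2 * x) = 2 * sinh x * cosh x.
Proof.
rewrite /sinh /cosh (_ : 2 * x = x + x); last by ring.
by rewrite opprD !expRD; field.
Qed.

Lemma cvg_odd_coeff c t :
  series (odd_coeff c t) @ \oo --> 2 * sn c t * cn c t.
Proof.
rewrite /sn /cn; case: ltgtP => c0.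
- set w := Num.sqrt c; have w0 : w != 0 by rewrite gt_eqF// sqrtr_gt0.
  have w2 : c = w ^+ 2 by rewrite sqr_sqrtr// ltW.
  have -> : 2 * (sinh (w * t / 2) / w) * cosh (w * t / 2) = w^-1 * sinh (w * t).
    rewrite [in RHS](_ : w * t = 2 * (w * t / 2)); last by field.
    by rewrite sinh_double; ring.
  rewrite /sinh (_ : _ / 2 = 2^-1 * expR (w * t) + (- 2^-1) * expR (- (w * t))); last by ring.
  have H := @cvg_seriesZ _ w^-1 _ (cvg_seriesD (@cvg_seriesZ _ 2^-1 _ (@cvg_expR (w * t)))
    (@cvg_seriesZ _ (- 2^-1) _ (@cvg_expR (- (w * t))))).
  apply: cvg_series_ext H => k; rewrite /exp_coeff /= /odd_coeff exprNn -signr_odd.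
  case: ifP => ok /=; last by rewrite expr0; ring.
  rewrite expr1 w2 -exprM exprMn.
  have -> : w ^+ k = w * w ^+ (2 * k./2) by rewrite -exprS mul2n -[in LHS](odd_double_half k) ok.
  by field; rewrite w0 /= pnatr_eq0 -lt0n fact_gt0.
- set w := Num.sqrt (- c); have w0 : w != 0 by rewrite gt_eqF// sqrtr_gt0 oppr_gt0.
  have w2 : c = - w ^+ 2 by rewrite sqr_sqrtr ?opprK// oppr_ge0 ltW.
  have -> : 2 * (sin (w * t / 2) / w) * cos (w * t / 2) = w^-1 * sin (w * t).
    rewrite [in RHS](_ : w * t = (w * t / 2) + (w * t / 2)); last by field.
    by rewrite sinD; ring.
  apply: cvg_series_ext (@cvg_seriesZ _ w^-1 _ (@cvg_sin (w * t))) => k.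
  rewrite /sin_coeff /= /odd_coeff; case: ifP => ok /=; last by rewrite !mul0r mulr0.
  rewrite w2 [(- w ^+ 2) ^+ _]exprNn -exprM exprMn.
  have -> : k.-1./2 = k./2 by rewrite -[in LHS](odd_double_half k) ok /= doubleK.
  have -> : w ^+ k = w * w ^+ (2 * k./2) by rewrite -exprS mul2n -[in LHS](odd_double_half k) ok.
  by field; rewrite w0 /= pnatr_eq0 -lt0n fact_gt0.
- have -> : 2 * (t / 2) * 1 = t by field.
  apply: cvg_series_ext (@cvg_series_delta 1 t) => k.
  rewrite /odd_coeff -c0; case: eqP => [->|k1]; first by rewrite /= expr0 mul1r expr1 divr1.
  case: ifP => // ok; rewrite expr0n; case: k k1 ok => [|[|k]] //= _ _.
  by rewrite !mul0r.
Qed.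

Lemma cvg_even_coeff c t :
  series (even_coeff c t) @ \oo --> 2 * sn c t ^+ 2.
Proof.
rewrite /sn; case: ltgtP => c0.
- set w := Num.sqrt c; have w0 : w != 0 by rewrite gt_eqF// sqrtr_gt0.
  have w2 : c = w ^+ 2 by rewrite sqr_sqrtr// ltW.
  have -> : 2 * (sinh (w * t / 2) / w) ^+ 2 = w ^- 2 * (cosh (w * t) + -1).
    rewrite [cosh _](_ : _ = cosh (w * t / 2) ^+ 2 + sinh (w * t / 2) ^+ 2).
      by have := cosh2_sinh2 (w * t / 2) => /(canRL (subrK _)) ->; field.
    have {1}-> : w * t = w * t / 2 + w * t / 2 by field.
    by rewrite /sinh /cosh opprD !expRD; field.
  rewrite /cosh (_ : _ / 2 = 2^-1 * expR (w * t) + 2^-1 * expR (- (w * t))); last by ring.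
  have H := @cvg_seriesZ _ (w ^- 2) _ (cvg_seriesD (cvg_seriesD (@cvg_seriesZ _ 2^-1 _ (@cvg_expR (w * t)))
    (@cvg_seriesZ _ (2^-1) _ (@cvg_expR (- (w * t))))) (@cvg_series_delta 0 (-1))).
  apply: cvg_series_ext H => k; rewrite /exp_coeff /= /even_coeff exprNn -signr_odd.
  case: eqP => [->|k0]; first by rewrite orbT /= !expr0 fact0; field.
  rewrite orbF; case: ifP => ok /=; first by rewrite expr1; ring.
  rewrite expr0 w2 -exprM exprMn.
  have -> : w ^+ k = w ^+ 2 * w ^+ (2 * (k./2).-1).
    rewrite -exprD; congr (_ ^+ _); rewrite -mulnS prednK ?mul2n.
      by rewrite -[in LHS](odd_double_half k) ok.
    by case: k k0 ok => [|[|k]].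
  by field; rewrite w0 /= pnatr_eq0 -lt0n fact_gt0.
- set w := Num.sqrt (- c); have w0 : w != 0 by rewrite gt_eqF// sqrtr_gt0 oppr_gt0.
  have w2 : c = - w ^+ 2 by rewrite sqr_sqrtr ?opprK// oppr_ge0 ltW.
  have -> : 2 * (sin (w * t / 2) / w) ^+ 2 = - w ^- 2 * (cos (w * t) + -1).
    rewrite [in RHS](_ : w * t = (w * t / 2) + (w * t / 2)); last by field.
    rewrite cosD; have := cos2Dsin2 (w * t / 2) => /(canRL (addrK _)) e.
    by rewrite -!expr2 e; field.
  have H := @cvg_seriesZ _ (- w ^- 2) _ (cvg_seriesD (@cvg_cos (w * t)) (@cvg_series_delta 0 (-1))).
  apply: cvg_series_ext H => k.
  rewrite /cos_coeff /= /even_coeff; case: eqP => [->|k0].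
    by rewrite orbT /= !expr0 fact0; field.
  rewrite orbF; case: ifP => ok /=; first by rewrite !mul0r; ring.
  have kE : k./2 = (k./2).-1.+1 by rewrite prednK//; case: k k0 ok => [|[|k]].
  rewrite w2 [(- w ^+ 2) ^+ _]exprNn -exprM exprMn {1}kE -exprnP [(-1) ^+ _.+1]exprS.
  have -> : w ^+ k = w ^+ 2 * w ^+ (2 * (k./2).-1).
    rewrite -exprD; congr (_ ^+ _); rewrite -mulnS -kE mul2n.
    by rewrite -[in LHS](odd_double_half k) ok.
  by field; rewrite w0 /= pnatr_eq0 -lt0n fact_gt0.
- have -> : 2 * (t / 2) ^+ 2 = t ^+ 2 / 2 by field.
  apply: cvg_series_ext (@cvg_series_delta 2 (t ^+ 2 / 2)) => k.
  rewrite /even_coeff -c0; case: eqP => [->|k2]; first by rewrite /= expr0 mul1r.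
  case: ifP => // /negbT; rewrite negb_or => /andP[ok k0].
  rewrite expr0n; case: k k2 ok k0 => [|[|[|[|k]]]] //= _ _ _.
  by rewrite !mul0r.
Qed.

(** [P] is a projector annihilated by [M] on both sides, so that the two
    summands act on complementary subspaces. *)
Lemma mxexp_cubic (M P : 'M[R]_4) c t v :
  M ^+ 3 = c *: M -> M * P = 0 -> P * M = 0 -> P * P = P ->
  mxexp (t *: M + v *: P) =
  (1 - P) + (2 * sn c t * cn c t) *: M + (2 * sn c t ^+ 2) *: M ^+ 2 + expR v *: P.
Proof.
move=> M3 MP PM PP; set A := t *: M + v *: P.
pose o k : R := if odd k then c ^+ k./2 * t ^+ k else 0.
pose b k : R := if odd k || (k == 0)%N then 0 else c ^+ (k./2).-1 * t ^+ k.
pose d k : R := if (k == 0)%N then 1 else 0.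
have oS k : o k.+1 = d k * t + c * t * b k.
  rewrite /o /b /d /=; case: eqP => [->|k0]; first by rewrite /= expr0 expr1; ring.
  rewrite orbF; case ok: (odd k) => /=; first by ring.
  have kE : k./2 = (k./2).-1.+1 by rewrite prednK//; case: k k0 ok => [|[|k]].
  by rewrite uphalf_half ok add0n {1}kE !exprS; ring.
have bS k : b k.+1 = t * o k.
  rewrite /o /b /= orbF; case ok: (odd k) => /=; last by rewrite mulr0.
  by rewrite uphalf_half ok /= exprS; ring.
have AE k : A ^+ k = d k *: (1 - P) + o k *: M + b k *: M ^+ 2 + v ^+ k *: P.
  elim: k => [|k IH].
    by rewrite /d /o /b /= !scale0r !addr0 expr0 !scale1r subrK.
  rewrite exprSr IH oS bS /A {1}/d /=.
  have PA : (1 - P) * (t *: M + v *: P) = t *: M.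
    by rewrite mulrBl mul1r mulrDr -!scalerAr PM PP scaler0 add0r addrK.
  have MA : M * (t *: M + v *: P) = t *: M ^+ 2.
    by rewrite mulrDr -!scalerAr MP scaler0 addr0 expr2.
  have M2A : M ^+ 2 * (t *: M + v *: P) = (t * c) *: M.
    by rewrite expr2 -mulrA MA -scalerAr -exprS M3 scalerA.
  have PA' : P * (t *: M + v *: P) = v *: P.
    by rewrite mulrDr -!scalerAr PM PP scaler0 add0r.
  rewrite !mulrDl -!scalerAl PA MA M2A PA' !scalerA [v ^+ k.+1]exprSr scale0r add0r -/(d k).
  rewrite (_ : b k * (t * c) = c * t * b k); last by ring.
  rewrite (_ : o k * t = t * o k); last by ring.
  rewrite (_ : (c * t) *: b k = c * t * b k) //.
  by rewrite [in RHS]scalerDl -!addrA; congr (_ + _); rewrite addrCA.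
rewrite /mxexp; apply: cvg_lim; first exact: norm_hausdorff.
have -> : series (fun k : nat => (k`!%:R : R)^-1 *: A ^+ k) = (fun n =>
   series (fun k => if k == 0%N then 1 else 0) n *: (1 - P) + series (odd_coeff c t) n *: M +
   series (even_coeff c t) n *: M ^+ 2 + series (exp_coeff v) n *: P).
  apply/funext => n; rewrite /series /= !scaler_suml -!big_split /=.
  apply: eq_bigr => k _; rewrite AE 3!scalerDr !scalerA.
  congr (_ + _ + _ + _); congr (_ *: _).
  - by rewrite /d; case: eqP => [->|_]; rewrite ?mulr0// fact0 invr1 mulr1.
  - by rewrite /o /odd_coeff; case: ifP; rewrite ?mulr0// mulrC.
  - by rewrite /b /even_coeff; case: ifP; rewrite ?mulr0// mulrC.
  - by rewrite mulrC.
apply: cvgD; last by apply: cvgZr_tmp; exact: @cvg_expR.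
apply: cvgD; last by apply: cvgZr_tmp; exact: @cvg_even_coeff.
apply: cvgD; last by apply: cvgZr_tmp; exact: @cvg_odd_coeff.
by rewrite -[X in _ --> X]scale1r; apply: cvgZr_tmp; exact: @cvg_series_delta.
Qed.

End MatrixExponential.

(** * The geodesics as products of exponentials *)

Section ExponentialFormula.
Context {R : realType}.
Implicit Types (a t v ph ka th : R).

Lemma mx4D a b c d e f p q r w a' b' c' d' e' f' p' q' r' w' :
  mx4 a b c d e f p q r w + mx4 a' b' c' d' e' f' p' q' r' w' =
  mx4 (a + a') (b + b') (c + c') (d + d') (e + e') (f + f') (p + p') (q + q')
    (r + r') (w + w') :> 'M[R]_4.
Proof.
apply/matrixP => i j; rewrite !mxE.
by case: (ord4P i) => ->; case: (ord4P j) => -> /=; rewrite ?addr0.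
Qed.

Lemma mx4Z x a b c d e f p q r w : x *: mx4 a b c d e f p q r w =
  mx4 (x * a) (x * b) (x * c) (x * d) (x * e) (x * f) (x * p) (x * q) (x * r)
    (x * w) :> 'M[R]_4.
Proof.
apply/matrixP => i j; rewrite !mxE.
by case: (ord4P i) => ->; case: (ord4P j) => -> /=; rewrite ?mulr0.
Qed.

Lemma e2E : e2 = mx4 0 0 0 0 0 0 0 0 0 1 :> 'M[R]_4.
Proof.
by have := control_mxE (0 : R) 1 0; rewrite !scale0r scale1r addr0 add0r.
Qed.

Lemma e4E : e4 = mx4 0 0 0 0 0 (-1) 0 1 0 0 :> 'M[R]_4.
Proof.
apply/matrixP => i j; rewrite !mxE.
by case: (ord4P i) => ->; case: (ord4P j) => -> /=;
  rewrite ?mulr1n ?mulr0n ?subr0 ?sub0r ?opprK ?oppr0.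
Qed.

Lemma mx_cube (A : 'M[R]_4) : A ^+ 3 = A *m (A *m A).
Proof. by rewrite !exprS expr0 mulr1. Qed.

Lemma mulmx_mx4 (A B : 'M[R]_4) : A * B = A *m B. Proof. by []. Qed.

Lemma mxexp_mx4 a b c d e f p q r k t v : let M := mx4 a b c d e f p q r 0 in
  M ^+ 3 = k *: M ->
  mxexp (t *: M + v *: e2) = mx4 1 0 0 0 1 0 0 0 1 (expR v) +
    (2 * sn k t * cn k t) *: M + (2 * sn k t ^+ 2) *: (M *m M).
Proof.
move=> M M3; rewrite (@mxexp_cubic R M e2 k t v M3); first last.
- by rewrite e2E mulmx_mx4 mx4_mul; congr mx4; ring.
- by rewrite e2E mulmx_mx4 mx4_mul -(scale0r 1%:M) mx4_1 mx4Z; congr mx4; ring.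
- by rewrite e2E mulmx_mx4 mx4_mul -(scale0r 1%:M) mx4_1 mx4Z; congr mx4; ring.
rewrite [M ^+ 2]expr2 mulmx_mx4 e2E (_ : 1 = 1%:M)// /M mx4_1 -scaleN1r !mx4_mul !mx4Z !mx4D.
by congr mx4; ring.
Qed.

Lemma mxexp_e4 th : mxexp (- th *: e4) = rotm th.
Proof.
rewrite -[X in mxexp X]addr0 -(scale0r e2) e4E (@mxexp_mx4 _ _ _ _ _ _ _ _ _ (-1)).
  rewrite mx4_mul !mx4Z !mx4D expR0 /rotm /sn /cn ltr0N1 oppr_lt0 ltr01 opprK sqrtr1.
  rewrite (_ : 1 * - th / 2 = - (th / 2)); last by field.
  rewrite sinN cosN divr1 sqrrN.
  have cE : cos th = cos (th / 2 + th / 2) by congr cos; field.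
  have sE : sin th = sin (th / 2 + th / 2) by congr sin; field.
  rewrite cE sE cosD sinD; have := cos2Dsin2 (th / 2) => cs.
  by congr mx4; lra.
by rewrite mx_cube !mx4_mul mx4Z; congr mx4; ring.
Qed.

Lemma mxexp_helix ph ka t v :
  mxexp (t *: (sin ph *: e1 + cos ph *: e3 + ka *: e4) + v *: e2) =
  rotm (- ph) *m (helix ka t v *m rotm ph).
Proof.
have -> : sin ph *: e1 + cos ph *: e3 + ka *: e4 =
   mx4 0 (cos ph) (sin ph) (cos ph) 0 (- ka) (sin ph) ka 0 0 :> 'M[R]_4.
  have := control_mxE (sin ph) 0 (cos ph); rewrite scale0r addr0 => ->.
  by rewrite e4E mx4Z mx4D; congr mx4; ring.
have := cos2Dsin2 ph => cs.
rewrite (@mxexp_mx4 _ _ _ _ _ _ _ _ _ (1 - ka ^+ 2)); last first.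
  rewrite mx_cube !mx4_mul mx4Z; move: (cos ph) (sin ph) cs => C D cs.
  have H z : (C ^+ 2 + D ^+ 2) * z = z by rewrite cs mul1r.
  by have H1 := H C; have H2 := H D; have H3 := H ka; congr mx4; lra.
rewrite /helix /rotm cosN sinN !mx4_mul !mx4Z !mx4D.
move: (cos ph) (sin ph) (sn _ _) (cn _ _) cs => C D s h cs.
have H z : (C ^+ 2 + D ^+ 2) * z = z by rewrite cs mul1r.
have H1 := H (s ^+ 2); have H2 := H (s ^+ 2 * ka ^+ 2); have H3 := H (s * h * ka).
by congr mx4; lra.
Qed.

Lemma gamma2E ph alpha2 beta t : alpha2 ^+ 2 < 1 ->
  let a := Num.sqrt (1 - alpha2 ^+ 2) in
  gamma2 ph alpha2 beta t = geod ph (beta / a) (a * t) (alpha2 * t).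
Proof.
move=> h a; have a0 : a != 0 by rewrite gt_eqF// sqrtr_gt0 subr_gt0.
rewrite /gamma2 -/a mxexp_e4.
have -> : t *: ((a * sin ph) *: e1 + alpha2 *: e2 + (a * cos ph) *: e3 + beta *: e4)
  = (a * t) *: (sin ph *: e1 + cos ph *: e3 + (beta / a) *: e4) + (alpha2 * t) *: e2
     :> 'M[R]_4.
  move: e1 e2 e3 e4 => E1 E2 E3 E4; rewrite !scalerDr !scalerA [RHS]addrAC; congr (_ + _); last first.
    by congr (_ *: _); field.
  rewrite [RHS]addrAC.
  by congr (_ + _ + _); congr (_ *: _); ring.
rewrite mxexp_helix /geod -!mulmxA rotmD; congr (_ *m (_ *m rotm _)).
by field.
Qed.

End ExponentialFormula.

(** * Uniqueness of the controls *)

Section ControlsUnique.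
Context {R : realType}.
Notation mu := (@lebesgue_measure R).
Implicit Types (f : R -> R) (S : R).

(** By the Lebesgue differentiation theorem for the extension of [f] by zero. *)
Lemma primitive0_ae S f : mu.-integrable `[0, S] (EFin \o f) ->
  (forall t, 0 <= t <= S -> primitive f t = 0) ->
  {ae mu, forall x, 0 <= x <= S -> f x = 0}.
Proof.
move=> fI f0; pose h := f \_ `[0, S].
have hI : mu.-integrable setT (EFin \o h).
  by have /(@integrable_mkcond _ _ _ mu)/= := fI; rewrite restrict_EFin; apply.
(* the integral starts at [-1] because differentiation is available at interior
   points only *)
have hF y : \int[mu]_(t in [set` Interval (BLeft (-1)) (BRight y)]) h t = 0.
  rewrite -Rintegral_mkcondr.
  have [S0|S0] := ltP S 0.
    have -> : `[0, S]%classic = set0 :> set R by rewrite set_itv_ge// bnd_simp -ltNge.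
    by rewrite setI0 Rintegral_set0.
  have [y0|y0] := ltP y 0.
    rewrite (_ : _ `&` _ = set0) ?Rintegral_set0// -subset0 => x /=.
    rewrite !in_itv /= => -[/andP[_ xy] /andP[x0 _]].
    by have := lt_le_trans y0 (le_trans x0 xy); rewrite ltxx.
  have m1 x : 0 <= x -> -1 <= x :> R by apply: le_trans; rewrite oppr_le0 ler01.
  have [yS|/ltW Sy] := leP y S.
    rewrite (_ : _ `&` _ = `[0, y]%classic); first by apply: f0; rewrite y0.
    apply/seteqP; split => x /=; rewrite !in_itv /=.
      by move=> [/andP[_ ->] /andP[-> _]].
    by move=> /andP[x0 xy]; rewrite x0 xy m1// (le_trans xy yS).
  rewrite (_ : _ `&` _ = `[0, S]%classic); first by apply: f0; rewrite S0 lexx.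
  apply/seteqP; split => x /=; rewrite !in_itv /=; first by case.
  by move=> /andP[x0 xS]; rewrite x0 xS m1// (le_trans xS Sy).
have hIy y : mu.-integrable [set` Interval (BLeft (-1)) (BRight y)] (EFin \o h).
  by apply: integrableS hI.
have := @FTC1 R h (BLeft (-1)) hIy (open_integrable_locally openT hI).
apply: filterS; first exact: (ae_filter_ringOfSetsType mu).
move=> x /= H xS.
have [|_] := H; first by rewrite lte_fin; case/andP: xS => x0 _; lra.
have -> : (fun x0 => \int[mu]_(t in `[-1, x0]) h t) = cst 0 by apply/funext => y; exact: hF.
by rewrite derive1_cst /h patchE mem_set//= in_itv.
Qed.

(** Three entries of the differential equation have the form
    [(g i j)' = u * g m n] with [g m n] nonzero, so [g] determines its controls
    almost everywhere. Hence the length of a shortest arc is that of its explicit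
    parametrization, whichever controls witness it. *)
Lemma control_length_unique S g u1 u2 u3 v1 v2 v3 : 0 <= S ->
  horizontal S g u1 u2 u3 -> horizontal S g v1 v2 v3 ->
  control_length S u1 u2 u3 = control_length S v1 v2 v3.
Proof.
move=> S0 hu hv.
have [gG _ [u1I u2I u3I] gu] := hu; have [_ _ [v1I v2I v3I] gv] := hv.
have key i j (w z : R -> R) m n :
   (forall s, (g s *m (u1 s *: e1 + u2 s *: e2 + u3 s *: e3)) i j = w s * g s m n) ->
   (forall s, (g s *m (v1 s *: e1 + v2 s *: e2 + v3 s *: e3)) i j = z s * g s m n) ->
   (forall s, 0 <= s <= S -> g s m n != 0) ->
   {ae mu, forall x, 0 <= x <= S -> w x = z x}.
  move=> Ew Ez g0.
  have uI := horizontal_integrand_integrable hu i j.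
  have vI := horizontal_integrand_integrable hv i j.
  have : {ae mu, forall x, 0 <= x <= S -> (g x *m (u1 x *: e1 + u2 x *: e2 + u3 x *: e3)) i j
      - (g x *m (v1 x *: e1 + v2 x *: e2 + v3 x *: e3)) i j = 0}.
    apply: (@primitive0_ae _ (fun x => (g x *m (u1 x *: e1 + u2 x *: e2 + u3 x *: e3)) i j
      - (g x *m (v1 x *: e1 + v2 x *: e2 + v3 x *: e3)) i j)).
      by apply: eq_integrable (integrableB _ uI vI).
    move=> t /andP[t0 tS]; rewrite /primitive RintegralB//.
    - have tSS : 0 <= t <= S by rewrite t0.
      by have := gu t tSS i j; rewrite (gv t tSS i j) => /addrI <-; rewrite subrr.
    - apply: integrableS uI => //; apply: subset_itvl; by rewrite bnd_simp.
    - apply: integrableS vI => //; apply: subset_itvl; by rewrite bnd_simp.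
  apply: filterS; first exact: (ae_filter_ringOfSetsType mu).
  move=> x /= H xS; have := H xS; rewrite Ew Ez -mulrBl => /eqP.
  by rewrite mulf_eq0 subr_eq0 (negPf (g0 x xS)) orbF => /eqP.
have g00 s : 0 <= s <= S -> g s 0 0 != 0.
  by move=> sS; have [h _ _ _] := horizontal_entries hu sS; rewrite gt_eqF// (lt_le_trans ltr01).
have g33 s : 0 <= s <= S -> g s 3 3 != 0.
  move=> sS; have [a [b [c [d [e [f [p [q [r [v [_ ->]]]]]]]]]]] := SO0_21xRE (gG s sS).
  by rewrite mx4E gt_eqF// expR_gt0.
have E1 := key 0 2 u1 v1 0 0 (fun s => let: And4 _ _ h _ := mul_control (g s) (u1 s) (u2 s) (u3 s) 0 in h)
  (fun s => let: And4 _ _ h _ := mul_control (g s) (v1 s) (v2 s) (v3 s) 0 in h) g00.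
have E2 := key 3 3 u2 v2 3 3 (fun s => let: And4 _ _ _ h := mul_control (g s) (u1 s) (u2 s) (u3 s) 3 in h)
  (fun s => let: And4 _ _ _ h := mul_control (g s) (v1 s) (v2 s) (v3 s) 3 in h) g33.
have E3 := key 0 1 u3 v3 0 0 (fun s => let: And4 _ h _ _ := mul_control (g s) (u1 s) (u2 s) (u3 s) 0 in h)
  (fun s => let: And4 _ h _ _ := mul_control (g s) (v1 s) (v2 s) (v3 s) 0 in h) g00.
apply: ae_eq_integral => //.
- by apply: (measurable_int mu); exact: speed_integrable hu.
- by apply: (measurable_int mu); exact: speed_integrable hv.
apply: filterS3 E1 E2 E3; first exact: (ae_filter_ringOfSetsType mu).
move=> x /= H1 H2 H3; rewrite in_itv /= => xS;
by rewrite H1// H2// H3.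
Qed.

End ControlsUnique.

(** * The cut time of a geodesic *)

Section Gamma2.
Context {R : realType}.
Variables ph alpha2 beta : R.
Hypothesis alpha2_lt1 : alpha2 ^+ 2 < 1.
Hypothesis beta0 : beta != 0.
Let a := Num.sqrt (1 - alpha2 ^+ 2).
Let ka := beta / a.
Let k := `|beta| / a.
Let gam := gamma2 ph alpha2 beta.

Let a0 : 0 < a. Proof. by rewrite sqrtr_gt0 subr_gt0. Qed.
Let a2 : a ^+ 2 = 1 - alpha2 ^+ 2. Proof. by rewrite sqr_sqrtr// subr_ge0 ltW. Qed.
Let k0 : 0 < k. Proof. by rewrite divr_gt0// normr_gt0. Qed.

Let ka_k : ka = k \/ ka = - k.
Proof.
by rewrite /ka /k; case: (ger0P beta) => _; [left|right; rewrite mulNr opprK].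
Qed.

Let ka2 : ka ^+ 2 = k ^+ 2.
Proof. by case: ka_k => ->; rewrite ?sqrrN. Qed.

Lemma gamma2_smooth : exists u1 u2 u3, smooth_horizontal gam u1 u2 u3 /\
  forall t, u1 t ^+ 2 + u2 t ^+ 2 + u3 t ^+ 2 = 1 ^+ 2.
Proof.
have one_SO : SO0_21xR (1%:M : 'M[R]_4) by rewrite -rotm0; exact: rotm_SO.
have := smooth_affine 0 a (geod_smooth ph ka 0 (alpha2 / a) one_SO).
set g := (fun t : R => 1%:M *m _) => sg.
have -> : gam = g.
  apply/funext => t; rewrite /g mul1mx /gam gamma2E// !add0r -/a -/ka.
  by congr (geod _ _ _ _); field; rewrite gt_eqF.
do 3 eexists; split; first exact: sg.
move=> t /=; have := cos2Dsin2 (ph + ka * (0 + a * t)) => cs.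
transitivity (a ^+ 2 * (cos (ph + ka * (0 + a * t)) ^+ 2 + sin (ph + ka * (0 + a * t)) ^+ 2)
  + alpha2 ^+ 2); first by field; rewrite gt_eqF.
by rewrite cs a2; ring.
Qed.

Lemma gamma2_0 : gam 0 = 1%:M.
Proof. by rewrite /gam gamma2E// !mulr0 geod0. Qed.

Lemma gamma2_has_length T : 0 <= T -> has_length T gam T%:E.
Proof.
move=> T0; have [u1 [u2 [u3 [sg speed]]]] := gamma2_smooth.
exists u1, u2, u3; split; first exact: smooth_is_horizontal.
by rewrite (smooth_length T0 ler01 speed) mul1r.
Qed.

Lemma gamma2_length T l : 0 <= T -> has_length T gam l -> l = T%:E.
Proof.
move=> T0 [v1 [v2 [v3 [hv ->]]]]; have [u1 [u2 [u3 [hu ->]]]] := gamma2_has_length T0.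
exact: (control_length_unique T0 hv hu).
Qed.

Lemma rho2_gamma2_le T : 0 <= T -> (rho2 (gam 0) (gam T) <= T%:E)%E.
Proof.
move=> T0; apply: ereal_inf_lbound; exists T, gam; split => //.
exact: gamma2_has_length.
Qed.

Lemma gamma2_entries T : 0 <= T -> let g := gam T in
  let s := sn (1 - k ^+ 2) (a * T) in
  [/\ g 0 0 = 1 + 2 * s ^+ 2,
      g 1 1 + g 2 2 = (1 + g 0 0) * cos (hol k (a * T)) &
      g 3 3 = expR (alpha2 * T)].
Proof.
move=> T0 /=; have aT0 : 0 <= a * T by rewrite mulr_ge0// ltW.
rewrite /gam gamma2E// -/a -/ka geod_KAK// ka2.
set s := sn _ _; set A := ph + _.
have -> : cos (hol k (a * T)) = cos (hol ka (a * T)).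
  by have kN := hol_opp k aT0; case: ka_k => ->; rewrite ?kN ?cosN.
move: (hol _ _) => h; rewrite /rotm /boost !mx4_mul !mx4E; split; try ring.
have -> : cos h = cos (A + h) * cos A + sin (A + h) * sin A.
  by rewrite -cosB; congr cos; ring.
by rewrite cosN sinN; ring.
Qed.

(** With [a ^+ 2 + alpha2 ^+ 2 = 1], the projection of the geodesic has length
    [a * T] and its vertical coordinate is [alpha2 * T]. Any curve with the same
    end point has a projection of length at least [a * T] and the same vertical
    coordinate, hence length at least [a * (a * T) + alpha2 * (alpha2 * T)]. *)
Lemma gamma2_optimal T : 0 < T -> (1 < k -> a * T <= 2 * pi / kap k) ->
  hol k (a * T) <= pi -> rho2 (gam 0) (gam T) = T%:E.
Proof.
move=> T0 Tk hT; apply/eqP; rewrite eq_le rho2_gamma2_le ?(ltW T0)//=.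
apply: le_ereal_inf_tmp => _ [S [g [S0 g0 gS [u1 [u2 [u3 [hg ->]]]]]]].
rewrite gamma2_0 in g0.
have [E0 E1 E3] := gamma2_entries (ltW T0); rewrite -gS in E0 E1 E3.
have aT0 : 0 < a * T by rewrite mulr_gt0.
have H1 := horizontal_length_ge S0 hg g0 k0 aT0 Tk hT E0 E1.
have H2 := horizontal_vertical S0 hg g0; rewrite E3 expRK in H2.
have ab : a ^+ 2 + alpha2 ^+ 2 = 1 by rewrite a2 subrK.
have := control_length_ge hg (ltW a0) ab; apply: le_trans.
rewrite lee_fin -H2.
have : a * (a * T) <= a * arc_length u1 u3 S by rewrite ler_pM2l.
have -> : a * (a * T) = T - alpha2 * (alpha2 * T).
  by transitivity (a ^+ 2 * T); [ring|rewrite a2; ring].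
by lra.
Qed.

Lemma gamma2_not_optimal T : 0 < T ->
  ((1 < k -> a * T <= 2 * pi / kap k) /\ pi < hol k (a * T)) \/
  (1 < k /\ 2 * pi / kap k < a * T) ->
  (rho2 (gam 0) (gam T) < T%:E)%E.
Proof.
move=> T0 H; have aT0 : 0 < a * T by rewrite mulr_gt0.
pose mu := alpha2 / a.
have speed : Num.sqrt (1 + mu ^+ 2) * (a * T) = T.
  have -> : 1 + mu ^+ 2 = (a^-1) ^+ 2.
    transitivity ((a ^+ 2 + alpha2 ^+ 2) * a^-1 ^+ 2); last by rewrite a2 subrK mul1r.
    by rewrite /mu; field; rewrite gt_eqF.
  by rewrite sqrtr_sqr ger0_norm ?invr_ge0 ?(ltW a0)//; field; rewrite gt_eqF.
have : exists2 l, l < Num.sqrt (1 + mu ^+ 2) * (a * T) &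
    reach 1%:M (geod ph ka (a * T) (mu * (a * T))) l.
  case: H => -[H1 H2]; first exact: shortcut_holonomy ka_k aT0 H1 H2.
  exact: shortcut_full_turn H1 ka_k H2.
rewrite speed => -[l lT /rho2_le].
have -> : geod ph ka (a * T) (mu * (a * T)) = gam T.
  rewrite /gam gamma2E// -/a -/ka; congr geod; rewrite /mu; field.
  by rewrite gt_eqF.
by rewrite -gamma2_0 => /le_lt_trans; apply; rewrite lte_fin.
Qed.

(** A noncontinuable shortest arc is not shorter than the cut time, or the
    geodesic itself would continue it; it is not longer, or there would be a
    shortcut. *)
Lemma cut_time T Tc : 0 < T -> noncontinuable_shortest_arc T gam -> 0 < Tc ->
  (1 < k -> a * Tc <= 2 * pi / kap k) -> hol k (a * Tc) <= pi ->
  hol k (a * Tc) = pi \/ (1 < k /\ a * Tc = 2 * pi / kap k) -> T = Tc.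
Proof.
move=> T0 [shT ncT] Tc0 Tck hTc H; have [TTc|TcT|//] := ltgtP T Tc.
  exfalso; apply: ncT; exists Tc, gam; split => //.
    by rewrite /shortest_arc gamma2_optimal//; exact/gamma2_has_length/ltW.
  rewrite [ltRHS]gamma2_optimal//; apply: le_lt_trans (rho2_gamma2_le (ltW T0)) _.
  by rewrite lte_fin.
have := gamma2_length (ltW T0) shT => E.
suff : (rho2 (gam 0) (gam T) < T%:E)%E by rewrite E ltxx.
apply: gamma2_not_optimal => //.
have aTcT : a * Tc < a * T by rewrite ltr_pM2l.
case: H => [H|[k1 H]]; last by right; split=> //; rewrite -H.
have [k1|k1] := ltP 1 k; last first.
  left; split => //; rewrite -H; apply: hol_increasing => //.
    by rewrite mulr_ge0// ltW.
  by rewrite ltNge k1.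
have [aT|aT] := leP (a * T) (2 * pi / kap k); last by right.
left; split => //; rewrite -H; apply: hol_increasing => //.
by rewrite mulr_ge0// ltW.
Qed.

End Gamma2.

(** * The cut time as a function of the curvature *)

Section CutTimes.
Context {R : realType}.
Implicit Types (k x lo hi : R).

Lemma hol_reaches_pi k lo hi : 0 < k -> 0 <= lo -> lo < hi ->
  hol k lo < pi -> pi < hol k hi -> exists2 x, lo < x < hi & hol k x = pi.
Proof.
move=> k0 lo0 lohi Hlo Hhi.
have C : {within `[lo, hi], continuous (hol k)}.
  have := hol_continuous (k := k) (t := hi); apply: continuous_subspaceW => x /=.
  by rewrite !in_itv /= => /andP[lx ->]; rewrite (le_trans lo0 lx).
have /(IVT (ltW lohi) C)[x] : Num.min (hol k lo) (hol k hi) <= pi <= Num.max (hol k lo) (hol k hi).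
  by rewrite ge_min le_max (ltW Hlo) (ltW Hhi) orbT.
rewrite in_itv /= => /andP[lx xh] E; exists x => //.
rewrite !lt_neqAle lx xh !andbT; apply/andP; split; apply/eqP => F.
  by move: Hlo; rewrite F E ltxx.
by move: Hhi; rewrite -F E ltxx.
Qed.

(** [om] is less than [pi / 2] exactly as long as [cn], a positive multiple of
    its cosine, is positive. *)
Lemma om_lt_half k x : 0 < k -> 0 < x -> (1 < k -> x < pi / kap k) ->
  om k x < pi / 2.
Proof.
move=> k0 x0 xk; have xk2 : 1 < k -> x < 2 * pi / kap k.
  by move=> k1; apply: lt_le_trans (xk k1) (half_le_full k1).
have /andP[om0p ompi] := om_strict k0 x0 xk2.
have cn0 : 0 < cn (1 - k ^+ 2) x.
  have [k1|k1] := ltP 1 k; last exact: cn_gt0.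
  have [_ ->] := sn_cn_circle x k1; apply: cos_gt0_pihalf.
  have kp := kap_gt0 k1; have := xk k1; rewrite ltr_pdivlMr// => h.
  have p0 := pi_gt0 R; have : 0 < x * kap k by rewrite mulr_gt0.
  by move=> h'; apply/andP; split; lra.
have [E _] := om_cos_sin k (ltW x0); move: cn0; rewrite E => cn0.
rewrite ltNge; apply/negP => oh; move: cn0; rewrite ltNge => /negP; apply.
have -> : cos (om k x) = - cos (pi - om k x) by rewrite cosB cospi sinpi; ring.
rewrite mulrN oppr_le0 mulr_ge0// ?sqrtr_ge0//.
by apply: cos_ge0_pihalf; apply/andP; split; lra.
Qed.

Lemma om_gt_half k x : 1 < k -> pi / kap k < x -> x < 2 * pi / kap k ->
  pi / 2 < om k x.
Proof.
move=> k1 xl xh; have kp := kap_gt0 k1; have p0 := pi_gt0 R.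
have x0 : 0 < x by apply: lt_trans xl; rewrite divr_gt0.
have k0 : 0 < k by lra.
have xle : 0 <= x <= 2 * pi / kap k by rewrite !ltW.
have := om_sym k1 xle.
have : om k (2 * pi / kap k - x) < pi / 2.
  by apply: om_lt_half; [exact: k0|lra|move=> _; lra].
by lra.
Qed.

Lemma pi_quotient_lt (a b p q : R) : 0 < p -> 0 < q -> a * q < b * p ->
  a * pi / p < b * pi / q.
Proof.
move=> p0 q0 h; rewrite ltr_pdivrMr// mulrAC ltr_pdivlMr//.
by rewrite mulrAC [ltRHS]mulrAC ltr_pM2r ?pi_gt0.
Qed.

(** [hol] equals [pi - 2 * om] at [pi / k] and [2 * pi - 2 * om] at
    [2 * pi / k]. The latter exceeds [pi] as long as the arc of length
    [2 * pi / k] is less than half a circle, that is, [2 * kap k < k]. *)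
Lemma cut_time_first_interval k : 0 < k -> (1 < k -> k ^+ 2 < 4 / 3) ->
  exists2 x, pi / k < x < 2 * pi / k &
    hol k x = pi /\ (1 < k -> x <= pi / kap k).
Proof.
move=> k0 k43; have p0 := pi_gt0 R.
have kp : 1 < k -> 2 * pi / k < pi / kap k.
  move=> k1; have K := kap_gt0 k1; have K2 := kap2 (ltW k1).
  rewrite -[pi in ltRHS]mul1r; apply: pi_quotient_lt => //.
  by have := k43 k1; nra.
have q0 : 0 < pi / k by rewrite divr_gt0.
have q2 : 2 * pi / k = 2 * (pi / k) by rewrite mulrA.
have kq : k * (pi / k) = pi by field; rewrite gt_eqF.
have [|||||x xI Hx] := @hol_reaches_pi k (pi / k) (2 * pi / k) => //.
- exact: ltW.
- by rewrite q2; lra.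
- rewrite /hol kq.
  have /andP[] : 0 < om k (pi / k) < pi.
    apply: om_strict => // k1; have := kp k1; have := kap_gt0 k1 => K.
    by rewrite q2 -[X in _ -> _ < X]mulrA; lra.
  by lra.
- rewrite /hol; have : om k (2 * pi / k) < pi / 2.
    by apply: om_lt_half => //; rewrite q2; lra.
  by rewrite q2; lra.
exists x => //; split => // k1; have := kp k1; move/andP: xI => []; lra.
Qed.

(** Now the arc of length [2 * pi / k] is more than half a circle, and the arc
    of length [3 * pi / k] is still less than a full circle. *)
Lemma cut_time_second_interval k : 1 < k -> 4 / 3 < k ^+ 2 -> k ^+ 2 < 9 / 5 ->
  exists2 x, 2 * pi / k < x < 3 * pi / k &
    hol k x = pi /\ x <= 2 * pi / kap k.
Proof.
move=> k1 kl kh; have p0 := pi_gt0 R; have k0 : 0 < k by lra.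
have K := kap_gt0 k1; have K2 := kap2 (ltW k1).
have q0 : 0 < pi / k by rewrite divr_gt0.
have q2 z : z * pi / k = z * (pi / k) by rewrite mulrA.
have Q2 z : z * pi / kap k = z * (pi / kap k) by rewrite mulrA.
have kq : k * (pi / k) = pi by field; rewrite gt_eqF.
have Kq : kap k * (pi / kap k) = pi by field; rewrite gt_eqF.
have Q0 : 0 < pi / kap k by rewrite divr_gt0.
have h1 : pi / kap k < 2 * pi / k.
  by rewrite -[pi in ltLHS]mul1r; apply: pi_quotient_lt => //; nra.
have h2 : 3 * pi / k < 2 * pi / kap k by apply: pi_quotient_lt => //; nra.
rewrite !q2 !Q2 in h1 h2.
have [|||||x xI Hx] := @hol_reaches_pi k (2 * pi / k) (3 * pi / k) => //.
- by rewrite q2; lra.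
- by rewrite !q2; lra.
- rewrite /hol; have : pi / 2 < om k (2 * pi / k).
    by apply: om_gt_half => //; rewrite q2 ?Q2; lra.
  by rewrite q2; lra.
- rewrite /hol; have /andP[] : 0 < om k (3 * pi / k) < pi.
    by apply: om_strict => //; [rewrite q2; lra|rewrite q2 Q2].
  by rewrite q2; lra.
exists x => //; split => //; rewrite Q2; move: xI; rewrite !q2 => /andP[]; lra.
Qed.

Lemma hol_half_turn k : 1 < k -> k ^+ 2 = 4 / 3 ->
  2 * pi / k = pi / kap k /\ hol k (2 * pi / k) = pi.
Proof.
move=> k1 kE; have K := kap_gt0 k1; have K2 := kap2 (ltW k1).
have E : k = 2 * kap k by nra.
have e : 2 * pi / k = pi / kap k by rewrite [in LHS]E; field; rewrite gt_eqF.
split=> //; rewrite e /hol (half_turn k1).2 {1}E; field.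
by rewrite gt_eqF.
Qed.

(** The full circle encloses the area [2 * pi * (k / kap k - 1)]. *)
Lemma hol_full_turn_le k : 1 < k -> 9 / 5 <= k ^+ 2 ->
  hol k (2 * pi / kap k) <= pi.
Proof.
move=> k1 kE; have K := kap_gt0 k1; have K2 := kap2 (ltW k1); have p0 := pi_gt0 R.
rewrite /hol (full_turn k1).2.
have Kq : kap k * (pi / kap k) = pi by field; rewrite gt_eqF.
have Q0 : 0 < pi / kap k by rewrite divr_gt0.
have kk : 2 * k <= 3 * kap k by nra.
rewrite (_ : k * (2 * pi / kap k) = 2 * k * (pi / kap k)); last by ring.
have : 2 * k * (pi / kap k) <= 3 * kap k * (pi / kap k) by rewrite ler_pM2r.
by lra.
Qed.

(** [hol k x = pi] says that [k * x / 2 = om k x + pi / 2]. *)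
Lemma system_of_hol_pi k x : 0 <= x -> hol k x = pi ->
  let s := sn (1 - k ^+ 2) x in let r := Num.sqrt (1 + s ^+ 2) in
  cos (k * x / 2) = - (k * s / r) /\ sin (k * x / 2) = cn (1 - k ^+ 2) x / r.
Proof.
move=> x0 H s r; have [E1 E2] := om_cos_sin k x0; rewrite -/s -/r in E1 E2.
have r0 : r != 0 by rewrite gt_eqF// sqrtr_gt0 sqr1_gt0.
have -> : k * x / 2 = om k x + pi / 2 by move: H; rewrite /hol; lra.
rewrite cosDpihalf sinDpihalf E1 E2; split; first by rewrite mulrC mulKf.
by rewrite mulrC mulKf.
Qed.

End CutTimes.

(** * The equations of the cut time *)

Section Systems.
Context {R : realType}.
Variables alpha2 beta T : R.
Hypothesis alpha2_lt1 : alpha2 ^+ 2 < 1.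
Hypothesis T0 : 0 < T.
Let a := Num.sqrt (1 - alpha2 ^+ 2).
Let k := `|beta| / a.

Let a0 : 0 < a. Proof. by rewrite sqrtr_gt0 subr_gt0. Qed.
Let a2 : 1 - alpha2 ^+ 2 = a ^+ 2. Proof. by rewrite sqr_sqrtr// subr_ge0 ltW. Qed.
Let betaE : `|beta| = k * a. Proof. by rewrite divfK ?gt_eqF. Qed.
Let beta2 : beta ^+ 2 = k ^+ 2 * a ^+ 2.
Proof. by rewrite -exprMn -betaE real_normK// num_real. Qed.
Let aT0 : 0 <= a * T. Proof. by rewrite mulr_ge0 ?ltW. Qed.

Let sqrt_scale (x : R) : Num.sqrt (a ^+ 2 * x) = a * Num.sqrt x.
Proof. by rewrite sqrtrM ?sqr_ge0// sqrtr_sqr ger0_norm// ltW. Qed.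

Let half_angle : `|beta| * T / 2 = k * (a * T) / 2.
Proof. by rewrite betaE; ring. Qed.

Lemma system_lt1_of_hol_pi : 0 < k -> k < 1 -> hol k (a * T) = pi ->
  system_lt1 alpha2 beta T.
Proof.
move=> k0 k1 /(system_of_hol_pi aT0)/=; rewrite -half_angle => -[Hc Hs].
rewrite /system_lt1 Hc Hs; have c0 : 0 < 1 - k ^+ 2 by nra.
set s := sn _ _; set r := Num.sqrt (1 + s ^+ 2).
pose q := Num.sqrt (1 - k ^+ 2); have q0 : 0 < q by rewrite sqrtr_gt0.
have q2 : q ^+ 2 = 1 - k ^+ 2 by rewrite sqr_sqrtr// ltW.
have -> : Num.sqrt (1 - alpha2 ^+ 2 - beta ^+ 2) = a * q.
  by rewrite a2 beta2 -sqrt_scale; congr Num.sqrt; ring.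
have tE : T * (a * q) / 2 = q * (a * T) / 2 by ring.
have sE : s = sinh (T * (a * q) / 2) / q by rewrite tE /s /sn c0.
have hE : cn (1 - k ^+ 2) (a * T) = cosh (T * (a * q) / 2) by rewrite tE /cn c0.
have h2 := cn_sn (1 - k ^+ 2) (a * T); rewrite -/s in h2.
have -> : Num.sqrt ((1 - alpha2 ^+ 2) * cosh (T * (a * q) / 2) ^+ 2 - beta ^+ 2) =
    a * (q * r).
  rewrite a2 beta2 -hE h2 (_ : _ - _ = a ^+ 2 * ((1 - k ^+ 2) * (1 + s ^+ 2))); last by ring.
  by rewrite sqrt_scale sqrtrM// ltW.
have r0 : r != 0 by rewrite gt_eqF// sqrtr_gt0 sqr1_gt0.
clearbody r; rewrite hE betaE sE.
by split; field; rewrite r0 !gt_eqF.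
Qed.

Lemma system_eq1_of_hol_pi : k = 1 -> hol k (a * T) = pi -> system_eq1 beta T.
Proof.
move=> k1 /(system_of_hol_pi aT0)/=; rewrite -half_angle => -[Hc Hs].
rewrite /system_eq1 Hc Hs k1 expr1n subrr /sn /cn !ltxx.
have -> : 1 + beta ^+ 2 * T ^+ 2 / 4 = 1 + (a * T / 2) ^+ 2 by rewrite beta2 k1; field.
by rewrite betaE k1 !mul1r.
Qed.

Lemma system_gt1_of_hol_pi : 1 < k -> hol k (a * T) = pi ->
  system_gt1 alpha2 beta T.
Proof.
move=> k1 /(system_of_hol_pi aT0)/=; rewrite -half_angle => -[Hc Hs].
rewrite /system_gt1 Hc Hs; have K := kap_gt0 k1; have K2 := kap2 (ltW k1).
have [sE hE] := sn_cn_circle (a * T) k1; move: sE hE.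
set s := sn _ _; set r := Num.sqrt (1 + s ^+ 2) => sE hE.
have wE : Num.sqrt (alpha2 ^+ 2 + beta ^+ 2 - 1) = a * kap k.
  rewrite /kap -sqrt_scale; congr Num.sqrt.
  by rewrite beta2; move: a2 => /(canRL (subrK _)) a2'; lra.
rewrite wE; have tE : T * (a * kap k) / 2 = kap k * (a * T) / 2 by ring.
rewrite tE.
have h2 := cn_sn (1 - k ^+ 2) (a * T); rewrite -/s in h2.
have -> : Num.sqrt (beta ^+ 2 - (1 - alpha2 ^+ 2) * cos (kap k * (a * T) / 2) ^+ 2) =
    a * (kap k * r).
  rewrite a2 beta2 -hE h2 (_ : _ - _ = a ^+ 2 * ((k ^+ 2 - 1) * (1 + s ^+ 2))); last by ring.
  by rewrite sqrt_scale sqrtrM// -K2 sqr_ge0.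
have r0 : r != 0 by rewrite gt_eqF// sqrtr_gt0 sqr1_gt0.
clearbody r; rewrite hE betaE sE.
by split; field; rewrite r0 !gt_eqF.
Qed.

End Systems.

Lemma lt_quotient_sqrt (R : realType) (r c n : R) : 0 <= r -> 0 <= c -> 0 < n ->
  (r < c / Num.sqrt n) = (r ^+ 2 < c ^+ 2 / n).
Proof.
move=> r0 c0 n0; rewrite -[in RHS](sqr_sqrtr (ltW n0)) -expr_div_n ltr_pXn2r//.
by rewrite nnegrE divr_ge0// sqrtr_ge0.
Qed.

Theorem theorem10 (R : realType) (phi0 alpha2 beta T : R)
    (halpha2 : -1 < alpha2 < 1) (hbeta : beta != 0) (hT : 0 < T)
    (hgamma : noncontinuable_shortest_arc T (gamma2 phi0 alpha2 beta)) :
  let r := `|beta| / Num.sqrt (1 - alpha2 ^+ 2) in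
  [/\ (0 < r < 1 ->
        pi / `|beta| < T < 2 * pi / `|beta| /\ system_lt1 alpha2 beta T),
      (r = 1 ->
        pi / `|beta| < T < 2 * pi / `|beta| /\ system_eq1 beta T),
      (1 < r < 2 / Num.sqrt 3 ->
        pi / `|beta| < T < 2 * pi / `|beta| /\ system_gt1 alpha2 beta T) &
      [/\ (r = 2 / Num.sqrt 3 -> T = 2 * pi / `|beta|),
          (2 / Num.sqrt 3 < r < 3 / Num.sqrt 5 ->
            2 * pi / `|beta| < T < 3 * pi / `|beta| /\
            system_gt1 alpha2 beta T) &
          (3 / Num.sqrt 5 <= r ->
            T = 2 * pi / Num.sqrt (beta ^+ 2 + alpha2 ^+ 2 - 1))]].
Proof.
have al1 : alpha2 ^+ 2 < 1 by case/andP: halpha2 => h1 h2; nra.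
set a := Num.sqrt (1 - alpha2 ^+ 2); move=> k.
have a0 : 0 < a by rewrite sqrtr_gt0 subr_gt0.
have k0 : 0 < k by rewrite divr_gt0// normr_gt0.
have p0 := pi_gt0 R.
have betaE : `|beta| = k * a by rewrite divfK ?gt_eqF.
have cut x : 0 < x -> (1 < k -> x <= 2 * pi / kap k) -> hol k x <= pi ->
    hol k x = pi \/ (1 < k /\ x = 2 * pi / kap k) -> a * T = x.
  move=> x0; have -> : x = a * (x / a) by rewrite mulrC divfK// gt_eqF.
  move=> H1 H2 H3; rewrite (cut_time al1 hbeta hT hgamma _ H1 H2 H3)//.
  by rewrite divr_gt0.
have scale z x : x = z * pi / k -> z * pi / `|beta| = x / a.
  by move=> ->; rewrite betaE; field; rewrite !gt_eqF.
have TE x : a * T = x -> T = x / a by move=> <-; rewrite mulrC mulKf// gt_eqF.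
have interval z w x : z * pi / k < x < w * pi / k -> a * T = x ->
    z * pi / `|beta| < T < w * pi / `|beta|.
  move=> /andP[h1 h2] /TE ->; rewrite (scale z _ erefl) (scale w _ erefl).
  by rewrite !ltr_pM2r ?invr_gt0// h1.
have first_interval : (1 < k -> k ^+ 2 < 4 / 3) ->
    pi / `|beta| < T < 2 * pi / `|beta| /\ hol k (a * T) = pi.
  move=> k43; have [x xI [Hx xk]] := cut_time_first_interval k0 k43.
  have aTx : a * T = x.
    apply: cut; [|move=> k1|by rewrite Hx|by left].
    - by case/andP: xI => + _; apply: lt_trans; rewrite divr_gt0.
    - exact: le_trans (xk k1) (half_le_full k1).
  split; last by rewrite aTx.
  by rewrite -[X in X / _ < _]mul1r; apply: interval aTx; rewrite mul1r.
have lt43 : (k < 2 / Num.sqrt 3) = (k ^+ 2 < 4 / 3).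
  by rewrite lt_quotient_sqrt ?(ltW k0)//; congr (_ < _ / _); ring.
have gt43 : 2 / Num.sqrt 3 < k -> 4 / 3 < k ^+ 2.
  move=> h; rewrite lt_neqAle leNgt -lt43 -leNgt (ltW h) andbT; apply/eqP => E.
  move: h; rewrite -[X in _ < X](ger0_norm (ltW k0)) -sqrtr_sqr -E.
  by rewrite sqrtrM// sqrtrV// (_ : 4 = 2 ^+ 2) ?sqrtr_sqr ?ger0_norm ?ltxx//; ring.
have lt95 : (k < 3 / Num.sqrt 5) = (k ^+ 2 < 9 / 5).
  by rewrite lt_quotient_sqrt ?(ltW k0)//; congr (_ < _ / _); ring.
split.
- move=> /andP[_ k1]; have [|I H] := first_interval.
    by move=> k1'; have := lt_trans k1 k1'; rewrite ltxx.
  by split => //; apply: system_lt1_of_hol_pi.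
- move=> k1; have [|I H] := first_interval; first by rewrite k1 ltxx.
  by split => //; apply: (system_eq1_of_hol_pi (alpha2 := alpha2)).
- move=> /andP[k1 kl]; have [|I H] := first_interval; first by rewrite -lt43.
  by split => //; apply: system_gt1_of_hol_pi.
split.
- move=> kE; have k2 : k ^+ 2 = 4 / 3.
    by rewrite kE expr_div_n sqr_sqrtr//; congr (_ / _); ring.
  have k1 : 1 < k by nra.
  have [E H] := hol_half_turn k1 k2.
  rewrite (scale 2 _ erefl); apply: TE; apply: cut; [| |by rewrite H|by left].
  + by rewrite divr_gt0// mulr_gt0.
  + by move=> _; rewrite E half_le_full.
- move=> /andP[kl kh]; have kl' := gt43 kl; rewrite lt95 in kh.
  have k1 : 1 < k by nra.
  have [x xI [Hx xk]] := cut_time_second_interval k1 kl' kh.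
  have aTx : a * T = x.
    apply: cut; [|by move=> _|by rewrite Hx|by left].
    by case/andP: xI => + _; apply: lt_trans; rewrite divr_gt0// mulr_gt0.
  split; first exact: interval aTx.
  by apply: system_gt1_of_hol_pi => //; rewrite -/a -/k aTx.
- rewrite leNgt lt95 -leNgt => kE; have k1 : 1 < k by nra.
  have K := kap_gt0 k1.
  have -> : Num.sqrt (beta ^+ 2 + alpha2 ^+ 2 - 1) = a * kap k.
    rewrite /kap -[a](ger0_norm (ltW a0)) -sqrtr_sqr -sqrtrM ?sqr_ge0//; congr Num.sqrt.
    have -> : beta ^+ 2 = k ^+ 2 * a ^+ 2.
      by rewrite -exprMn -betaE real_normK// num_real.
    by rewrite sqr_sqrtr ?subr_ge0 ?ltW//; ring.
  rewrite (TE (2 * pi / kap k)); first by field; rewrite !gt_eqF.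
  apply: cut; [by rewrite divr_gt0// mulr_gt0|by []|exact: hol_full_turn_le|by right].
Qed.
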